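(* Let $D$ be the germ of a reduced complex analytic curve with $p$ irreducible components, with local ring $\mathcal{O}_D$ and conductor $\gamma\in\mathbb{N}^p$. Then the ring $\mathcal{O}_D$ is a Gorenstein ring if and only if for every fractional ideal $I\subset Q(\mathcal{O}_D)$ the following property is satisfied for all $v\in\mathbb{Z}^p$: $$v\in \mathrm{val}(I^\vee)\iff \Delta(\gamma-v-\underline{1},\mathrm{val}(I))=\emptyset.$$
   Context: Let $D=D_1\cup\dots\cup D_p$ be the germ of a reduced complex analytic curve with irreducible components $D_1,\dots,D_p$; $Q(\mathcal{O}_D)$ is the total ring of fractions of $\mathcal{O}_D$. The normalization of $\mathcal{O}_D$ is $\mathcal{O}_{\widetilde{D}}=\bigoplus_{i=1}^p\mathbb{C}\{t_i\}$ and $Q(\mathcal{O}_D)=Q(\mathcal{O}_{\widetilde D})=\bigoplus_{i=1}^p Q(\mathbb{C}\{t_i\})$. For $g\in Q(\mathcal{O}_D)$, $\mathrm{val}_i(g)\in\mathbb{Z}\cup\{\infty\}$ is the order in $t_i$ of the image of $g$ in $Q(\mathbb{C}\{t_i\})$ (with $\mathrm{val}_i(0)=\infty$), and $\mathrm{val}(g)=(\mathrm{val}_1(g),\dots,\mathrm{val}_p(g))$. A fractional ideal is a finitely generated $\mathcal{O}_D$-submodule $I\subset Q(\mathcal{O}_D)$ containing a non zero divisor of $Q(\mathcal{O}_D)$. Its set of values is $\mathrm{val}(I)=\{\mathrm{val}(g): g\in I \text{ non zero divisor}\}\subset\mathbb{Z}^p$, and its dual is $I^\vee=\mathrm{Hom}_{\mathcal{O}_D}(I,\mathcal{O}_D)\simeq\{g\in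 Q(\mathcal{O}_D): g\cdot I\subseteq\mathcal{O}_D\}$. $\mathbb{Z}^p$ carries the product order. The conductor of $D$ is $\gamma=\inf\{\alpha\in\mathbb{N}^p:\alpha+\mathbb{N}^p\subseteq\mathrm{val}(\mathcal{O}_D)\}$; equivalently $\mathcal{O}_{\widetilde D}^\vee=t^\gamma\mathcal{O}_{\widetilde D}$, where $t^\alpha=(t_1^{\alpha_1},\dots,t_p^{\alpha_p})$. We write $\underline{1}=(1,\dots,1)$. For $\mathcal{E}\subseteq\mathbb{Z}^p$, $v\in\mathbb{Z}^p$ and $i\in\{1,\dots,p\}$, set $\Delta_i(v,\mathcal{E})=\{\alpha\in\mathcal{E}: \alpha_i=v_i \text{ and } \alpha_j>v_j\ \forall j\neq i\}$ and $\Delta(v,\mathcal{E})=\bigcup_{i=1}^p\Delta_i(v,\mathcal{E})$. *)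

(* Defs.v *)
From HB Require Import structures.
From mathcomp Require Import all_boot all_order all_algebra complex.
From mathcomp Require Import boolp classical_sets functions reals.
From mathcomp Require Import constructive_ereal.
(* The notations of mpoly clash with those of classical_sets. *)
From mathcomp Require Import -(notations) mpoly.

Set Implicit Arguments.
Unset Strict Implicit.
Unset Printing Implicit Defensive.

Import Order.TTheory GRing.Theory Num.Theory.

Local Open Scope ring_scope.
Local Open Scope classical_set_scope.

Record fps (n : nat) (K : Type) := Fps { fps_coef : multinom n -> K }.

Lemma fps_eqP n K (a b : fps n K) : fps_coef a =1 fps_coef b -> a = b.
Proof. by case: a b => [a] [b] /= /funext ->. Qed.

HB.instance Definition _ n K := gen_eqMixin (fps n K).
HB.instance Definition _ n K := gen_choiceMixin (fps n K).

Section FpsRing.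
Variables (n : nat) (K : comNzRingType).
Local Notation fps := (fps n K).
Implicit Types a b c : fps.

Definition fps_add a b := Fps (fun m => fps_coef a m + fps_coef b m).
Definition fps_opp a := Fps (fun m => - fps_coef a m).
Definition fps_scale (x : K) a := Fps (fun m => x * fps_coef a m).
Definition fps_one : fps := Fps (fun m => (m == @mnm0 n)%:R).
Definition fps_mul a b := Fps (fun m =>
  \sum_(k : bmultinom n (mdeg m).+1 * bmultinom n (mdeg m).+1
         | m == mnm_add k.1 k.2) fps_coef a k.1 * fps_coef b k.2).

Fact fps_addA : associative fps_add.
Proof. by move=> a b c; apply: fps_eqP => m /=; rewrite addrA. Qed.
Fact fps_addC : commutative fps_add.
Proof. by move=> a b; apply: fps_eqP => m /=; rewrite addrC. Qed.
Fact fps_add0 : left_id (Fps (fun=> 0)) fps_add.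
Proof. by move=> a; apply: fps_eqP => m /=; rewrite add0r. Qed.
Fact fps_addN : left_inverse (Fps (fun=> 0)) fps_opp fps_add.
Proof. by move=> a; apply: fps_eqP => m /=; rewrite addNr. Qed.

HB.instance Definition _ := GRing.isZmodule.Build fps
  fps_addA fps_addC fps_add0 fps_addN.

Definition fps_trunc (N : nat) a : mpoly n K :=
  \sum_(m : bmultinom n N) fps_coef a m *: mpolyX K m.

Lemma fps_truncE N a m : (mdeg m < N)%N -> mcoeff m (fps_trunc N a) = fps_coef a m.
Proof. exact: (mcoeff_mpoly (fps_coef a)). Qed.

Lemma fps_mulE a b m (p q : mpoly n K) :
  (forall k, mdeg k <= mdeg m -> mcoeff k p = fps_coef a k)%N ->
  (forall k, mdeg k <= mdeg m -> mcoeff k q = fps_coef b k)%N ->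
  fps_coef (fps_mul a b) m = mcoeff m (p * q).
Proof.
move=> hp hq; rewrite mcoeffM /=; apply: eq_bigr => -[k l] /= _.
by rewrite hp ?hq // -ltnS bmdeg.
Qed.

Lemma fps_mulC : commutative fps_mul.
Proof.
move=> a b; apply: fps_eqP => m.
have h c k : (mdeg k <= mdeg m)%N ->
  mcoeff k (fps_trunc (mdeg m).+1 c) = fps_coef c k.
  by move=> km; rewrite fps_truncE.
by rewrite !(fps_mulE (h _) (h _)) mulrC.
Qed.

Lemma fps_mulA : associative fps_mul.
Proof.
move=> a b c; apply: fps_eqP => m.
have h d k : (mdeg k <= mdeg m)%N ->
  mcoeff k (fps_trunc (mdeg m).+1 d) = fps_coef d k.
  by move=> km; rewrite fps_truncE.
have h2 d e k : (mdeg k <= mdeg m)%N ->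
  mcoeff k (fps_trunc (mdeg m).+1 d * fps_trunc (mdeg m).+1 e)
  = fps_coef (fps_mul d e) k.
  by move=> km; rewrite -(@fps_mulE d e) // => l lk; apply: h (leq_trans lk km).
by rewrite (fps_mulE (h _) (h2 _ _)) (fps_mulE (h2 _ _) (h _)) mulrA.
Qed.

Lemma fps_mul1 : left_id fps_one fps_mul.
Proof.
move=> a; apply: fps_eqP => m.
have h c k : (mdeg k <= mdeg m)%N ->
  mcoeff k (fps_trunc (mdeg m).+1 c) = fps_coef c k.
  by move=> km; rewrite fps_truncE.
rewrite (@fps_mulE _ _ _ 1 _ _ (h a)) ?mul1r ?h // => k _.
by rewrite mcoeff1.
Qed.

Lemma fps_mulDl : left_distributive fps_mul +%R.
Proof.
move=> a b c; apply: fps_eqP => m /=; rewrite -big_split /=.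
by apply: eq_bigr => k _; rewrite mulrDl.
Qed.

Lemma fps_one_neq0 : fps_one != 0.
Proof.
apply/eqP => /(congr1 (fun a => fps_coef a (@mnm0 n))) /= /eqP.
by rewrite eqxx oner_eq0.
Qed.

HB.instance Definition _ := GRing.Zmodule_isComNzRing.Build fps
  fps_mulA fps_mulC fps_mul1 fps_mulDl fps_one_neq0.

Fact fps_scaleA x y a : fps_scale x (fps_scale y a) = fps_scale (x * y) a.
Proof. by apply: fps_eqP => m /=; rewrite mulrA. Qed.
Fact fps_scale1 : left_id 1 fps_scale.
Proof. by move=> a; apply: fps_eqP => m /=; rewrite mul1r. Qed.
Fact fps_scaleDr : right_distributive fps_scale +%R.
Proof. by move=> x a b; apply: fps_eqP => m /=; rewrite mulrDr. Qed.
Fact fps_scaleDl a : {morph fps_scale^~ a : x y / x + y}.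
Proof. by move=> x y; apply: fps_eqP => m /=; rewrite mulrDl. Qed.

HB.instance Definition _ := GRing.Zmodule_isLmodule.Build K fps
  fps_scaleA fps_scale1 fps_scaleDr fps_scaleDl.

Fact fps_scaleAl (x : K) a b : x *: (a * b) = (x *: a) * b.
Proof.
apply: fps_eqP => m /=; rewrite mulr_sumr.
by apply: eq_bigr => k _; rewrite mulrA.
Qed.

HB.instance Definition _ := GRing.Lmodule_isLalgebra.Build K fps fps_scaleAl.
HB.instance Definition _ := GRing.Lalgebra_isComAlgebra.Build K fps.

End FpsRing.

(* [fps_norm_le a r M] says that the sum of the |a_m| r^|m|, over all
   multi-indices m, is at most M. In a numFieldType such as R[i],
   [0 < r] forces r to be a positive real. *)
Definition fps_norm_le n (K : numFieldType) (a : fps n K) (r M : K) : Prop :=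
  forall N, \sum_(m : bmultinom n N) `|fps_coef a m| * r ^+ mdeg m <= M.

Definition convergent n (K : numFieldType) : {pred fps n K} :=
  fun a => `[< exists r M : K, 0 < r /\ fps_norm_le a r M >].
Arguments convergent : clear implicits.

Section Convergent.
Variables (n : nat) (K : numFieldType).
Implicit Types a b : fps n K.

Lemma convergentP a :
  reflect (exists r M : K, 0 < r /\ fps_norm_le a r M) (a \in convergent n K).
Proof. exact: asboolP. Qed.

Lemma fps_norm_le_ge0 a r M : 0 < r -> fps_norm_le a r M -> 0 <= M.
Proof.
move=> r0 /(_ 0%N); apply: le_trans; apply: sumr_ge0 => m _.
by rewrite mulr_ge0 // exprn_ge0 // ltW.
Qed.

Lemma fps_norm_le_mono a r s M :
  0 <= s -> s <= r -> fps_norm_le a r M -> fps_norm_le a s M.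
Proof.
move=> s0 sr ha N; apply: le_trans (ha N); apply: ler_sum => m _.
by rewrite ler_wpM2l // lerXn2r // nnegrE // (le_trans s0).
Qed.

Lemma fps_common_radius a b r s M M' :
  0 < r -> 0 < s -> fps_norm_le a r M -> fps_norm_le b s M' ->
  exists2 t : K, 0 < t & fps_norm_le a t M /\ fps_norm_le b t M'.
Proof.
move=> r0 s0 ha hb.
have /orP[rs|sr] : r >=< s by apply: real_comparable; apply: gtr0_real.
  by exists r => //; split => //; apply: fps_norm_le_mono hb => //; apply: ltW.
by exists s => //; split => //; apply: fps_norm_le_mono ha => //; apply: ltW.
Qed.

Lemma fps_norm_leD a b r M M' :
  0 < r -> fps_norm_le a r M -> fps_norm_le b r M' ->
  fps_norm_le (a + b) r (M + M').
Proof.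
move=> r0 ha hb N; apply: le_trans (lerD (ha N) (hb N)).
rewrite -big_split; apply: ler_sum => m _ /=.
by rewrite -mulrDl ler_wpM2r ?exprn_ge0 ?(ltW r0) //; apply: ler_normD.
Qed.

Lemma fps_norm_leM a b r M M' :
  0 < r -> fps_norm_le a r M -> fps_norm_le b r M' ->
  fps_norm_le (a * b) r (M * M').
Proof.
move=> r0 ha hb N.
have M0 := fps_norm_le_ge0 r0 ha.
pose A (m : multinom n) := `|fps_coef a m| * r ^+ mdeg m.
pose B (m : multinom n) := `|fps_coef b m| * r ^+ mdeg m.
have A0 m : 0 <= A m by rewrite mulr_ge0 // exprn_ge0 // ltW.
have B0 m : 0 <= B m by rewrite mulr_ge0 // exprn_ge0 // ltW.
apply: (@le_trans _ _ ((\sum_(k : bmultinom n N) A k) *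
                       (\sum_(l : bmultinom n N) B l))); last first.
  by apply: ler_pM; [exact: sumr_ge0 | exact: sumr_ge0 | exact: ha | exact: hb].
rewrite mulr_suml; under [leRHS]eq_bigr do rewrite mulr_sumr.
rewrite pair_bigA /=.
have sumE (m : bmultinom n N) :
    `|fps_coef (a * b) m| * r ^+ mdeg m <=
    \sum_(k : bmultinom n N * bmultinom n N | bmnm m == mnm_add k.1 k.2)
      A k.1 * B k.2.
  have h (c : fps n K) k : (mdeg k <= mdeg m)%N ->
      mcoeff k (fps_trunc N c) = fps_coef c k.
    by move=> km; rewrite fps_truncE // (leq_ltn_trans km) // bmdeg.
  rewrite (fps_mulE (h a) (h b)).
  rewrite (@mcoeff_poly_mul _ _ _ _ _ N) ?bmdeg //.
  have := ler_norm_sum (index_enum (bmultinom n N * bmultinom n N)%type)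
    (fun k => mcoeff (bmnm k.1) (fps_trunc N a) *
              mcoeff (bmnm k.2) (fps_trunc N b))
    (fun k => bmnm m == mnm_add (bmnm k.1) (bmnm k.2)).
  move=> /(ler_wpM2r (exprn_ge0 (mdeg m) (ltW r0))) /le_trans; apply.
  rewrite mulr_suml; apply: ler_sum => -[k l] /= /eqP mE.
  rewrite mE mdegD exprD normrM !fps_truncE ?bmdeg //.
  by rewrite mulrACA.
apply: le_trans (ler_sum _ (fun m _ => sumE m)) _.
rewrite (exchange_big_dep predT) //=; apply: ler_sum => -[k l] _ /=.
have AB0 : 0 <= A k * B l by rewrite mulr_ge0.
case: (boolP [exists m : bmultinom n N, bmnm m == mnm_add k l]); last first.
  move=> /existsPn h; rewrite big_pred0 // => m; exact/negbTE/h.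
move=> /existsP[m0 /eqP hm0]; rewrite (big_pred1 m0) // => m /=.
by rewrite -hm0.
Qed.

Lemma fps_norm_leZ x a r M :
  fps_norm_le a r M -> fps_norm_le (x *: a) r (`|x| * M).
Proof.
move=> ha N; apply: le_trans (ler_wpM2l (normr_ge0 x) (ha N)).
by rewrite mulr_sumr; apply: ler_sum => m _ /=; rewrite normrM mulrA.
Qed.

Lemma fps_norm_le1 : fps_norm_le (1 : fps n K) 1 1.
Proof.
move=> N; case: N => [|N].
  by rewrite big1 ?ler01 // => m; have := bmdeg m; rewrite ltn0.
rewrite (bigD1 (@bm0 n N)) //= big1 => [|m /negbTE mN0].
  by rewrite expr1n mulr1 addr0 eqxx normr1.
by rewrite -[_ == @mnm0 n]/(m == @bm0 n N) mN0 normr0 mul0r.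
Qed.

Fact convergent_subalg : subalg_closed (convergent n K).
Proof.
split=> [|x a b /convergentP[r [M [r0 ha]]] /convergentP[s [M' [s0 hb]]]
         |a b /convergentP[r [M [r0 ha]]] /convergentP[s [M' [s0 hb]]]].
- by apply/convergentP; exists 1, 1; split=> //; apply: fps_norm_le1.
- have [t t0 [ha' hb']] := fps_common_radius r0 s0 ha hb.
  apply/convergentP; exists t, (`|x| * M + M'); split=> //.
  by apply: fps_norm_leD => //; apply: fps_norm_leZ.
- have [t t0 [ha' hb']] := fps_common_radius r0 s0 ha hb.
  by apply/convergentP; exists t, (M * M'); split=> //; apply: fps_norm_leM.
Qed.

HB.instance Definition _ :=
  GRing.isSubalgClosed.Build K (fps n K) (convergent n K) convergent_subalg.

End Convergent.

Record cps (n : nat) (K : numFieldType) :=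
  Cps { cps_val : fps n K; cps_valP : cps_val \in convergent n K }.

HB.instance Definition _ n K := [isSub for @cps_val n K].
HB.instance Definition _ n K := [Choice of cps n K by <:].
HB.instance Definition _ n K :=
  [SubChoice_isSubAlgebra of cps n K by <:].
HB.instance Definition _ n K :=
  [SubNzRing_isSubComNzRing of cps n K by <:].

(* The least total degree of a monomial of [a]; 0 when [a = 0]. *)
Definition fps_ord n (K : nmodType) (a : fps n K) : nat :=
  if pselect (exists d, `[< exists2 m, mdeg m = d & fps_coef a m != 0 >])
  is left h then ex_minn h else 0%N.

Lemma fps_ordP n (K : comNzRingType) (a : fps n K) : a != 0 ->
  (exists2 m, mdeg m = fps_ord a & fps_coef a m != 0) /\
  (forall m, (mdeg m < fps_ord a)%N -> fps_coef a m = 0).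
Proof.
move=> a0; rewrite /fps_ord; case: pselect => [h|nh]; last first.
  case/eqP: a0; apply: fps_eqP => m /=; apply: contrapT => /eqP am.
  by apply: nh; exists (mdeg m); apply/asboolP; exists m.
case: ex_minnP => d /asboolP hd dmin; split=> // m md.
apply: contrapT => /eqP am; move: md; rewrite ltnNge => /negP; apply.
by apply: dmin; apply/asboolP; exists m.
Qed.

Lemma fps_mul_eq0 n (K : idomainType) (a b : fps n K) :
  a * b = 0 -> (a == 0) || (b == 0).
Proof.
move=> ab0; apply: contrapT => /negP; rewrite negb_or => /andP[a0 b0].
have [[ma mda ama] amin] := fps_ordP a0; have [[mb mdb bmb] bmin] := fps_ordP b0.
set d := fps_ord a in mda amin; set e := fps_ord b in mdb bmin.
pose p := fps_trunc d.+1 a; pose q := fps_trunc e.+1 b.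
have truncE N (c : fps n K) m :
    mcoeff m (fps_trunc N.+1 c) = if (mdeg m <= N)%N then fps_coef c m else 0.
  case: ifPn => [mN|]; first by rewrite fps_truncE.
  rewrite -ltnNge => mN; rewrite /fps_trunc raddf_sum big1 // => k _.
  rewrite /= mcoeffZ mcoeffX; case: eqP => [km|_]; last by rewrite mulr0.
  by have := bmdeg k; rewrite km ltnNge mN.
have p0 : p != 0.
  apply/eqP => /(congr1 (mcoeff ma)); rewrite mcoeff0 truncE mda leqnn.
  exact/eqP.
have q0 : q != 0.
  apply/eqP => /(congr1 (mcoeff mb)); rewrite mcoeff0 truncE mdb leqnn.
  exact/eqP.
have pE m : mdeg m != d -> mcoeff m p = 0.
  rewrite neq_ltn truncE => /orP[md|dm]; last by rewrite leqNgt dm.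
  by rewrite (ltnW md) amin.
have qE m : mdeg m != e -> mcoeff m q = 0.
  rewrite neq_ltn truncE => /orP[md|dm]; last by rewrite leqNgt dm.
  by rewrite (ltnW md) bmin.
case/eqP: (mulf_neq0 p0 q0); apply/mpolyP => m; rewrite mcoeff0.
have := congr1 (fun c => fps_coef c m) ab0; rewrite /= => abm.
rewrite mcoeffM.
have [mde|mde] := eqVneq (mdeg m) (d + e)%N; last first.
  rewrite big1 // => -[k l] /= /eqP mE.
  have [kd|kd] := eqVneq (mdeg k) d; last by rewrite pE ?mul0r.
  rewrite [X in _ * X]qE ?mulr0 //; apply: contra mde => /eqP le.
  by rewrite mE mdegD kd le.
rewrite -[RHS]abm; apply: eq_bigr => -[k l] /= /eqP mE.
have kl : (mdeg k + mdeg l)%N = (d + e)%N by rewrite -mdegD -mE.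
case: (ltngtP (mdeg k) d) => kd.
- by rewrite pE ?neq_ltn ?kd // amin // !mul0r.
- have le : (mdeg l < e)%N by rewrite -(ltn_add2l d) -kl ltn_add2r.
  by rewrite qE ?neq_ltn ?le // bmin // !mulr0.
- have le : mdeg l = e by apply/eqP; rewrite -(eqn_add2l d) -kl kd.
  by rewrite !truncE kd le !leqnn.
Qed.

Section ConvergentDomain.
Variables (n : nat) (K : numFieldType).
Local Notation cps := (cps n K).

Definition cps_unit : {pred cps} := fun a => `[< exists b, b * a = 1 >].
Definition cps_inv (a : cps) : cps :=
  if pselect (exists b, b * a = 1) is left h then sval (cid h) else a.

Fact cps_mulVx : {in cps_unit, left_inverse 1 cps_inv *%R}.
Proof.
by move=> a /asboolP ua; rewrite /cps_inv; case: pselect => // h; case: cid.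
Qed.
Fact cps_unitPl (a b : cps) : b * a = 1 -> cps_unit a.
Proof. by move=> ba; apply/asboolP; exists b. Qed.
Fact cps_inv_out : {in [predC cps_unit], cps_inv =1 id}.
Proof.
by move=> a /asboolP ua; rewrite /cps_inv; case: pselect => // h; case: ua.
Qed.

HB.instance Definition _ := GRing.ComNzRing_hasMulInverse.Build cps
  cps_mulVx cps_unitPl cps_inv_out.

Fact cps_mul_eq0 : GRing.integral_domain_axiom cps.
Proof.
move=> a b ab0; rewrite -!(inj_eq val_inj) /=; apply: fps_mul_eq0.
by rewrite -[LHS](rmorphM (val : cps -> fps n K)) ab0.
Qed.

HB.instance Definition _ := GRing.ComUnitRing_isIntegral.Build cps cps_mul_eq0.

End ConvergentDomain.

(* The value of a numerator/denominator pair does not depend on the pair, so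
   the one chosen by [repr] is as good as any other. *)
Definition frac_val (K : numFieldType) (q : {fraction cps 1 K}) : \bar int :=
  if q == 0 then +oo%E
  else ((fps_ord (cps_val \n_(repr q)))%:Z
        - (fps_ord (cps_val \d_(repr q)))%:Z)%:E.

Section CommutativeAlgebra.
Variable A : comNzRingType.
Implicit Types I J P M : {pred A}.

Definition prime_ideal P : Prop := idealr_closed P /\ prime_idealr_closed P.

Definition minimal_prime P : Prop :=
  prime_ideal P /\
  forall P', prime_ideal P' -> {subset P' <= P} -> P' =i P.

(* [idealr_closed] only holds of proper ideals. *)
Definition maximal_ideal M : Prop :=
  idealr_closed M /\
  forall J, idealr_closed J -> {subset M <= J} -> J =i M.

Definition local_ring : Prop :=
  exists2 M, maximal_ideal M & forall M', maximal_ideal M' -> M' =i M.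

(* The unit ideal, which [idealr_closed] excludes, is generated by 1. *)
Definition noetherian : Prop :=
  forall I, idealr_closed I -> exists s : seq A, forall x,
    x \in I <-> exists c : 'I_(size s) -> A, x = \sum_k c k * s`_k.

Definition reduced : Prop := forall (x : A) k, x ^+ k = 0 -> x = 0.

(* A chain of primes P_0 < ... < P_d of A that contain P, i.e. a chain of
   length d in A/P. *)
Definition prime_chain_above P (d : nat) : Prop :=
  exists c : nat -> {pred A},
    (forall i, (i <= d)%N -> prime_ideal (c i) /\ {subset P <= c i}) /\
    (forall i, (i < d)%N -> {subset c i <= c i.+1} /\ ~ c i =i c i.+1).

Definition quotient_dim P (d : nat) : Prop :=
  prime_chain_above P d /\ forall d', prime_chain_above P d' -> (d' <= d)%N.

Definition injective_module (E : lmodType A) : Prop :=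
  forall (M N : lmodType A) (f : {linear M -> N}) (g : {linear M -> E}),
    injective f -> exists h : {linear N -> E}, forall x, h (f x) = g x.

Definition exact_at (L M N : lmodType A)
    (f : {linear L -> M}) (g : {linear M -> N}) : Prop :=
  forall y, g y = 0 <-> exists x, y = f x.

(* There is an injective resolution 0 -> M -> E^0 -> E^1 -> ... whose terms
   vanish from some degree on. *)
Definition finite_injective_dimension (M : lmodType A) : Prop :=
  exists (E : nat -> lmodType A) (e : {linear M -> E 0%N})
         (d : forall i, {linear E i -> E i.+1}),
    [/\ forall i, injective_module (E i),
        injective e,
        exact_at e (d 0%N),
        forall i, exact_at (d i) (d i.+1) &
        exists N, forall i, (N <= i)%N -> forall x : E i, x = 0].

(* The definition of Bass, for a local ring. *)
Definition gorenstein_local_ring : Prop :=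
  [/\ noetherian, local_ring & finite_injective_dimension A^o].

End CommutativeAlgebra.

Definition non_zero_divisor (A : comPzRingType) (x : A) : Prop :=
  forall y, x * y = 0 -> y = 0.

(* The local ring of a germ of reduced complex analytic curve with irreducible
   components D_1, ..., D_p: a reduced quotient of some C{x_1, ..., x_n}, whose
   minimal primes are the ideals of the D_i, all of dimension 1. *)
Record curve_germ (R : realType) (p : nat) := CurveGerm {
  germ_ring :> comAlgType R[i];
  germ_analytic : exists n (pi : {lrmorphism cps n R[i] -> germ_ring}),
    forall f, exists F, f = pi F;
  germ_reduced : reduced germ_ring;
  component_ideal : 'I_p -> {pred germ_ring};
  component_ideal_inj :
    forall i j, component_ideal i =i component_ideal j -> i = j;
  component_ideal_minimal : forall P : {pred germ_ring},
    minimal_prime P <-> exists i, P =i component_ideal i;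
  component_dim1 : forall i, quotient_dim (component_ideal i) 1 }.
Arguments component_ideal {R p} c i.

Definition Ct (R : realType) := cps 1 R[i].

(* The product of the fields Q(C{t_i}), with the pointwise ring structure of
   functions. *)
Definition Qprod (R : realType) (p : nat) := 'I_p -> {fraction Ct R}.

(* The identifications of Q(O_D) with the product of the Q(C{t_i}), and of the
   integral closure of O_D in it with the product of the C{t_i}, such that the
   kernel of O_D -> C{t_i} is the ideal of D_i. They depend on a choice of the
   uniformizers t_i, hence are a datum. *)
Record normalization (R : realType) (p : nat) (D : curve_germ R p) :=
  Normalization {
  nu : forall i : 'I_p, {lrmorphism D -> Ct R};
  nu_ker : forall i a, nu i a = 0 <-> a \in component_ideal D i;
  nu_total_fractions : forall q : Qprod R p, exists a b : D,
    non_zero_divisor b /\ forall i, q i = tofrac (nu i a) / tofrac (nu i b);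
  nu_integral_closure : forall q : Qprod R p,
    (exists2 f : {poly D}, f \is monic &
       forall i, root (map_poly (fun a => tofrac (nu i a)) f) (q i))
    <-> exists h : 'I_p -> Ct R, forall i, q i = tofrac (h i) }.

Section Values.
Variables (R : realType) (p : nat) (D : curve_germ R p) (N : normalization D).
Local Notation Q := (Qprod R p).

Definition germ_emb (a : D) : Q := fun i => tofrac (nu N i a).

Definition germ_in_Q : set Q := range germ_emb.

Definition fractional_ideal (I : set Q) : Prop :=
  (exists s : seq Q, I =
     [set g | exists c : 'I_(size s) -> D, g = \sum_k germ_emb (c k) * s`_k]) /\
  exists2 g, I g & non_zero_divisor g.

Definition dual (I : set Q) : set Q :=
  [set g | forall h, I h -> germ_in_Q (g * h)].

Definition values (I : set Q) : set ('I_p -> int) :=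
  [set v | exists g, [/\ I g, non_zero_divisor g &
                         forall i, frac_val (g i) = (v i)%:E]].

(* gamma is the greatest lower bound, for the product order, of the alpha in
   N^p such that alpha + N^p is contained in val(O_D). *)
Definition is_conductor (gamma : 'I_p -> nat) : Prop :=
  let S := [set alpha : 'I_p -> nat |
    forall beta : 'I_p -> nat,
      values germ_in_Q (fun i => (alpha i + beta i)%N%:Z)] in
  (forall alpha, S alpha -> forall i, (gamma i <= alpha i)%N) /\
  (forall delta : 'I_p -> nat,
     (forall alpha, S alpha -> forall i, (delta i <= alpha i)%N) ->
     forall i, (delta i <= gamma i)%N).

End Values.

Definition Delta_i (p : nat) (i : 'I_p) (v : 'I_p -> int)
    (E : set ('I_p -> int)) : set ('I_p -> int) :=
  [set alpha | [/\ E alpha, alpha i = v i &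
                   forall j, j != i -> v j < alpha j]].

Definition Delta (p : nat) (v : 'I_p -> int)
    (E : set ('I_p -> int)) : set ('I_p -> int) :=
  \bigcup_(i in [set: 'I_p]) Delta_i i v E.

(* Main.v *)
Require Import Defs.
From HB Require Import structures.
From mathcomp Require Import all_boot all_order all_algebra complex.
From mathcomp Require Import boolp classical_sets functions reals.
From mathcomp Require Import constructive_ereal.
(* The notations of mpoly clash with those of classical_sets. *)
From mathcomp Require Import -(notations) mpoly.
From mathcomp Require Import ring zify.

(** Let A be the local ring of the germ, O~ its normalization and Q its total ring
    of fractions. Both sides of the equivalence amount to the existence of a perfect
    form ([perfect_form]): a linear form l on Q that vanishes on A and for which
    l (A q) = 0 only if q lies in A. Such a form plays the part of the residue of a
    generator of the dualizing module.

    A perfect form gives the duality of values. It turns the dual of a fractional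
    ideal I into its orthogonal {g | l (g I) = 0}, and the orthogonal of O~ is
    t^gamma O~. If Delta (gamma - v - 1, val I) is empty then, for each branch i,
    t_i^(gamma_i - v_i - 1) lies outside I + t^(gamma - v) O~; a linear form
    separating them is represented through l by an element of the dual that lies in
    t^v O~ and has valuation v_i on the branch i, and a generic linear combination of
    these elements has valuation v ([Delta_values_dual]). The other half holds for any
    germ, by the minimality of the conductor ([values_dual_Delta]).

    Conversely the duality for I = A alone gives a perfect form
    ([perfect_form_of_values]): for a generic form killing A, the orthogonal of A
    contains A and has no other values, and values detect equality
    ([subspace_sub_of_values]).

    A perfect form makes A Gorenstein ([germ_finite_injective_dimension]): it
    identifies Q/A with the continuous linear forms on A, an injective module by
    Baer's criterion and the Artin-Rees property, so that 0 -> A -> Q -> Q/A -> 0 is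
    an injective resolution. Conversely let A have finite injective dimension. The
    groups Ext^i (A/J, A) vanish for i >= 2 and J containing a parameter x, by
    descending induction on i: A/xA contains the residue field and has projective
    dimension one ([lifts_descend], [lifts_devissage]). The case i = 2 says that maps
    between socle elements of A/xA are multiplications ([socle_mod_x_cyclic]), so the
    socle of Q/A is a line, and a form that is nonzero on it is perfect
    ([perfect_form_of_socle]).

    All this rests on the finiteness of O~ over A. Division by a parameter in C{t}
    produces digits of geometric growth ([weierstrass_division]), and the series in
    the parameter that they form can be summed inside A ([germ_geometric_sum]); so O~
    is generated by finitely many powers of the t_i ([normalization_generators]).
    Hence A contains a power of t ([conductor_exists]), is determined by its values,
    and is noetherian ([germ_noetherian]). *)

Set Implicit Arguments.
Unset Strict Implicit.
Unset Printing Implicit Defensive.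

Import Order.TTheory GRing.Theory Num.Theory.
Local Open Scope ring_scope.
Local Open Scope classical_set_scope.

(** * Submodules, the criterion of Baer and extension of linear maps *)

(** The seed S0 takes care of the empty chain, whose union need not satisfy P. *)
Lemma Zorn_above (T : Type) (P : set (set T)) (S0 : set T) : P S0 ->
  (forall F : set (set T), F `<=` P -> F !=set0 -> total_on F subset ->
     P (\bigcup_(X in F) X)) ->
  exists M, [/\ P M, S0 `<=` M & forall B, P B -> M `<=` B -> B `<=` M].
Proof.
move=> PS0 chainP; pose P' := [set X | P (S0 `|` X)].
have [|A [PA maxA]] := @Zorn_bigcup T P'.
  move=> F FP Ftot; rewrite /P' /=.
  have [[X0 FX0]|/set0P/negP/negPn/eqP ->] := pselect (F !=set0); last first.
    by rewrite bigcup_set0 setU0.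
  have -> : S0 `|` \bigcup_(X in F) X =
            \bigcup_(Y in [set S0 `|` X | X in F]) Y.
    rewrite bigcup_image eqEsubset; split=> x.
      by case=> [Sx|[X FX Xx]]; [exists X0 => //; left|exists X => //; right].
    by case=> X FX [Sx|Xx]; [left|right; exists X].
  apply: chainP; first by move=> _ [X FX <-]; apply: FP.
    by exists (S0 `|` X0); exists X0.
  move=> _ _ [X FX <-] [Y FY <-].
  by have [XY|YX] := Ftot _ _ FX FY; [left|right]; apply: setUS.
exists (S0 `|` A); split=> // B PB MB.
have SB : S0 `|` B = B by apply/setUidPr => x Sx; apply: MB; left.
have AB : A `<=` B by move=> x Ax; apply: MB; right.
have BA : B `<=` A by apply: contrapT => nBA; apply: (maxA B); rewrite ?/P' /= ?SB.
by move=> x /BA; right.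
Qed.

Definition submodule (A : pzRingType) (V : lmodType A) (S : set V) : Prop :=
  [/\ S 0, forall x y, S x -> S y -> S (x + y) & forall r x, S x -> S (r *: x)].

Section Submodule.
Variables (A : pzRingType) (V : lmodType A) (S : set V).
Hypothesis subS : submodule S.

Lemma submod0 : S 0. Proof. by case: subS. Qed.
Lemma submodD x y : S x -> S y -> S (x + y).
Proof. by case: subS => _ + _; exact. Qed.
Lemma submodZ r x : S x -> S (r *: x).
Proof. by case: subS => _ _; exact. Qed.
Lemma submodN x : S x -> S (- x).
Proof. by rewrite -scaleN1r; exact: submodZ. Qed.
Lemma submodB x y : S x -> S y -> S (x - y).
Proof. by move=> Sx Sy; apply: submodD => //; apply: submodN. Qed.
Lemma submod_sum (I : Type) (s : seq I) (F : I -> V) :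
  (forall i, S (F i)) -> S (\sum_(i <- s) F i).
Proof.
by move=> SF; elim/big_rec: _ => [|i x _ Sx]; [exact: submod0|apply: submodD].
Qed.
Lemma submodP x y : S x -> S (y - x) -> S y.
Proof. by move=> Sx Syx; rewrite -(subrK x y); apply: submodD. Qed.

End Submodule.

Definition ideal (A : pzRingType) (J : set A) := @submodule A A^o J.

(** The homomorphism from J is a total function constrained on J only, which spares a
    type for J. *)
Definition baer (A : pzRingType) (E : lmodType A) : Prop :=
  forall (J : set A) (f : A -> E), ideal J ->
    (forall a b, J a -> J b -> f (a + b) = f a + f b) ->
    (forall r a, J a -> f (r * a) = r *: f a) ->
    exists e, forall a, J a -> f a = a *: e.

(** A maximal functional submodule of N x E is a total graph: Baer's condition for the
    ideal of the r such that r n lies in its domain provides a value at n. *)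
Lemma baer_extension (A : pzRingType) (N E : lmodType A) (S : set (N * E)) :
  baer E -> submodule S -> (forall e, S (0, e) -> e = 0) ->
  exists h : {linear N -> E}, forall n e, S (n, e) -> h n = e.
Proof.
move=> bE subS funS.
pose P (G : set (N * E)) := submodule G /\ forall e, G (0, e) -> e = 0.
have [|F FP [X0 FX0] Ftot|G [[subG funG] SG maxG]] := @Zorn_above _ P S.
- by [].
- split; last by move=> e [X FX]; apply: (FP _ FX).2.
  split; first by exists X0 => //; case: (FP _ FX0).1.
    move=> x y [X FX Xx] [Y FY Yy].
    have [XY|YX] := Ftot _ _ FX FY.
      by exists Y => //; apply: (submodD (FP _ FY).1) => //; apply: XY.
    by exists X => //; apply: (submodD (FP _ FX).1) => //; apply: YX.
  by move=> r x [X FX Xx]; exists X => //; apply: (submodZ (FP _ FX).1).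
have funG2 n e e' : G (n, e) -> G (n, e') -> e = e'.
  move=> Ge Ge'; apply/eqP; rewrite -subr_eq0; apply/eqP/funG.
  by have := submodB subG Ge Ge'; rewrite /= -[(n,e) - _]/(n - n, e - e') subrr.
have totG n : exists e, G (n, e).
  pose J : set A := [set r | exists e, G (r *: n, e)].
  pose f r : E := if pselect (exists e, G (r *: n, e)) is left h then sval (cid h)
                  else 0.
  have fG r : J r -> G (r *: n, f r).
    by rewrite /f; case: pselect => // h _; case: cid.
  have idJ : ideal J.
    split; first by exists 0; rewrite scale0r; apply: (submod0 subG).
      move=> a b [e Ge] [e' Ge']; exists (e + e').
      by rewrite scalerDl; apply: (submodD subG Ge Ge').
    move=> r a [e Ge]; exists (r *: e).
    by rewrite -[r *: a]/(r * a) -scalerA; apply: (submodZ subG r Ge).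
  have [||e0 fe0] := bE J f idJ.
  - move=> a b Ja Jb; apply: (funG2 ((a + b) *: n)).
      by apply: fG; apply: (submodD idJ Ja Jb).
    by rewrite scalerDl; apply: (submodD subG (fG _ Ja) (fG _ Jb)).
  - move=> r a Ja; apply: (funG2 ((r * a) *: n)).
      by apply: fG; apply: (submodZ idJ r Ja).
    by rewrite -scalerA; apply: (submodZ subG r (fG _ Ja)).
  pose G' : set (N * E) :=
    [set z | exists r x y, G (x, y) /\ z = (x + r *: n, y + r *: e0)].
  have GG' : G `<=` G'.
    by move=> [x y] Gxy; exists 0, x, y; rewrite !scale0r !addr0.
  have PG' : P G'.
    split; last first.
      move=> e [r [x [y [Gxy [xE ->]]]]].
      have Gr : G (r *: n, - y).
        have := submodN subG Gxy; rewrite -[- (x, y)]/(- x, - y).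
        by congr (G (_, _)); apply/eqP; rewrite eqr_oppLR -addr_eq0 -xE.
      have Jr : J r by exists (- y).
      by rewrite -fe0 // -(funG2 _ _ _ Gr (fG _ Jr)) subrr.
    split; first exact: GG' (submod0 subG).
      move=> _ _ [r [x [y [Gxy ->]]]] [r' [x' [y' [Gxy' ->]]]].
      exists (r + r'), (x + x'), (y + y'); split.
        exact: (submodD subG Gxy Gxy').
      by congr (_, _); rewrite /= scalerDl addrACA.
    move=> s _ [r [x [y [Gxy ->]]]].
    exists (s * r), (s *: x), (s *: y); split; first exact: (submodZ subG s Gxy).
    by congr (_, _); rewrite /= scalerDr scalerA.
  exists e0; apply: (maxG _ PG' GG').
  exists 1, 0, 0; split; first exact: (submod0 subG).
  by rewrite !scale1r !add0r.
have [h hG] := choice totG.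
have addh : zmod_morphism h.
  by move=> x y; apply: (funG2 (x - y)) => //; apply: (submodB subG (hG _) (hG _)).
have scah : scalable h.
  by move=> r x; apply: (funG2 (r *: x)) => //; apply: (submodZ subG r (hG _)).
pose h1 := GRing.isZmodMorphism.Build N E h addh.
pose h2 := GRing.isScalable.Build A N E *:%R h scah.
pose hl : {linear N -> E} := HB.pack h h1 h2.
exists hl => n e /SG Ge; exact: funG2 (hG n) Ge.
Qed.

Lemma baer_injective (A : comNzRingType) (E : lmodType A) :
  baer E -> injective_module E.
Proof.
move=> bE M N f g injf.
pose S : set (N * E) := [set z | exists m, z = (f m, g m)].
have [||h hS] := @baer_extension A N E S bE.
- split; first by exists 0; rewrite !linear0.
    move=> _ _ [m ->] [m' ->]; exists (m + m').
    by rewrite !linearD.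
  by move=> r _ [m ->]; exists (r *: m); rewrite !linearZ.
- move=> e [m [fm ->]].
  suff -> : m = 0 by rewrite linear0.
  by apply: injf; rewrite -fm linear0.
by exists h => m; apply: hS; exists m.
Qed.

Lemma baer_field (K : fieldType) : baer K^o.
Proof.
move=> J f idJ fD fM.
have [[a [Ja a0]]|nJ] := pselect (exists a, J a /\ a != 0).
  exists (f a / a) => b Jb.
  have : a * f b = b * f a by rewrite -[RHS](fM b a Ja) -[LHS](fM a b Jb) mulrC.
  rewrite -[b *: _]/(b * (f a / a)) => h.
  by apply: (mulfI a0); rewrite h; field.
exists 0 => b Jb; have -> : b = 0.
  by apply: contrapT => /eqP b0; apply: nJ; exists b.
rewrite scaler0; have := fM 0 b Jb; rewrite mul0r scale0r //.
Qed.

(** The graph of the form x + c w |-> c on W + K w is functional because w is not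
    in W; it extends since Baer's condition holds over a field. *)
Lemma linear_form_separates (K : fieldType) (V : lmodType K) (W : set V) (w : V) :
  submodule W -> ~ W w ->
  exists phi : {linear V -> K^o}, phi w = 1 /\ forall x, W x -> phi x = 0.
Proof.
move=> subW nWw.
pose S : set (V * K^o) := [set z | exists2 x, W x & z.1 = x + z.2 *: w].
have [||h hS] := @baer_extension K V K^o S (@baer_field K).
- split; first by exists 0; [exact: (submod0 subW)|rewrite scale0r addr0].
    move=> [z1 z2] [z1' z2'] [x Wx /= ->] [x' Wx' /= ->]; exists (x + x').
      exact: (submodD subW).
    by rewrite /= scalerDl addrACA.
  move=> r [z1 z2] [x Wx /= ->]; exists (r *: x); first exact: (submodZ subW).
  by rewrite /= scalerDr scalerA.
- move=> e [x Wx /= xe]; apply: contrapT => /eqP e0; apply: nWw.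
  have -> : w = (- e^-1) *: x.
    have /eqP := esym xe; rewrite addr_eq0 => /eqP ->.
    by rewrite scalerN scaleNr opprK scalerA mulVf // scale1r.
  exact: (submodZ subW).
exists h; split; first by apply: hS; exists 0;
  [exact: (submod0 subW)|rewrite /= scale1r add0r].
by move=> x Wx; apply: hS; exists x => //=; rewrite scale0r addr0.
Qed.

(** * Minimal primes *)

(** The complement of a maximal multiplicative set S containing a and avoiding 0 is a
    minimal prime, because each of its elements has a power killed by some element
    of S. *)
Lemma minimal_prime_avoiding (A : comNzRingType) (a : A) :
  (forall k, a ^+ k != 0) -> exists2 P : {pred A}, minimal_prime P & a \notin P.
Proof.
move=> aX.
pose mul (S : set A) := [/\ S 1, S a, ~ S 0 & forall x y, S x -> S y -> S (x * y)].
have [||S [[S1 Sa S0 SM] aS maxS]] := @Zorn_above _ mul [set a ^+ k | k in setT].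
- split; [by exists 0%N|by exists 1%N| |].
    by move=> [k _ /eqP]; apply/negP.
  by move=> _ _ [k _ <-] [l _ <-]; exists (k + l)%N; rewrite // exprD.
- move=> F FP [X0 FX0] Ftot; split.
  + by exists X0 => //; case: (FP _ FX0).
  + by exists X0 => //; case: (FP _ FX0).
  + by move=> [X FX X00]; case: (FP _ FX).
  + move=> x y [X FX Xx] [Y FY Yy]; have [XY|YX] := Ftot _ _ FX FY.
      by exists Y => //; case: (FP _ FY) => _ _ _; apply=> //; apply: XY.
    by exists X => //; case: (FP _ FX) => _ _ _; apply=> //; apply: YX.
(* Otherwise the products s * x ^+ k would form a larger multiplicative set. *)
have killS x : ~ S x -> exists s k, S s /\ s * x ^+ k = 0.
  move=> nSx; apply: contrapT => nk.
  pose S' := [set y | exists s k, S s /\ (y = s * x ^+ k)].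
  have S'le : S `<=` S'.
    by move=> s Ss; exists s, 0%N; rewrite expr0 mulr1; split.
  apply: nSx; apply: (maxS S') => //; last first.
    by exists 1, 1%N; rewrite expr1 mul1r; split.
  split; [exact: S'le|exact: S'le| |].
    by move=> [s [k [Ss sx]]]; apply: nk; exists s, k.
  move=> _ _ [s [k [Ss ->]]] [s' [k' [Ss' ->]]].
  by exists (s * s'), (k + k')%N; split; [exact: SM|rewrite exprD; ring].
pose P : {pred A} := fun x => `[< ~ S x >].
have PE x : (x \in P) = `[< ~ S x >] by [].
have PP x : x \in P <-> ~ S x by rewrite PE; split=> /asboolP.
exists P; last by apply/negP => /PP.
have kill0 x s k : S s -> s * x ^+ k = 0 -> x \in P.
  move=> Ss sx; apply/PP => Sx; apply: S0; rewrite -sx.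
  by apply: (SM) => //; elim: k {sx} => // k IH; rewrite exprS; apply: (SM).
split; first split.
- split; first exact/PP.
    by apply/negP => /PP.
  move=> r x y /PP/killS[s [k [Ss sx]]] /PP/killS[s' [l [Ss' sy]]].
  apply: (kill0 _ (s * s') (k + l)%N (SM _ _ Ss Ss')).
  rewrite exprDn mulr_sumr big1 // => -[i /=]; rewrite ltnS => ile _.
  rewrite mulrnAr.
  have [ik|ki] := leqP k (k + l - i).
    suff -> : s * s' * ((r * x) ^+ (k + l - i) * y ^+ i) = 0 by rewrite mul0rn.
    rewrite -(subnK ik) exprD !exprMn.
    set u := x ^+ _ in sx *; set v := x ^+ _; set w := r ^+ _; set t := r ^+ _.
    by transitivity (s * u * (s' * (w * v * t) * y ^+ i)); [ring|rewrite sx mul0r].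
  have li : (l <= i)%N by move: ki; rewrite ltn_subLR ?ltn_add2l // addnC ltn_add2r => /ltnW.
  suff -> : s * s' * ((r * x) ^+ (k + l - i) * y ^+ i) = 0 by rewrite mul0rn.
  have -> : y ^+ i = y ^+ (i - l) * y ^+ l by rewrite -exprD subnK.
  set u := y ^+ l in sy *; set v := y ^+ _; set w := (r * x) ^+ _.
  by transitivity (s' * u * (s * w * v)); [ring|rewrite sy mul0r].
- move=> x y /PP nSxy; apply/orP; apply: contrapT => /orP/norP[].
  by move=> /negP/PP nx /negP/PP ny; apply: nSxy; apply: SM; apply: contrapT.
- move=> P' [[P'0 P'1 P'D] P'M] P'P x; apply/idP/idP; first exact: P'P.
  move=> /PP/killS[s [k [Ss sx]]].
  have : s * x ^+ k \in P' by rewrite sx.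
  move=> /P'M/orP[/P'P/PP //|].
  elim: k {sx} => [|k IH]; first by rewrite expr0 (negbTE P'1).
  by rewrite exprS => /P'M/orP[].
Qed.

(** * Substitution and inversion of convergent power series *)

Section PowerSeries.
Variables (n : nat) (K : numFieldType).
Implicit Types (a b G : fps n K) (F : nat -> K).

Lemma fps_norm_le_one (r : K) : 0 < r -> fps_norm_le (1 : fps n K) r 1.
Proof.
move=> r0 [|N].
  by rewrite big1 ?ler01 // => m; have := bmdeg m; rewrite ltn0.
rewrite (bigD1 (@bm0 n N)) //= big1 => [|m /negbTE mN0].
  by rewrite mdeg0 expr0 mulr1 addr0 eqxx normr1.
by rewrite -[_ == @mnm0 n]/(m == @bm0 n N) mN0 normr0 mul0r.
Qed.

Lemma fps_norm_leX a (r M : K) k :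
  0 < r -> fps_norm_le a r M -> fps_norm_le (a ^+ k) r (M ^+ k).
Proof.
move=> r0 ha; elim: k => [|k IH]; first by rewrite !expr0; apply: fps_norm_le_one.
by rewrite !exprS; apply: fps_norm_leM.
Qed.

Lemma fps_norm_le_coef a (r M : K) m :
  0 < r -> fps_norm_le a r M -> `|fps_coef a m| * r ^+ mdeg m <= M.
Proof.
move=> r0 /(_ (mdeg m).+1); apply: le_trans.
rewrite (bigD1 (BMultinom (ltnSn (mdeg m)))) //= lerDl sumr_ge0 // => i _.
by rewrite mulr_ge0 // exprn_ge0 // ltW.
Qed.

(** Shrinking the radius by a factor c <= 1 multiplies each term of positive degree
    by at most c, and there is no other term. *)
Lemma fps_norm_le_small G (r M e : K) : fps_coef G (@mnm0 n) = 0 ->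
  0 < r -> fps_norm_le G r M -> 0 < e ->
  exists2 s, 0 < s & fps_norm_le G s e.
Proof.
move=> G0 r0 hG e0; have M0 := fps_norm_le_ge0 r0 hG.
have eM : 0 < e + M by rewrite ltr_wpDr.
pose c := e / (e + M); have c0 : 0 < c by rewrite divr_gt0.
have c1 : c <= 1 by rewrite ler_pdivrMr // mul1r lerDl.
exists (r * c); first by rewrite mulr_gt0.
move=> N; apply: (@le_trans _ _ (c * M)); last first.
  by rewrite /c mulrAC ler_pdivrMr // mulrDr lerDr mulr_ge0 // ltW.
apply: le_trans (ler_wpM2l (ltW c0) (hG N)); rewrite mulr_sumr.
apply: ler_sum => m _; have [->|m0] := eqVneq (bmnm m) (@mnm0 n).
  by rewrite G0 normr0 !mul0r mulr0.
rewrite exprMn mulrA mulrC ler_wpM2r ?mulr_ge0 ?exprn_ge0 ?(ltW r0) //.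
by rewrite ler_iXnr ?(ltW c0) // lt0n mdeg_eq0.
Qed.

Lemma fps_coefM0 a b :
  fps_coef (a * b) (@mnm0 n) = fps_coef a (@mnm0 n) * fps_coef b (@mnm0 n).
Proof.
have h (c : fps n K) k : (mdeg k <= mdeg (@mnm0 n))%N ->
  mcoeff k (fps_trunc (mdeg (@mnm0 n)).+1 c) = fps_coef c k.
  by move=> km; rewrite fps_truncE.
by rewrite (fps_mulE (h a) (h b)) rmorphM /= !h.
Qed.

Lemma fps_coefX_lt G k m : fps_coef G (@mnm0 n) = 0 -> (mdeg m < k)%N ->
  fps_coef (G ^+ k) m = 0.
Proof.
move=> G0; elim: k m => // k IH m; rewrite ltnS exprS => mk /=.
rewrite big1 // => -[u v] /= /eqP mE.
have [->|u0] := eqVneq (bmnm u) (@mnm0 n); first by rewrite G0 mul0r.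
rewrite IH ?mulr0 // (leq_trans _ mk) //.
have/(congr1 (fun w => mdeg w)) := mE; rewrite mdegD => mD.
rewrite [ltnRHS]mD.
by rewrite -[X in (X < _)%N]add0n ltn_add2r lt0n mdeg_eq0.
Qed.

(** The substitution F(G) = sum_k F_k G^k: in each degree the sum is finite
    because G has no constant term. *)
Definition fps_comp F G : fps n K :=
  Fps (fun m => \sum_(k < (mdeg m).+1) F k * fps_coef (G ^+ k) m).

Lemma fps_comp_widen F G N m : fps_coef G (@mnm0 n) = 0 -> (mdeg m < N)%N ->
  fps_coef (fps_comp F G) m = \sum_(k < N) F k * fps_coef (G ^+ k) m.
Proof.
move=> G0 mN /=; rewrite (big_ord_widen N (fun k => F k * fps_coef (G ^+ k) m)) //.
rewrite [RHS](bigID (fun k : 'I_N => (k < (mdeg m).+1)%N)) /=.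
rewrite [X in _ = _ + X]big1 ?addr0 // => k; rewrite -leqNgt => mk.
by rewrite fps_coefX_lt // mulr0.
Qed.

(** The first step of the scheme of Horner: F(G) = F_0 + G F'(G), with F' the shift of
    F. *)
Lemma fps_compS F G : fps_coef G (@mnm0 n) = 0 ->
  fps_comp F G = F 0%N *: 1 + G * fps_comp (fun k => F k.+1) G.
Proof.
move=> G0; apply: fps_eqP => m.
rewrite (fps_comp_widen _ (N := (mdeg m).+2)) //.
rewrite big_ord_recl expr0 /=; congr (_ + _).
under [RHS]eq_bigr => k /eqP mE.
  have kk : (mdeg k.2 < (mdeg m).+1)%N by apply: bmdeg.
  rewrite -[\sum_(k0 < _) _]/(fps_coef (fps_comp (fun k => F k.+1) G) k.2).
  rewrite (fps_comp_widen _ G0 kk) mulr_sumr.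
  over.
rewrite exchange_big /=; apply: eq_bigr => i _.
rewrite /bump /= add1n exprS /= mulr_sumr.
by apply: eq_bigr => k _; rewrite mulrCA.
Qed.

Lemma geometric_half_sum N : \sum_(k < N) (2%:R ^+ k)^-1 <= 2%:R :> K.
Proof.
suff -> : \sum_(k < N) (2%:R ^+ k)^-1 = 2%:R - 2%:R * (2%:R ^+ N)^-1 :> K.
  by rewrite gerBl mulr_ge0 // invr_ge0 exprn_ge0.
elim: N => [|N IH]; first by rewrite big_ord0 expr0 invr1 mulr1 subrr.
rewrite big_ord_recr /= IH exprS; field.
by rewrite expf_neq0 // pnatr_eq0.
Qed.

Lemma fps_norm_le_comp F G (r s B : K) :
  fps_coef G (@mnm0 n) = 0 -> 0 < r -> 0 <= B -> fps_norm_le G r s ->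
  (forall k, `|F k| * s ^+ k <= B / 2%:R ^+ k) ->
  fps_norm_le (fps_comp F G) r (B * 2%:R).
Proof.
move=> G0 r0 B0 hG hF N.
apply: (@le_trans _ _ (\sum_(m : bmultinom n N) \sum_(k < N)
   `|F k| * (`|fps_coef (G ^+ k) m| * r ^+ mdeg m))).
  apply: ler_sum => m _; rewrite (fps_comp_widen _ G0 (bmdeg m)).
  apply: le_trans (ler_wpM2r (exprn_ge0 _ (ltW r0)) (ler_norm_sum _ _ _)) _.
  rewrite mulr_suml; apply: ler_sum => k _.
  by rewrite normrM mulrA.
rewrite exchange_big /=.
apply: le_trans (ler_wpM2l B0 (geometric_half_sum N)).
rewrite mulr_sumr; apply: ler_sum => k _; rewrite -mulr_sumr.
apply: le_trans (hF k); rewrite ler_wpM2l //.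
exact: fps_norm_leX.
Qed.

Lemma convergent_comp F G (B L : K) : 0 <= B -> 0 < L ->
  (forall k, `|F k| <= B * L ^+ k) ->
  fps_coef G (@mnm0 n) = 0 -> G \in convergent n K ->
  fps_comp F G \in convergent n K.
Proof.
move=> B0 L0 hF G0 /convergentP[r [M [r0 hG]]].
have L20 : 0 < (2%:R * L)^-1 by rewrite invr_gt0 mulr_gt0.
have [s s0 hs] := fps_norm_le_small G0 r0 hG L20.
apply/convergentP; exists s, (B * 2%:R); split=> //.
apply: fps_norm_le_comp hs _ => // k.
rewrite exprVn exprMn -[leRHS](_ : B * L ^+ k / (2%:R ^+ k * L ^+ k) = _).
  by rewrite ler_wpM2r // invr_ge0 mulr_ge0 ?exprn_ge0 // ltW.
by field; rewrite !expf_neq0 ?pnatr_eq0 // lt0r_neq0.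
Qed.

Definition ev0 (a : cps n K) : K := fps_coef (cps_val a) (@mnm0 n).

Lemma ev0_is_zmod : zmod_morphism ev0. Proof. by []. Qed.
Lemma ev0_is_monoid : monoid_morphism ev0.
Proof.
by split=> [|a b]; [rewrite /ev0 /= eqxx|exact: fps_coefM0].
Qed.
HB.instance Definition _ := GRing.isZmodMorphism.Build _ _ ev0 ev0_is_zmod.
HB.instance Definition _ := GRing.isMonoidMorphism.Build _ _ ev0 ev0_is_monoid.

Lemma ev0Z c (a : cps n K) : ev0 (c *: a) = c * ev0 a. Proof. by []. Qed.
Lemma ev0_const c : ev0 (c *: 1) = c.
Proof. by rewrite ev0Z rmorph1 mulr1. Qed.

(** H_k is the sum of F_(k+j) G^j over j; the recursion between these tails
    determines H_0 to any order in G. *)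
Lemma cps_geometric_sum F (G : cps n K) (B L : K) : 0 <= B -> 0 < L ->
  (forall k, `|F k| <= B * L ^+ k) -> ev0 G = 0 ->
  exists H : nat -> cps n K, forall k, H k = F k *: 1 + G * H k.+1.
Proof.
move=> B0 L0 hF G0.
have hk k : fps_comp (fun j => F (k + j)%N) (cps_val G) \in convergent n K.
  apply: (@convergent_comp _ _ (B * L ^+ k) L); rewrite ?cps_valP //.
    by rewrite mulr_ge0 // exprn_ge0 // ltW.
  by move=> j; rewrite -mulrA -exprD.
exists (fun k => Cps (hk k)) => k; apply: val_inj => /=.
rewrite {1}fps_compS // addn0; congr (_ + _ * _).
by congr fps_comp; apply: funext => j; rewrite addnS.
Qed.

(** The geometric series h of G = 1 - a / a(0) satisfies h = 1 + G h, that is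
    h (1 - G) = 1. *)
Lemma cps_unitP (a : cps n K) : (a \is a GRing.unit) = (ev0 a != 0).
Proof.
apply/idP/idP => [ua|a0]; first by rewrite -unitfE rmorph_unit.
pose G : cps n K := 1 - (ev0 a)^-1 *: a.
have G0 : ev0 G = 0.
  by rewrite /G rmorphB rmorph1 /= ev0Z mulVf // subrr.
have hk : fps_comp (fun=> 1) (cps_val G) \in convergent n K.
  apply: (@convergent_comp _ _ 1 1); rewrite ?cps_valP // => k.
  by rewrite normr1 expr1n mulr1.
pose h : cps n K := Cps hk.
have hE : h = 1 + G * h.
  by apply: val_inj; rewrite /= {1}fps_compS // scale1r.
apply/unitrPr; exists ((ev0 a)^-1 *: h).
rewrite -scalerAr scalerAl.
have -> : (ev0 a)^-1 *: a = 1 - G by rewrite /G opprB addrC subrK.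
by rewrite mulrBl mul1r {1}hE addrK.
Qed.

End PowerSeries.

(** * Power series in one variable *)

Section OneVariable.
Variable K : numFieldType.
Implicit Types (a b f u : cps 1 K).

Definition mono1 (d : nat) : multinom 1 := mnm_muln (mnm1 ord0) d.

Lemma mdeg_mono1 d : mdeg (mono1 d) = d.
Proof. by rewrite mdegMn mdeg1 mul1n. Qed.

Lemma mono1_mdeg (m : multinom 1) : mono1 (mdeg m) = m.
Proof.
by apply/mnmP => i; rewrite mulmnE mnm1E mdegE big_ord1 (ord1 i) eqxx mul1n.
Qed.

Lemma big_mono1 (N : nat) (F : nat -> K) :
  \sum_(m : bmultinom 1 N) F (mdeg m) = \sum_(i < N) F i.
Proof.
have hi (i : 'I_N) : (mdeg (mono1 i) < N)%N by rewrite mdeg_mono1.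
rewrite (reindex (fun i : 'I_N => BMultinom (hi i))) /=.
  by apply: eq_bigr => i _; rewrite mdeg_mono1.
exists (fun m : bmultinom 1 N => Ordinal (bmdeg m)) => [i _|m _].
  by apply: val_inj; rewrite /= mdeg_mono1.
by apply: val_inj; rewrite /= mono1_mdeg.
Qed.

Lemma fps_norm_le1P (a : fps 1 K) (r M : K) : fps_norm_le a r M <->
  forall N, \sum_(i < N) `|fps_coef a (mono1 i)| * r ^+ i <= M.
Proof.
have E N : \sum_(m : bmultinom 1 N) `|fps_coef a m| * r ^+ mdeg m
         = \sum_(i < N) `|fps_coef a (mono1 i)| * r ^+ i.
  rewrite -(big_mono1 N (fun i => `|fps_coef a (mono1 i)| * r ^+ i)).
  by apply: eq_bigr => m _; rewrite mono1_mdeg.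
by split=> h N; [rewrite -E|rewrite E]; apply: h.
Qed.

Definition fpsT : fps 1 K := Fps (fun m => (mdeg m == 1%N)%:R).

Lemma fpsT_convergent : fpsT \in convergent 1 K.
Proof.
apply/convergentP; exists 1, 1; split=> //; apply/fps_norm_le1P => -[|[|N]].
- by rewrite big_ord0.
- by rewrite big_ord1 /= mdeg_mono1 normr0 mul0r.
rewrite !big_ord_recl big1 ?addr0 => [|i _] /=; last first.
  by rewrite !mdeg_mono1 normr0 mul0r.
by rewrite !mdeg_mono1 normr0 normr1 mul0r !expr1n mulr1 add0r.
Qed.

Definition cT : cps 1 K := Cps fpsT_convergent.

Lemma ev0T : ev0 cT = 0.
Proof. by rewrite /ev0 /= mdeg0. Qed.

Lemma coef_fpsTM (b : fps 1 K) m : fps_coef (fpsT * b) m =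
  if mdeg m is d.+1 then fps_coef b (mono1 d) else 0.
Proof.
case dE : (mdeg m) => [|d].
  have -> : m = @mnm0 1 by apply/eqP; rewrite -mdeg_eq0 dE.
  by rewrite fps_coefM0 /= mdeg0 mul0r.
rewrite mulrC (fps_mulE (p := fps_trunc d.+2 b) (q := mpolyX K (mnm1 ord0))).
- have -> : m = mnm_add (mnm1 ord0) (mono1 d).
    by rewrite -[LHS]mono1_mdeg dE /mono1 mulmS.
  by rewrite mcoeffMX fps_truncE // mdeg_mono1.
- by move=> k; rewrite dE => kd; rewrite fps_truncE.
- move=> k _; rewrite mcoeffX /=; congr (_ %:R); congr nat_of_bool.
  apply/eqP/eqP => [<-|k1]; first by rewrite mdeg1.
  by rewrite -(mono1_mdeg k) k1 /mono1 mulm1n.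
Qed.

Definition fps_tail (a : fps 1 K) : fps 1 K :=
  Fps (fun m => fps_coef a (mono1 (mdeg m).+1)).

Lemma fps_norm_le_tail (a : fps 1 K) (r M : K) :
  0 < r -> fps_norm_le a r M -> fps_norm_le (fps_tail a) r (M / r).
Proof.
move=> r0 /fps_norm_le1P ha; apply/fps_norm_le1P => N.
rewrite ler_pdivlMr // mulr_suml; apply: le_trans (ha N.+1).
rewrite big_ord_recl /= -[leLHS]add0r lerD //.
  by rewrite mulr_ge0 // exprn_ge0 // ltW.
by apply: ler_sum => i _; rewrite /= mdeg_mono1 -mulrA -exprSr.
Qed.

Lemma fps_tail_convergent a : fps_tail (cps_val a) \in convergent 1 K.
Proof.
case: a => a /= /convergentP[r [M [r0 ha]]]; apply/convergentP.
by exists r, (M / r); split=> //; apply: fps_norm_le_tail.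
Qed.

Definition tail a : cps 1 K := Cps (fps_tail_convergent a).

Lemma tailE a : a = ev0 a *: 1 + cT * tail a.
Proof.
apply: val_inj; apply: fps_eqP => m.
rewrite -[RHS]/(ev0 a * (m == @mnm0 1)%:R
                + fps_coef (fpsT * fps_tail (cps_val a)) m) coef_fpsTM.
rewrite -mdeg_eq0; case dE : (mdeg m) => [|d] /=.
  by rewrite mulr1 addr0 /ev0; congr fps_coef; apply/eqP; rewrite -mdeg_eq0 dE.
by rewrite mulr0 add0r mdeg_mono1 -dE mono1_mdeg.
Qed.

Lemma ev0_eq0P a : ev0 a = 0 -> a = cT * tail a.
Proof. by move=> a0; rewrite {1}(tailE a) a0 scale0r add0r. Qed.

Lemma iter_tailE k a :
  a = \sum_(j < k) ev0 (iter j tail a) *: cT ^+ j + cT ^+ k * iter k tail a.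
Proof.
elim: k => [|k IH]; first by rewrite big_ord0 add0r expr0 mul1r.
rewrite big_ord_recr /= {1}IH -addrA; congr (_ + _).
rewrite {1}(tailE (iter k tail a)) mulrDr -scalerAr mulr1; congr (_ + _).
by rewrite mulrA -exprSr.
Qed.

Lemma cT_neq0 : cT != 0.
Proof.
apply/eqP => /(congr1 (fun a => fps_coef (cps_val a) (mono1 1))) /eqP /=.
by rewrite mdeg_mono1 oner_eq0.
Qed.

Lemma coef_iter_tail k a : ev0 (iter k tail a) = fps_coef (cps_val a) (mono1 k).
Proof.
suff h m : fps_coef (cps_val (iter k tail a)) m
         = fps_coef (cps_val a) (mono1 (mdeg m + k)).
  by rewrite /ev0 h mdeg0.
elim: k m => [|k IH] m; first by rewrite addn0 mono1_mdeg.
by rewrite iterS /= IH mdeg_mono1 addSnnS.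
Qed.

Lemma cps_eq0P a : (forall k, ev0 (iter k tail a) = 0) -> a = 0.
Proof.
move=> h; apply: val_inj; apply: fps_eqP => m.
by rewrite -(mono1_mdeg m) -coef_iter_tail h.
Qed.

Lemma cps_factor a : a != 0 ->
  exists k u, u \is a GRing.unit /\ a = cT ^+ k * u.
Proof.
move=> a0; have ex : exists k, ev0 (iter k tail a) != 0.
  apply: contrapT => nex; move/eqP: a0; apply; apply: cps_eq0P => k.
  by apply: contrapT => /eqP h; apply: nex; exists k.
case: (ex_minnP ex) => k uk mink.
exists k, (iter k tail a); split; first by rewrite cps_unitP.
rewrite {1}(iter_tailE k a) big1 ?add0r // => j _.
have [->|/mink] := eqVneq (ev0 (iter j tail a)) 0; first by rewrite scale0r.
by rewrite leqNgt ltn_ord.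
Qed.

Lemma cps_dvdT_eq0 a : (forall k, exists b, a = cT ^+ k * b) -> a = 0.
Proof.
move=> h; apply: contrapT => /eqP /[dup] a0 /cps_factor[k [u [uu aE]]].
have [b ab] := h k.+1; move: uu; rewrite cps_unitP => /eqP; apply.
have -> : u = cT * b.
  by apply: (mulfI (expf_neq0 k cT_neq0)); rewrite -aE ab exprSr mulrA.
by rewrite rmorphM /= ev0T mul0r.
Qed.

Lemma fps_ord_Tk k u : u \is a GRing.unit -> fps_ord (cps_val (cT ^+ k * u)) = k.
Proof.
rewrite cps_unitP => u0; set a := cT ^+ k * u.
have tk j v : iter j tail (cT ^+ j * v) = v.
  elim: j v => [|j IH] v; first by rewrite expr0 mul1r.
  have tT w : tail (cT * w) = w.
    apply: (mulfI cT_neq0); apply: (addrI (ev0 (cT * w) *: 1)).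
    by rewrite -tailE rmorphM /= ev0T mul0r scale0r add0r.
  by rewrite iterSr exprS -mulrA tT.
have a0 : a != 0.
  rewrite mulf_neq0 ?expf_neq0 ?cT_neq0 //.
  by apply: contraNneq u0 => ->; rewrite rmorph0.
have an0 : cps_val a != 0.
  by apply: contraNneq a0 => va0; apply/eqP/val_inj.
have [[m md am] amin] := fps_ordP an0.
apply/eqP; rewrite eqn_leq; apply/andP; split; rewrite leqNgt; apply/negP => lt.
  have := amin (mono1 k); rewrite mdeg_mono1 => /(_ lt).
  by rewrite -coef_iter_tail /a tk; apply/eqP.
move/eqP: am; apply; rewrite -(mono1_mdeg m) -coef_iter_tail md.
set d := fps_ord _ in lt *; rewrite /a -(subnK lt) addnC exprD exprSr -!mulrA tk.
by rewrite rmorphM /= ev0T mul0r.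
Qed.

(** Division by X = T^k U, iterated: f_n = p_n + X f_(n+1) with p_n of degree < k.
    One step is f |-> U^-1 (f - p) / T^k, which multiplies a norm by a constant;
    so the remainders p_n grow at most geometrically. *)
Lemma weierstrass_division (X U f : cps 1 K) k :
  U \is a GRing.unit -> X = cT ^+ k * U ->
  exists (F : nat -> cps 1 K) (c : nat -> nat -> K),
  [/\ F 0%N = f,
      forall n, F n = \sum_(j < k) c j n *: cT ^+ j + X * F n.+1 &
      forall j, exists B L, [/\ 0 <= B, 0 < L & forall n, `|c j n| <= B * L ^+ n]].
Proof.
move=> uU XE; pose step g := U^-1 * iter k tail g.
exists (fun n => iter n step f), (fun j n => ev0 (iter j tail (iter n step f))).
split=> // [n|j].
  rewrite iterS {1}(iter_tailE k (iter n step f)); congr (_ + _).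
  by rewrite XE /step; rewrite -mulrA mulVKr.
have [r [M [r0 hf]]] := convergentP _ (cps_valP f).
have [s [M' [s0 hV]]] := convergentP _ (cps_valP U^-1).
have [t t0 [{}hf {}hV]] := fps_common_radius r0 s0 hf hV.
have M0 := fps_norm_le_ge0 t0 hf; have M'0 := fps_norm_le_ge0 t0 hV.
have norm_tail i g Q : fps_norm_le (cps_val g) t Q ->
    fps_norm_le (cps_val (iter i tail g)) t (Q / t ^+ i).
  move=> hg; elim: i => [|i IH]; first by rewrite expr0 divr1.
  by rewrite exprSr invfM mulrA; apply: fps_norm_le_tail.
have norm_iter n :
    fps_norm_le (cps_val (iter n step f)) t (M * (M' / t ^+ k) ^+ n).
  elim: n => [|n IH]; first by rewrite expr0 mulr1.
  rewrite exprS mulrCA -mulrA [_^-1 * _]mulrC.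
  by apply: fps_norm_leM => //; apply: norm_tail.
exists (M / t ^+ j), (M' / t ^+ k + 1).
have L0 : 0 <= M' / t ^+ k by rewrite divr_ge0 // exprn_ge0 // ltW.
split; [by rewrite divr_ge0 // exprn_ge0 // ltW | by rewrite ltr_wpDl |].
move=> n; have := fps_norm_le_coef (@mnm0 1) t0 (norm_tail j _ _ (norm_iter n)).
rewrite mdeg0 expr0 mulr1 => /le_trans; apply.
rewrite mulrAC ler_wpM2l ?divr_ge0 ?exprn_ge0 ?(ltW t0) //.
by apply: lerXn2r; rewrite ?nnegrE ?addr_ge0 // lerDl.
Qed.

End OneVariable.

(** * The valuation of Laurent series *)

Lemma numden_tofrac (A : idomainType) (q : {fraction A}) :
  q * tofrac (\d_(repr q)) = tofrac (\n_(repr q)).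
Proof.
rewrite -{1}[q]reprK; set x := repr q; unlock tofrac.
rewrite -[LHS]FracField.pi_mul; apply/eqmodP; rewrite /= FracField.equivfE.
by rewrite /FracField.mulf !numden_Ratio ?(oner_eq0, mulf_neq0, denom_ratioP) //
  !mulr1 mulrC.
Qed.

Section FractionValuation.
Variable K : numFieldType.
Local Notation O := (cps 1 K).
Local Notation F := {fraction O}.
Implicit Types (q r : F) (z w : int) (c : K) (a b u : O).

Definition fT : F := tofrac (cT K).
Definition fC (c : K) : F := tofrac (c *: (1 : O)).

Lemma fT_neq0 : fT != 0. Proof. by rewrite tofrac_eq0 cT_neq0. Qed.
Lemma fTz_neq0 z : fT ^ z != 0. Proof. by rewrite expfz_neq0 // fT_neq0. Qed.

Lemma tofrac_neq0 u : u \is a GRing.unit -> tofrac u != 0 :> F.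
Proof.
by rewrite tofrac_eq0; apply: contraTneq => ->; rewrite unitr0.
Qed.

(** Membership in t^z O replaces the comparison of valuations in the extended
    integers: 0 belongs to all these modules. *)
Definition vge z q : Prop := exists b, q = fT ^ z * tofrac b.
Definition has_val z q : Prop :=
  exists2 u, u \is a GRing.unit & q = fT ^ z * tofrac u.

Lemma vge_0 z : vge z 0.
Proof. by exists 0; rewrite tofrac0 mulr0. Qed.
Lemma vgeD z q r : vge z q -> vge z r -> vge z (q + r).
Proof. by move=> [a ->] [b ->]; exists (a + b); rewrite tofracD mulrDr. Qed.
Lemma vgeN z q : vge z q -> vge z (- q).
Proof. by move=> [a ->]; exists (- a); rewrite tofracN mulrN. Qed.
Lemma vgeB z q r : vge z q -> vge z r -> vge z (q - r).
Proof. by move=> zq zr; apply: vgeD => //; apply: vgeN. Qed.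
Lemma vgeM z w q r : vge z q -> vge w r -> vge (z + w) (q * r).
Proof.
move=> [a ->] [b ->]; exists (a * b).
by rewrite tofracM expfzDr ?fT_neq0 // mulrACA.
Qed.
Lemma vge_tofrac a : vge 0 (tofrac a).
Proof. by exists a; rewrite expr0z mul1r. Qed.
Lemma vgeMO z q a : vge z q -> vge z (tofrac a * q).
Proof. by move=> zq; rewrite -(add0r z); apply: vgeM => //; apply: vge_tofrac. Qed.
Lemma vge_le z w q : w <= z -> vge z q -> vge w q.
Proof.
move=> wz [b ->]; exists (cT K ^+ `|z - w|%N * b).
rewrite tofracM tofracXn mulrA exprnP -expfzDr ?fT_neq0 //.
by congr (_ ^ _ * _); lia.
Qed.
Lemma vge_fTz z : vge z (fT ^ z).
Proof. by exists 1; rewrite tofrac1 mulr1. Qed.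

Lemma has_val_vge z q : has_val z q -> vge z q.
Proof. by move=> [u _ ->]; exists u. Qed.
Lemma has_val_neq0 z q : has_val z q -> q != 0.
Proof.
by move=> [u uu ->]; rewrite mulf_neq0 ?fTz_neq0 ?tofrac_neq0.
Qed.
Lemma has_val_fTz z : has_val z (fT ^ z).
Proof. by exists 1; rewrite ?unitr1 // tofrac1 mulr1. Qed.

Lemma has_valP z q : has_val z q <-> vge z q /\ ~ vge (z + 1) q.
Proof.
split=> [[u uu ->]|[[b ->] nz]].
  split; first by exists u.
  move=> [b]; rewrite expfzDr ?fT_neq0 // -mulrA => /(mulfI (fTz_neq0 z)).
  rewrite expr1z -tofracM => /eqP; rewrite tofrac_eq => /eqP uE; move: uu.
  by rewrite uE cps_unitP rmorphM /= ev0T mul0r eqxx.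
exists b => //; rewrite cps_unitP; apply/eqP => b0; apply: nz.
exists (tail b); rewrite {1}(ev0_eq0P b0) tofracM expfzDr ?fT_neq0 //.
by rewrite expr1z mulrA.
Qed.

Lemma has_val_inj z w q : has_val z q -> has_val w q -> z = w.
Proof.
wlog : z w / z <= w => [wl|zw] hz hw.
  by have [/wl|/ltW/wl] := leP z w; [exact|move=> h; symmetry; exact: h].
have [_ nz] := (has_valP z q).1 hz.
apply/eqP; rewrite eq_le zw leNgt; apply/negP => lt; apply: nz.
by apply: vge_le (has_val_vge hw); lia.
Qed.

Lemma frac_factor q : q != 0 -> exists z, has_val z q.
Proof.
have := numden_tofrac q; set n := \n_(repr q); set d := \d_(repr q) => qd q0.
have d0 : d != 0 by apply: denom_ratioP.
have td0 : tofrac d != 0 :> F by rewrite tofrac_eq0.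
have n0 : n != 0.
  by apply: contraNneq (mulf_neq0 q0 td0) => n0; rewrite qd n0 tofrac0.
have [j [u [uu nE]]] := cps_factor n0; have [k [v [uv dE]]] := cps_factor d0.
exists (j%:Z - k%:Z), (u / v); first by rewrite unitrM unitrV uu uv.
apply: (mulIf (x := tofrac d)); rewrite ?tofrac_eq0 // qd dE nE.
rewrite [tofrac (_ ^+ j * u)]tofracM [tofrac (_ ^+ k * v)]tofracM !tofracXn -/fT.
rewrite [RHS]mulrACA -tofracM divrK // [fT ^+ k]exprnP -expfzDr ?fT_neq0 //.
by rewrite subrK exprnP.
Qed.

(** Whatever numerator t^j u and denominator t^k v are chosen, j - k is the exponent of
    t in the fraction. *)
Lemma frac_valE z q : frac_val q = z%:E <-> has_val z q.
Proof.
have hv w : has_val w q -> frac_val q = w%:E.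
  move=> hw; have q0 := has_val_neq0 hw; rewrite /frac_val (negbTE q0).
  have := numden_tofrac q; set n := \n_(repr q); set d := \d_(repr q) => qd.
  have d0 : d != 0 by apply: denom_ratioP.
  have td0 : tofrac d != 0 :> F by rewrite tofrac_eq0.
  have n0 : n != 0.
    by apply: contraNneq (mulf_neq0 q0 td0) => n0; rewrite qd n0 tofrac0.
  have [j [u [uu nE]]] := cps_factor n0; have [k [v [uv dE]]] := cps_factor d0.
  rewrite nE dE !fps_ord_Tk //; congr (_%:E).
  have [x ux qE] := hw.
  have hn : has_val (w + k%:Z) (tofrac n).
    exists (x * v); first by rewrite unitrM ux uv.
    rewrite -qd qE dE !tofracM tofracXn -/fT exprnP expfzDr ?fT_neq0 //.
    by rewrite mulrACA.
  have hn' : has_val j%:Z (tofrac n) by exists u; rewrite // nE tofracM tofracXn.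
  suff : w + k%:Z = j%:Z by move=> <-; rewrite addrK.
  exact: has_val_inj hn hn'.
split=> [|/hv //]; have [->|q0] := eqVneq q 0; first by rewrite /frac_val eqxx.
by have [w hw] := frac_factor q0; rewrite (hv _ hw) => -[<-].
Qed.

(** The scalar c is the quotient of the leading coefficients. *)
Lemma vge_lead z q r : vge z q -> has_val z r ->
  exists c, vge (z + 1) (q - fC c * r).
Proof.
move=> [a ->] [u uu ->]; exists (ev0 (a / u)).
have bE := tailE (a / u).
rewrite /fC mulrCA -mulrBr -tofracM -tofracB.
exists (tail (a / u) * u).
rewrite expfzDr ?fT_neq0 // expr1z -mulrA; congr (_ * _).
rewrite -tofracM; congr tofrac.
by rewrite -{1}[a](divrK uu) {1}bE mulrDl addrAC subrr add0r mulrA.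
Qed.

Lemma vge_has_val z q w : has_val w q -> vge z q <-> z <= w.
Proof.
move=> hq; split=> [zq|zw]; last exact: vge_le zw (has_val_vge hq).
rewrite leNgt; apply/negP => wz; have [_] := (has_valP w q).1 hq; apply.
by apply: vge_le zq; lia.
Qed.

Lemma has_valM z w q r : has_val z q -> has_val w r -> has_val (z + w) (q * r).
Proof.
move=> [u uu ->] [v uv ->]; exists (u * v); first by rewrite unitrM uu uv.
by rewrite tofracM expfzDr ?fT_neq0 // mulrACA.
Qed.

Lemma has_valV z q : has_val z q -> has_val (- z) q^-1.
Proof.
move=> [u uu ->]; exists u^-1; first by rewrite unitrV.
rewrite invfM -invr_expz; congr (_ * _).
by apply: (mulIf (tofrac_neq0 uu)); rewrite -tofracM !mulVf ?mulVr ?tofrac1 ?tofrac_neq0.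
Qed.

Lemma vge_bounded q : exists z, vge z q.
Proof.
have [->|/frac_factor[z /has_val_vge]] := eqVneq q 0; last by exists z.
by exists 0; apply: vge_0.
Qed.

Lemma fC_is_zmod : zmod_morphism fC.
Proof. by move=> x y; rewrite /fC scalerBl tofracB. Qed.
Lemma fC_is_monoid : monoid_morphism fC.
Proof.
by split=> [|x y]; rewrite /fC ?scale1r ?tofrac1 // -tofracM -scalerAl mul1r scalerA.
Qed.
HB.instance Definition _ := GRing.isZmodMorphism.Build _ _ fC fC_is_zmod.
HB.instance Definition _ := GRing.isMonoidMorphism.Build _ _ fC fC_is_monoid.

Lemma vgeMC z q c : vge z q -> vge z (fC c * q).
Proof. exact: vgeMO. Qed.

End FractionValuation.

(** * The germ inside its total ring of fractions *)

(** An alias of B: the fractions carry one structure over the germ and another one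
    over the complex numbers. *)
Definition restrict_scalars (A B : pzRingType) (f : {rmorphism A -> B}) : Type := B.

Section Restriction.
Variables (A B : pzRingType) (f : {rmorphism A -> B}).
HB.instance Definition _ := GRing.Zmodule.copy (restrict_scalars f) B.

Definition restr_scale (a : A) (x : restrict_scalars f) : restrict_scalars f := f a * (x : B).
Fact restr_scaleA a b x : restr_scale a (restr_scale b x) = restr_scale (a * b) x.
Proof. by rewrite /restr_scale mulrA rmorphM. Qed.
Fact restr_scale1 : left_id 1 restr_scale.
Proof. by move=> x; rewrite /restr_scale rmorph1 mul1r. Qed.
Fact restr_scaleDr : right_distributive restr_scale +%R.
Proof. by move=> a x y; apply: mulrDr. Qed.
Fact restr_scaleDl x : {morph restr_scale^~ x : a b / a + b}.
Proof. by move=> a b; rewrite /restr_scale rmorphD mulrDl. Qed.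
HB.instance Definition _ := GRing.Zmodule_isLmodule.Build A (restrict_scalars f)
  restr_scaleA restr_scale1 restr_scaleDr restr_scaleDl.
End Restriction.

Section Germ.
Variables (R : realType) (p : nat) (D : curve_germ R p) (N : normalization D).
Local Notation K := R[i].
Local Notation O := (Ct R).
Local Notation F := {fraction O}.
Local Notation Q := (Qprod R p).
Local Notation nu := (nu N).
Local Notation emb := (germ_emb N).
Local Notation inA := (germ_in_Q N).
Implicit Types (q r : Q) (a b : D) (c : K) (i j : 'I_p) (v w : 'I_p -> int).

(** The kernels are the minimal primes, and these intersect in the nilradical. *)
Lemma nu_joint_inj a : (forall i, nu i a = 0) -> a = 0.
Proof.
move=> nua; apply: contrapT => /eqP a0.
have [|P minP aP] := @minimal_prime_avoiding D a.
  by move=> k; apply: contraNneq a0 => /germ_reduced ->.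
have /component_ideal_minimal[i Pi] := minP.
by move: aP; rewrite Pi => /negP; apply; apply/(nu_ker N).
Qed.

Lemma component_exists : exists i : 'I_p, True.
Proof.
apply: contrapT => np; have /eqP := @oner_neq0 D; apply.
by apply: nu_joint_inj => i; case: np; exists i.
Qed.

Fact emb_is_zmod : zmod_morphism emb.
Proof. by move=> a b; apply: funext => i; rewrite /germ_emb rmorphB tofracB. Qed.
Fact emb_is_monoid : monoid_morphism emb.
Proof.
split; first by apply: funext => i; rewrite /germ_emb rmorph1 tofrac1.
by move=> a b; apply: funext => i; rewrite /germ_emb rmorphM tofracM.
Qed.
HB.instance Definition _ := GRing.isZmodMorphism.Build _ _ emb emb_is_zmod.
HB.instance Definition _ := GRing.isMonoidMorphism.Build _ _ emb emb_is_monoid.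

Lemma emb_inj : injective emb.
Proof.
move=> a b ab; apply/eqP; rewrite -subr_eq0; apply/eqP/nu_joint_inj => i.
apply/eqP; have /eqP := congr1 (fun q : Q => q i) ab.
by rewrite /germ_emb tofrac_eq rmorphB subr_eq0.
Qed.

Definition scalQ (c : K) : Q := fun=> fC c.
Fact scalQ_is_zmod : zmod_morphism scalQ.
Proof. by move=> a b; apply: funext => i; rewrite /scalQ rmorphB. Qed.
Fact scalQ_is_monoid : monoid_morphism scalQ.
Proof.
by split=> [|a b]; apply: funext => i; rewrite /scalQ ?rmorph1 ?rmorphM.
Qed.
HB.instance Definition _ := GRing.isZmodMorphism.Build _ _ scalQ scalQ_is_zmod.
HB.instance Definition _ := GRing.isMonoidMorphism.Build _ _ scalQ scalQ_is_monoid.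

Lemma emb_alg c : emb (c%:A) = scalQ c.
Proof. by apply: funext => i; rewrite /germ_emb linearZ /= rmorph1. Qed.

Lemma embZ c a : emb (c *: a) = scalQ c * emb a.
Proof. by rewrite -emb_alg -rmorphM -scalerAl mul1r. Qed.

(** Two branches cannot have different residues: a series with zero constant term
    minus a nonzero constant is a unit, and so is its image on each branch. *)
Lemma ev0_nu_lift n (pi : {lrmorphism cps n K -> D}) (G : cps n K) i :
  ev0 (nu i (pi G)) = ev0 G.
Proof.
apply/eqP; apply: contraT => ne; set l := ev0 (nu i (pi G)) in ne *.
pose e : cps n K := l *: 1.
have piE : nu i (pi e) = l *: 1.
  have -> : pi e = l%:A by rewrite /e linearZ rmorph1.
  by rewrite linearZ rmorph1.
have uG : G - e \is a GRing.unit.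
  by rewrite cps_unitP rmorphB /= ev0_const subr_eq0 eq_sym.
have : nu i (pi (G - e)) \is a GRing.unit.
  have [H GH] := unitrPr uG.
  by apply/unitrPr; exists (nu i (pi H)); rewrite -!rmorphM GH !rmorph1.
by rewrite cps_unitP !rmorphB /= piE ev0_const subrr eqxx.
Qed.

Lemma ev0_nu i j a : ev0 (nu i a) = ev0 (nu j a).
Proof.
have [n [pi piE]] := germ_analytic D; have [G ->] := piE a.
by rewrite !ev0_nu_lift.
Qed.

Lemma germ_geometric_sum (c : nat -> K) (X : D) (B L : K) : 0 <= B -> 0 < L ->
  (forall k, `|c k| <= B * L ^+ k) -> (forall i, ev0 (nu i X) = 0) ->
  exists H : nat -> D, forall k, H k = (c k)%:A + X * H k.+1.
Proof.
move=> B0 L0 hc; have [n [pi piE]] := germ_analytic D.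
have [G ->] := piE X => X0.
have [i _] := component_exists.
have G0 : ev0 G = 0 by rewrite -(ev0_nu_lift pi G i).
have [H HE] := cps_geometric_sum B0 L0 hc G0.
by exists (pi \o H) => k; rewrite /= HE rmorphD rmorphM /= linearZ /= rmorph1.
Qed.

Definition comp_at (i : 'I_p) (x : F) : Q := fun j => if j == i then x else 0.

Lemma comp_at_sum q : q = \sum_i comp_at i (q i).
Proof.
apply: funext => j; rewrite fct_sumE (bigD1 j) //= /comp_at eqxx.
by rewrite big1 ?addr0 // => i /negbTE; rewrite eq_sym => ->.
Qed.

(** If b vanished on the branch i, it would kill an element supported on that branch
    alone; such an element comes from writing the i-th idempotent as a fraction. *)
Lemma nzd_nu b : non_zero_divisor b -> forall i, nu i b != 0.
Proof.
move=> nb i; apply/eqP => bi0.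
have [x [y [_ xy]]] := nu_total_fractions N (comp_at i 1).
have /eqP := xy i; rewrite /comp_at eqxx eq_sym => xyi.
have z0 : nu i (x * y) != 0.
  rewrite rmorphM mulf_eq0 -!(tofrac_eq0 (_ : O)); apply/negP => /orP[] /eqP z.
    by move: xyi; rewrite z mul0r eq_sym oner_eq0.
  by move: xyi; rewrite z invr0 mulr0 eq_sym oner_eq0.
move/eqP: z0; apply; rewrite (nb (x * y)) ?rmorph0 //.
apply: nu_joint_inj => j; rewrite rmorphM /=.
have [->|ji] := eqVneq j i; first by rewrite bi0 mul0r.
have /eqP := xy j; rewrite /comp_at (negbTE ji) eq_sym mulf_eq0 invr_eq0.
by rewrite !tofrac_eq0 rmorphM /= => /orP[] /eqP ->; rewrite ?(mul0r, mulr0).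
Qed.

Lemma Q_fraction q : exists a b, (forall i, nu i b != 0) /\ emb b * q = emb a.
Proof.
have [a [b [nb qE]]] := nu_total_fractions N q.
exists a, b; have b0 := nzd_nu nb; split=> //; apply: funext => i.
by rewrite -[LHS]/(emb b i * q i) qE mulrC divfK // tofrac_eq0.
Qed.

Lemma Q_common_denominator (I : finType) (g : I -> Q) : exists b,
  (forall i, nu i b != 0) /\ forall k, inA (emb b * g k).
Proof.
have [b hb] := choice (fun k => Q_fraction (g k)).
have [a ab] := choice hb; exists (\prod_k a k); split=> [i|k].
  by rewrite rmorph_prod; apply/prodf_neq0 => k _; have [ak _] := ab k; exact: ak.
exists (b k * \prod_(l | l != k) a l) => //.
by rewrite [X in _ = emb X * _](bigD1 k) //= !rmorphM /= mulrAC; have [_ <-] := ab k.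
Qed.

(** A parameter: a denominator of 1/t vanishes on each branch. *)
Lemma parameter_exists : exists x : D, forall i, nu i x != 0 /\ ev0 (nu i x) = 0.
Proof.
have [a [b [b0 ab]]] := Q_fraction (fun=> (fT K)^-1).
exists b => i; split=> //.
have /eqP : tofrac (nu i b) = tofrac (nu i a) * fT K.
  have := congr1 (fun q : Q => q i) ab; rewrite /germ_emb /= => <-.
  by rewrite -[X in _ = X * _]/(tofrac (nu i b) * (fT K)^-1) divfK ?fT_neq0.
by rewrite -tofracM tofrac_eq => /eqP ->; rewrite rmorphM /= ev0T mulr0.
Qed.

(** The normalization is generated over the germ by finitely many powers of the
    uniformizers: divide by a parameter and sum the digits inside the germ. *)
Lemma normalization_generators : exists k : 'I_p -> nat,
  forall f : 'I_p -> O, exists h : 'I_p -> nat -> D,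
    forall i, f i = \sum_(j < k i) nu i (h i j) * cT K ^+ j.
Proof.
have [X hX] := parameter_exists.
have facX i : exists k U, U \is a GRing.unit /\ nu i X = cT K ^+ k * U.
  exact: cps_factor (hX i).1.
have [k hk] := choice facX; exists k => f.
suff h i : exists h : nat -> D, f i = \sum_(j < k i) nu i (h j) * cT K ^+ j.
  by have [H HE] := choice h; exists H.
have [U [uU XE]] := hk i.
have [G [c [G0 GE cB]]] := weierstrass_division (f i) uU XE.
have hH (j : nat) : exists H : nat -> D, forall n, H n = (c j n)%:A + X * H n.+1.
  have [B [L [B0 L0 cBL]]] := cB j.
  by apply: (germ_geometric_sum B0 L0 cBL) => l; case: (hX l).
have [H HE] := choice hH; exists (fun j : nat => H j 0%N).
pose S n := \sum_(j < k i) nu i (H j n) * cT K ^+ j.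
have SE n : G n - S n = nu i X * (G n.+1 - S n.+1).
  rewrite GE mulrBr /S mulr_sumr.
  under [X in _ - X = _]eq_bigr => j _.
    rewrite HE rmorphD rmorphM /= linearZ /= rmorph1 mulrDl -scalerAl mul1r -mulrA.
    over.
  by rewrite big_split /= opprD addrACA subrr add0r.
have XS m : G 0%N - S 0%N = nu i X ^+ m * (G m - S m).
  elim: m => [|m IH]; first by rewrite expr0 mul1r.
  by rewrite IH SE mulrA -exprSr.
apply/eqP; rewrite -subr_eq0 -G0; apply/eqP/cps_dvdT_eq0 => n.
exists (tail (nu i X) ^+ n * (G n - S n)).
by rewrite -/(S 0%N) (XS n) mulrA -exprMn -(ev0_eq0P (hX i).2).
Qed.

End Germ.

(** * The conductor *)

Section Conductor.
Variables (R : realType) (p : nat) (D : curve_germ R p) (N : normalization D).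
Local Notation K := R[i].
Local Notation O := (Ct R).
Local Notation F := {fraction O}.
Local Notation Q := (Qprod R p).
Local Notation nu := (nu N).
Local Notation emb := (germ_emb N).
Local Notation inA := (germ_in_Q N).
Local Notation scalQ := (@scalQ R p).
Local Notation comp_at := (@comp_at R p).
Implicit Types (q r : Q) (a b : D) (c : K) (i j : 'I_p) (v w : 'I_p -> int).

Definition vgeQ v q : Prop := forall i, vge (v i) (q i).
Definition has_valQ v q : Prop := forall i, has_val (v i) (q i).

Lemma inAD q r : inA q -> inA r -> inA (q + r).
Proof. by move=> [a _ <-] [b _ <-]; exists (a + b); rewrite ?rmorphD. Qed.
Lemma inAN q : inA q -> inA (- q).
Proof. by move=> [a _ <-]; exists (- a); rewrite ?rmorphN. Qed.
Lemma inAM q r : inA q -> inA r -> inA (q * r).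
Proof. by move=> [a _ <-] [b _ <-]; exists (a * b); rewrite ?rmorphM. Qed.
Lemma inA_emb a : inA (emb a). Proof. by exists a. Qed.
Lemma inA_scalQ c : inA (scalQ c). Proof. by rewrite -(emb_alg N); apply: inA_emb. Qed.
Lemma inA0 : inA 0. Proof. by rewrite -(rmorph0 emb); apply: inA_emb. Qed.
Lemma inA_sum (I : Type) (s : seq I) (P : pred I) (f : I -> Q) :
  (forall k, P k -> inA (f k)) -> inA (\sum_(k <- s | P k) f k).
Proof. by move=> h; elim/big_rec: _ => [|k q /h hk hq]; [exact: inA0|exact: inAD]. Qed.

Lemma inA_vge0 q : inA q -> vgeQ (fun=> 0) q.
Proof. by move=> [a _ <-] i; apply: vge_tofrac. Qed.

Lemma vgeQ_0 v : vgeQ v 0. Proof. by move=> i; apply: vge_0. Qed.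
Lemma vgeQD v q r : vgeQ v q -> vgeQ v r -> vgeQ v (q + r).
Proof. by move=> hq hr i; apply: vgeD. Qed.
Lemma vgeQ_scalQ v c q : vgeQ v q -> vgeQ v (scalQ c * q).
Proof. by move=> hq i; apply: vgeMC. Qed.
Lemma vgeQN v q : vgeQ v q -> vgeQ v (- q).
Proof. by move=> hq i; apply: vgeN. Qed.
Lemma vgeQ_le v w q : (forall i, w i <= v i) -> vgeQ v q -> vgeQ w q.
Proof. by move=> wv hq i; apply: vge_le (wv i) (hq i). Qed.
Lemma vgeQ_comp v i x : vge (v i) x -> vgeQ v (comp_at i x).
Proof.
move=> vx j; rewrite /comp_at; case: eqP => [->//|_]; exact: vge_0.
Qed.

Lemma nzdP q : non_zero_divisor q <-> forall i, q i != 0.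
Proof.
split=> [nq i|q0 y qy]; last first.
  apply: funext => i; have := congr1 (fun r : Q => r i) qy.
  by move=> /eqP; rewrite -[_ i]/(q i * y i) mulf_eq0 (negbTE (q0 i)) => /eqP.
apply/eqP => qi0; have : comp_at i 1 = 0.
  apply: nq; apply: funext => j; rewrite -[LHS]/(q j * comp_at i 1 j) /comp_at.
  by case: eqP => [->|_]; rewrite ?mulr0 // qi0 mul0r.
move=> /(congr1 (fun r : Q => r i)) /eqP; rewrite /comp_at eqxx.
by rewrite -[(0 : Q) i]/(0 : F) oner_eq0.
Qed.

Lemma valuesP (I : set Q) v :
  values I v <-> exists2 q, I q & has_valQ v q.
Proof.
split=> [[q [Iq _ qv]]|[q Iq qv]]; exists q => //; first by move=> i; apply/frac_valE.
split=> //; last by move=> i; apply/frac_valE.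
by apply/nzdP => i; apply: has_val_neq0 (qv i).
Qed.

Lemma comp_atM i x q : comp_at i x * q = comp_at i (x * q i).
Proof.
apply: funext => j; rewrite -[LHS]/(comp_at i x j * q j) /comp_at.
by case: eqP => [->|_]; rewrite ?mul0r.
Qed.

(** Some power of t annihilates the quotient of the normalization by the germ: a
    common denominator of the generators does, and it divides a power of t. *)
Lemma conductor_exists : exists b : nat, forall q, vgeQ (fun=> b%:Z) q -> inA q.
Proof.
have [k hk] := normalization_generators N.
pose M := (\max_i k i)%N.
have [d [d0 hd]] := Q_common_denominator N
   (fun x : 'I_p * 'I_M => comp_at x.1 (fT K ^+ x.2)).
have ex i : exists n : nat, has_val n%:Z (emb d i).
  have [n [u [uu dE]]] := cps_factor (d0 i).
  by exists n, u; rewrite // /germ_emb dE tofracM tofracXn.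
have [n hn] := choice ex.
exists (\max_i n i)%N => q hq.
have ex' i : exists f : O, emb d i * tofrac f = q i.
  have [b bE] : vge 0 ((emb d i)^-1 * q i).
    rewrite -(addNr (n i)%:Z); apply: vgeM; first exact/has_val_vge/has_valV.
    by apply: vge_le (hq i); rewrite lez_nat leq_bigmax.
  exists b; apply: (mulfI (invr_neq0 (has_val_neq0 (hn i)))).
  by rewrite bE mulKf ?(has_val_neq0 (hn i)) // expr0z mul1r.
have [f fE] := choice ex'; have [h hE] := hk f.
rewrite (comp_at_sum q); apply: inA_sum => i _; rewrite -fE hE.
have -> : comp_at i (emb d i * tofrac (\sum_(j < k i) nu i (h i j) * cT K ^+ j))
   = \sum_(j < k i) emb (h i j) * (emb d * comp_at i (fT K ^+ j)).
  apply: funext => l; rewrite fct_sumE /comp_at.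
  have [->|li] := eqVneq l i; last first.
    rewrite big1 // => j _.
    rewrite -[LHS]/(emb (h i j) l * (emb d l * if l == i then _ else 0)).
    by rewrite (negbTE li) !mulr0.
  rewrite rmorph_sum mulr_sumr; apply: eq_bigr => j _.
  rewrite -[RHS]/(emb (h i j) i * (emb d i * if i == i then _ else 0)) eqxx.
  by rewrite /= tofracM tofracXn mulrCA.
apply: inA_sum => j _; apply: inAM; first exact: inA_emb.
have jM : (j < M)%N by apply: leq_trans (ltn_ord j) _; apply: leq_bigmax.
exact: (hd (i, Ordinal jM)).
Qed.

(** Values detect membership: successive approximations by elements of A raise the
    valuations until the remainder lies in t^b O~. *)
Lemma subspace_sub_of_values (P : set Q) (b : nat) :
  (forall q r, P q -> P r -> P (q + r)) -> (forall c q, P q -> P (scalQ c * q)) ->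
  (forall q, vgeQ (fun=> b%:Z) q -> inA q /\ P q) ->
  (forall v q, P q -> has_valQ v q -> exists a : Q, [/\ inA a, P a & has_valQ v a]) ->
  P `<=` inA.
Proof.
move=> PD PZ hb hP.
suff h m : forall (n : 'I_p -> nat) q, (\sum_i n i <= m)%N -> P q ->
    vgeQ (fun i => b%:Z - (n i)%:Z) q -> inA q.
  move=> q Pq; have [z hz] := choice (fun i => vge_bounded (q i)).
  apply: (h _ (fun i => `|b%:Z - z i|%N) _ (leqnn _) Pq) => i.
  by apply: vge_le (hz i); lia.
elim: m => [|m IH] n q nm Pq hq.
  apply: (hb _ _).1 => i; apply: vge_le (hq i).
  by move: nm; rewrite leqn0 sum_nat_eq0 => /forallP/(_ i)/eqP ->; rewrite subr0.
have [n0|] := pselect (forall i, n i = 0%N).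
  by apply: (hb _ _).1 => i; apply: vge_le (hq i); rewrite n0 subr0.
move=> /existsNP[i /eqP ni0].
(* Adding multiples of t^b makes every component nonzero. *)
pose z : Q := fun j => if q j == 0 then fT K ^ b%:Z else 0.
have hz : vgeQ (fun=> b%:Z) z.
  by move=> j; rewrite /z; case: ifP => _; [apply: vge_fTz|apply: vge_0].
have [Az Pz] := hb _ hz.
have Pqz := PD _ _ Pq Pz.
have qz0 j : (q + z) j != 0.
  rewrite -[_ j]/(q j + z j) /z; have [->|qj] := eqVneq (q j) 0; last by rewrite addr0.
  by rewrite add0r fTz_neq0.
have [v hv] := choice (fun j => frac_factor (qz0 j)).
have vn : vgeQ (fun j => b%:Z - (n j)%:Z) (q + z).
  by apply: vgeQD => //; apply: vgeQ_le hz => j; lia.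
have [a [Aa Pa ha]] := hP v (q + z) Pqz hv.
have [c hc] := vge_lead (has_val_vge (hv i)) (ha i).
have le_v j : b%:Z - (n j)%:Z <= v j by apply/(vge_has_val _ (hv j)).
have -> : q = (q + z - scalQ c * a) + scalQ c * a - z by rewrite subrK addrK.
apply: inAD (inAN Az); apply: inAD; last exact: inAM (inA_scalQ c) Aa.
pose n' j := if j == i then (n i).-1 else n j.
apply: (IH n').
- move: nm; rewrite (bigD1 i) //= [X in (X <= m)%N](bigD1 i) //= /n' eqxx.
  rewrite [X in ((n i).-1 + X)%N](eq_bigr n) => [|j /negbTE -> //].
  by move: (\sum_(j | _) n j)%N => S; lia.
- by apply: PD => //; rewrite -mulNr -rmorphN; apply: PZ.
- move=> j; rewrite /n'; have [->|ji] := eqVneq j i.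
    by apply: vge_le hc; have := le_v i; lia.
  apply: vgeB; first exact: vn.
  by apply: vgeMC; apply: vge_le (le_v j) (has_val_vge (ha j)).
Qed.

(** For the direct implication, the prescribed values provide the approximations that
    show t^alpha O~ to lie in A. *)
Lemma values_conductor (alpha : 'I_p -> nat) :
  (forall beta : 'I_p -> nat, values inA (fun i => (alpha i + beta i)%N%:Z)) <->
  (forall q, vgeQ (fun i => (alpha i)%:Z) q -> inA q).
Proof.
split=> [hv|hA beta]; last first.
  apply/valuesP; exists (fun i => fT K ^ (alpha i + beta i)%N%:Z).
    by apply: hA => i; apply: vge_le (vge_fTz K _); rewrite lez_nat leq_addr.
  by move=> i; apply: has_val_fTz.
have [b hb] := conductor_exists.
apply: (@subspace_sub_of_values _ (b + \max_i alpha i)%N).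
- by move=> q r; apply: vgeQD.
- by move=> c q; apply: vgeQ_scalQ.
- move=> q hq; split; first by apply/hb/(vgeQ_le _ hq) => i; lia.
  apply: vgeQ_le hq => i; rewrite lez_nat (leq_trans _ (leq_addl _ _)) //.
  exact: leq_bigmax.
- move=> v q hq qv.
  have av i : (alpha i)%:Z <= v i by apply/(vge_has_val _ (qv i)).
  have /valuesP[a Aa ha] := hv (fun i => `|v i - (alpha i)%:Z|%N).
  have {}ha : has_valQ v a.
    by move=> i; have := ha i; congr (has_val _ _); have := av i; lia.
  exists a; split=> // i; exact: vge_le (av i) (has_val_vge (ha i)).
Qed.

Variable gamma : 'I_p -> nat.
Hypothesis hgamma : is_conductor N gamma.

(** Each branch i has some admissible alpha with alpha_i = gamma_i, and an element is
    the sum of its components. *)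
Lemma conductor_sub q : vgeQ (fun i => (gamma i)%:Z) q -> inA q.
Proof.
case: hgamma => lb glb hq; rewrite (comp_at_sum q); apply: inA_sum => i _.
have [alpha [ha ai]] : exists alpha : 'I_p -> nat,
    (forall q, vgeQ (fun i => (alpha i)%:Z) q -> inA q) /\ (alpha i <= gamma i)%N.
  apply: contrapT => nex.
  have := glb (fun j => gamma j + (j == i))%N _ i; rewrite eqxx addn1 ltnn.
  move=> /(_ _)/negP; apply; rewrite // => alpha /values_conductor ha j.
  have [->|_] := eqVneq j i; last by rewrite addn0; apply: lb; apply/values_conductor.
  by rewrite addn1 ltnNge; apply/negP => le; apply: nex; exists alpha.
by apply/ha/vgeQ_comp/(vge_le _ (hq i)); rewrite lez_nat.
Qed.

(** Otherwise gamma_i could be lowered: the products f x run through all of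
    t_i^z C{t_i}. *)
Lemma conductor_minimal i (z : int) x :
  z < (gamma i)%:Z -> has_val z x -> (forall f : O, inA (comp_at i (tofrac f * x))) -> False.
Proof.
case: hgamma => lb _ zg hx hA.
have gA (w : int) y : w = (gamma i)%:Z - 1 -> vge w y -> inA (comp_at i y).
  move=> wg hy; have zw : z <= w by lia.
  have [u uu xE] := hx; have [d yE] := vge_le zw hy.
  have -> : y = tofrac (d / u) * x; last exact: hA.
  by rewrite xE yE mulrCA -tofracM divrK.
have [g0|g0] := posnP (gamma i).
  have m1 : -1 = (gamma i)%:Z - 1 by rewrite g0.
  have := inA_vge0 (gA _ _ m1 (vge_fTz K (-1))) i; rewrite /comp_at eqxx.
  by move=> /(vge_has_val _ (has_val_fTz K _)).
pose delta j := if j == i then (gamma i).-1 else gamma j.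
have : (gamma i <= delta i)%N.
  apply: lb; apply/values_conductor => q hq; rewrite (comp_at_sum q).
  apply: inA_sum => j _; have [->|ji] := eqVneq j i.
    apply: (gA ((gamma i)%:Z - 1)) => //.
    by have := hq i; rewrite /delta eqxx; congr (vge _ _); lia.
  apply: conductor_sub; apply: vgeQ_comp.
  by have := hq j; rewrite /delta (negbTE ji).
by rewrite /delta eqxx; lia.
Qed.

Lemma conductor_pred_notin i : ~ inA (comp_at i (fT K ^ ((gamma i)%:Z - 1))).
Proof.
move=> hA; apply: (@conductor_minimal i ((gamma i)%:Z - 1) _ _ (has_val_fTz K _)).
  by lia.
move=> f; rewrite (tailE f) tofracD mulrDl.
have -> : comp_at i (fC (ev0 f) * fT K ^ ((gamma i)%:Z - 1)
     + tofrac (cT K * tail f) * fT K ^ ((gamma i)%:Z - 1)) =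
   scalQ (ev0 f) * comp_at i (fT K ^ ((gamma i)%:Z - 1)) +
   comp_at i (tofrac (cT K * tail f) * fT K ^ ((gamma i)%:Z - 1)).
  rewrite [scalQ _ * _]mulrC comp_atM [_ * scalQ _ i]mulrC.
  apply: funext => j; rewrite -[RHS]/(comp_at i _ j + comp_at i _ j) /comp_at.
  by case: eqP => _; rewrite ?addr0.
apply: inAD; first exact: inAM (inA_scalQ _) hA.
apply: conductor_sub; apply: vgeQ_comp; exists (tail f).
rewrite tofracM -/(fT K) mulrAC -{1}(expr1z (fT K)) -expfzDr ?fT_neq0 //.
by congr (_ ^ _ * _); lia.
Qed.

Lemma conductor_dual q : (forall r, vgeQ (fun=> 0) r -> inA (q * r)) ->
  vgeQ (fun i => (gamma i)%:Z) q.
Proof.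
move=> hq i; have [->|/frac_factor[z hz]] := eqVneq (q i) 0; first exact: vge_0.
apply/(vge_has_val _ hz); rewrite leNgt; apply/negP => zg.
apply: (conductor_minimal zg hz) => f; rewrite -comp_atM mulrC; apply: hq.
by apply: vgeQ_comp; apply: vge_tofrac.
Qed.

End Conductor.

(** * Perfect forms *)

(** Of the points x + n y, n a natural number, a subspace that misses x or y
    contains at most one, so large n avoid finitely many such subspaces. *)
Lemma avoid_subspaces (K : numFieldType) (V : lmodType K) (P : set V)
    (I : finType) (Z : I -> set V) :
  submodule P -> (forall i, submodule (Z i)) ->
  (forall i, exists2 x, P x & ~ Z i x) ->
  exists2 x, P x & forall i, ~ Z i x.
Proof.
move=> subP subZ nZ.
suff h (s : seq I) : exists2 x, P x & forall i, i \in s -> ~ Z i x.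
  have [x Px xs] := h (enum I); exists x => // i; apply: xs.
  by rewrite mem_enum.
elim: s => [|j s [x Px xs]]; first by exists 0 => //; exact: submod0 subP.
have [y Py yj] := nZ j.
have line i : ~ Z i y \/ ~ Z i x ->
    exists n0, forall n, (n0 <= n)%N -> ~ Z i (x + n%:R *: y).
  move=> nz; have [[n1 Zn1]|none] := pselect (exists n, Z i (x + n%:R *: y)).
    exists n1.+1 => n n1n Zn.
    have Ziy : Z i y.
      have d0 : (n%:R - n1%:R : K) != 0.
        by rewrite subr_eq0 eqr_nat neq_ltn n1n orbT.
      have -> : y = (n%:R - n1%:R)^-1 *: ((x + n%:R *: y) - (x + n1%:R *: y)).
        by rewrite opprD addrACA subrr add0r -scalerBl scalerA mulVf // scale1r.
      by apply: submodZ => //; apply: submodB.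
    case: nz => // nx; apply: nx.
    rewrite -(addrK (n%:R *: y) x); apply: submodB => //.
    by apply: submodZ.
  by exists 0%N => n _ Zn; apply: none; exists n.
have [f hf] : exists f : I -> nat, forall i, i \in j :: s ->
    forall n, (f i <= n)%N -> ~ Z i (x + n%:R *: y).
  have ex i : exists n0, i \in j :: s ->
      forall n, (n0 <= n)%N -> ~ Z i (x + n%:R *: y).
    have [|] := boolP (i \in j :: s); last by exists 0%N.
    rewrite inE => /orP[/eqP ->|/xs nx]; first by have [n0] := line j (or_introl yj); exists n0.
    by have [n0] := line i (or_intror nx); exists n0.
  by have [f] := choice ex; exists f.
exists (x + (\max_i f i)%N%:R *: y).
  by apply: submodD => //; apply: submodZ.
by move=> i /hf; apply; apply: leq_bigmax.
Qed.

Section Duality.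
Variables (R : realType) (p : nat) (D : curve_germ R p) (N : normalization D).
Local Notation K := R[i].
Local Notation O := (Ct R).
Local Notation F := {fraction O}.
Local Notation Q := (Qprod R p).
Local Notation nu := (nu N).
Local Notation emb := (germ_emb N).
Local Notation inA := (germ_in_Q N).
Local Notation scalQ := (@scalQ R p).
Local Notation comp_at := (@comp_at R p).
Local Notation QA := (restrict_scalars emb).
Local Notation QK := (restrict_scalars scalQ).
Implicit Types (q r : Q) (a b : D) (c : K) (i j : 'I_p) (v w : 'I_p -> int).

Definition in_max a : Prop := forall i, ev0 (nu i a) = 0.

Lemma germ_residue a : exists c, in_max (a - c%:A).
Proof.
have [i0 _] := component_exists N; exists (ev0 (nu i0 a)) => i.
by rewrite rmorphB /= linearZ /= !rmorphB rmorph1 /= ev0_const (ev0_nu N i i0) subrr.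
Qed.

Lemma germ_unit a : ~ in_max a -> exists b, a * b = 1.
Proof.
have [n [pi piE]] := germ_analytic D; have [G ->] := piE a => nm.
have [i0 _] := component_exists N.
have uG : G \is a GRing.unit.
  rewrite cps_unitP; apply/eqP => G0; apply: nm => i.
  by rewrite ev0_nu_lift.
by have [H GH] := unitrPr uG; exists (pi H); rewrite -rmorphM GH rmorph1.
Qed.

Lemma in_max_vge a : in_max a -> vgeQ (fun=> 1) (emb a).
Proof.
move=> ma i; exists (tail (nu i a)); rewrite /germ_emb {1}(ev0_eq0P (ma i)).
by rewrite tofracM expr1z.
Qed.

Lemma submodA_K (S : set Q) : @submodule D QA S -> @submodule K QK S.
Proof.
move=> subS; split; [exact: submod0 subS|exact: submodD subS|].
move=> c q Sq; rewrite -[c *: q]/(scalQ c * q) -(emb_alg N).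
exact: (submodZ subS c%:A Sq).
Qed.

Lemma submodule_inA : @submodule D QA inA.
Proof.
split; [exact: inA0|exact: inAD|by move=> a q; apply: inAM; apply: inA_emb].
Qed.

Lemma vgeQ_lower q : exists z : int, vgeQ (fun=> z) q.
Proof.
have [z hz] := choice (fun i => vge_bounded (q i)).
exists (- (\max_i `|z i|)%N%:Z) => i; apply: vge_le (hz i).
have : (`|z i| <= \max_i `|z i|)%N by apply: leq_bigmax.
by move: (\max_i _)%N => m; lia.
Qed.

(** A nonzero element of Q/S generates a submodule of finite length, so one of its
    multiples is a nonzero socle element. *)
Lemma socle_exists (S : set Q) (z : int) y :
  @submodule D QA S -> (forall q, vgeQ (fun=> z) q -> S q) -> ~ S y ->
  exists a, ~ S (emb a * y) /\ forall m, in_max m -> S (emb m * (emb a * y)).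
Proof.
move=> subS zS nSy; have [z0 hz0] := vgeQ_lower y.
suff h n : forall y', ~ S y' -> vgeQ (fun=> z - n%:Z) y' ->
    exists a, ~ S (emb a * y') /\ forall m, in_max m -> S (emb m * (emb a * y')).
  by apply: (h `|z - z0|%N y nSy) => i; apply: vge_le (hz0 i); lia.
elim: n => [|n IH] y' nSy' hy'.
  by case: nSy'; apply: zS => i; apply: vge_le (hy' i); rewrite subr0.
have [soc|] := pselect (forall m, in_max m -> S (emb m * y')).
  exists 1; rewrite rmorph1 mul1r; split=> //.
move=> /existsNP[m /not_implyP[mm nS]].
have [|a [nSa ha]] := IH (emb m * y') nS.
  by move=> i; have := vgeM (in_max_vge mm i) (hy' i); apply: vge_le; lia.
by exists (a * m); rewrite rmorphM -[_ * _ * y']mulrA.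
Qed.

(** Raising the truncation by one on one branch costs at most one more generator,
    because two elements of J differ there by a scalar at leading order. *)
Lemma subspace_finite_mod (J : set Q) (z : int) (n : 'I_p -> nat) :
  @submodule K QK J -> (forall q, J q -> vgeQ (fun=> z) q) ->
  exists d (e : 'I_d -> Q), (forall k, J (e k)) /\
    forall q, J q -> exists c : 'I_d -> K,
      vgeQ (fun i => z + (n i)%:Z) (q - \sum_k scalQ (c k) * e k).
Proof.
move=> subJ Jz; have [m] : exists m, (\sum_i n i <= m)%N by exists (\sum_i n i)%N.
elim: m n => [|m IH] n nm.
  exists 0%N, (fun=> 0); split=> [k|q Jq]; first exact: submod0 subJ.
  exists (fun=> 0) => i; rewrite big_ord0 subr0; apply: vge_le (Jz _ Jq i).
  by move: nm; rewrite leqn0 sum_nat_eq0 => /forallP/(_ i)/eqP ->; rewrite addr0.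
have [n0|/existsNP[i /eqP ni0]] := pselect (forall i, n i = 0%N).
  exists 0%N, (fun=> 0); split=> [k|q Jq]; first exact: submod0 subJ.
  exists (fun=> 0) => i; rewrite big_ord0 subr0; apply: vge_le (Jz _ Jq i).
  by rewrite n0 addr0.
pose n' j := if j == i then (n i).-1 else n j.
have [|d [e [Je spane]]] := IH n'.
  move: nm; rewrite (bigD1 i) //= [X in (X <= m)%N](bigD1 i) //= /n' eqxx.
  rewrite [X in ((n i).-1 + X)%N](eq_bigr n) => [|j /negbTE -> //].
  by move: (\sum_(j | _) n j)%N => S; lia.
have n'E j : j != i -> n' j = n j by rewrite /n' => /negbTE ->.
have n'i : z + (n i)%:Z = z + (n' i)%:Z + 1 by rewrite /n' eqxx; lia.
have raise q : vgeQ (fun j => z + (n' j)%:Z) q -> vge (z + (n i)%:Z) (q i) ->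
    vgeQ (fun j => z + (n j)%:Z) q.
  move=> hq hqi j; have [->//|ji] := eqVneq j i.
  by have := hq j; rewrite n'E.
have JB q (c : 'I_d -> K) : J q -> J (q - \sum_k scalQ (c k) * e k).
  move=> Jq; apply: (submodB subJ Jq); apply: (@submod_sum _ QK _ subJ) => k.
  exact: (submodZ subJ).
have [small|] := pselect (forall q, J q -> vgeQ (fun j => z + (n' j)%:Z) q ->
    vge (z + (n i)%:Z) (q i)).
  exists d, e; split=> // q Jq; have [c hc] := spane q Jq; exists c.
  by apply: raise => //; apply: small => //; apply: JB.
move=> /existsNP[q0 /not_implyP[Jq0 /not_implyP[hq0 nq0]]].
have vq0 : has_val (z + (n' i)%:Z) (q0 i).
  by apply/has_valP; split; [exact: hq0|rewrite -n'i].
exists d.+1, (fun k => if unlift ord0 k is Some k' then e k' else q0); split.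
  by move=> k; case: unlift.
move=> q Jq; have [c hc] := spane q Jq.
have [c0 hc0] := vge_lead (hc i) vq0.
exists (fun k => if unlift ord0 k is Some k' then c k' else c0).
rewrite big_ord_recl unlift_none; under eq_bigr => k _ do rewrite liftK.
rewrite opprD addrCA addrC.
apply: raise; last by rewrite n'i.
by apply: vgeQD => //; apply: vgeQN; apply: vgeQ_scalQ.
Qed.

Variable gamma : 'I_p -> nat.
Hypothesis hgamma : is_conductor N gamma.

Lemma conductor_big q (z : int) :
  (forall i, (gamma i)%:Z <= z) -> vgeQ (fun=> z) q -> inA q.
Proof.
by move=> gz hq; apply: (conductor_sub hgamma) => i; apply: vge_le (hq i).
Qed.

Definition gmax := (\max_i gamma i)%N.
Lemma vge_gmax_inA q : vgeQ (fun=> gmax%:Z) q -> inA q.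
Proof. by apply: conductor_big => i; rewrite lez_nat leq_bigmax. Qed.

(** Division by g shifts the conductor by the valuation of g. *)
Lemma principal_big (g : Q) : (forall i, g i != 0) ->
  exists z : int, forall q, vgeQ (fun=> z) q -> exists b, q = emb b * g.
Proof.
move=> g0; have [n hn] := choice (fun i => frac_factor (g0 i)).
exists ((\max_i `|n i|)%N%:Z + gmax%:Z) => q hq.
have : inA (fun i => q i * (g i)^-1).
  apply: vge_gmax_inA => i.
  have := vgeM (hq i) (has_val_vge (has_valV (hn i))); apply: vge_le.
  have : (`|n i| <= \max_i `|n i|)%N by apply: leq_bigmax.
  by move: (\max_i _)%N => m; lia.
move=> [b _ bE]; exists b; apply: funext => i.
by rewrite -[RHS]/(emb b i * g i) bE divfK.
Qed.

(** Modulo t^gamma O~, which lies in A, the element q is a scalar multiple of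
    t_i^(gamma_i - 1). *)
Lemma lead_in_subspace (P : set Q) i q : @submodule K QK P -> inA `<=` P -> P q ->
  has_val ((gamma i)%:Z - 1) (q i) ->
  (forall j, j != i -> vge (gamma j)%:Z (q j)) ->
  P (comp_at i (fT K ^ ((gamma i)%:Z - 1))).
Proof.
move=> subP AP Pq qi qj.
have [c hc] := vge_lead (vge_fTz K ((gamma i)%:Z - 1)) qi.
have Pcq : P (scalQ c * q) by apply: (submodZ subP c).
apply: (submodP subP Pcq); apply/AP/(conductor_sub hgamma) => j.
rewrite -[(_ - _) j]/(comp_at i _ j - fC c * q j) /comp_at.
have [->|ji] := eqVneq j i; first by apply: vge_le hc; lia.
by rewrite sub0r; apply/vgeN/vgeMC/qj.
Qed.

(** The pairing (q, r) |-> l (q r) then makes A its own orthogonal. *)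
Definition perfect_form (l : {linear QK -> K^o}) : Prop :=
  (forall q, inA q -> l q = 0) /\
  (forall q, (forall a, l (emb a * q) = 0) -> inA q).

Lemma lformZ (l : {linear QK -> K^o}) c q : l (scalQ c * q) = c * l q.
Proof. by rewrite -[scalQ c * q]/(c *: (q : QK)) linearZ. Qed.

Lemma ker_submodule (l : {linear QK -> K^o}) :
  @submodule K QK [set q | l q = 0].
Proof.
split=> [|x y /= lx ly|c x /= lx]; first exact: linear0.
  by rewrite linearD lx ly addr0.
by rewrite linearZ /= lx scaler0.
Qed.

Definition socle_dual q : Prop := forall m, in_max m -> inA (emb m * q).

(** A form that is 1 on a socle element s of Q/A is perfect: a q outside A has a
    multiple that is a socle element, hence a nonzero multiple of s modulo A. *)
Lemma perfect_form_of_socle :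
  (forall s q, socle_dual s -> ~ inA s -> socle_dual q ->
     exists c, inA (q - scalQ c * s)) ->
  exists l, perfect_form l.
Proof.
move=> soc; have [i0 _] := component_exists N.
have socA y : ~ inA y -> exists a, ~ inA (emb a * y) /\ socle_dual (emb a * y).
  by apply: (@socle_exists inA _ y submodule_inA); exact: vge_gmax_inA.
have [a [nAs sds]] := socA _ (conductor_pred_notin hgamma (i := i0)).
set s := emb a * _ in nAs sds.
have [l [ls lA]] := linear_form_separates (submodA_K submodule_inA) nAs.
exists l; split=> // q lq; apply: contrapT => nAq.
have [b [nAb sdb]] := socA _ nAq.
have [c hc] := soc s _ sds nAs sdb.
have c0 : c = 0.
  have := lq b; rewrite -(subrK (scalQ c * s) (emb b * q)) linearD lA // add0r.
  by rewrite lformZ ls mulr1.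
by apply: nAb; move: hc; rewrite c0 rmorph0 mul0r subr0.
Qed.

(** Duality between the values of A and itself already forces a perfect form: take a
    generic form killing A; its orthogonal contains A and has the same values. *)
Lemma perfect_form_of_values :
  (forall v, Delta (fun i => (gamma i)%:Z - v i - 1) (values inA) = set0 ->
     values inA v) ->
  exists l, perfect_form l.
Proof.
move=> symA; pose w i := comp_at i (fT K ^ ((gamma i)%:Z - 1)).
pose V := QK -> K^o.
pose P := [set f : V | exists2 l : {linear QK -> K^o},
   f = l & forall q, inA q -> l q = 0].
have subP : submodule P.
  split.
  - by exists \0%R.
  - move=> _ _ [l -> lA] [l' -> l'A]; exists (l \+ l')%R => // q Aq /=.
    by rewrite lA // l'A // addr0.
  - by move=> c _ [l -> lA]; exists (c \*: l)%R => // q Aq /=; rewrite lA // scaler0.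
pose Z i := [set f : V | f (w i) = 0].
have [||_ [l -> lA] lw] := @avoid_subspaces K V P 'I_p Z subP.
- move=> i; split=> [//|f g /= fw gw|c f /= fw].
    by rewrite /Z /= -[LHS]/(f (w i) + g (w i)) fw gw addr0.
  by rewrite /Z /= -[LHS]/(c *: f (w i)) fw scaler0.
- move=> i.
  have [l [lw lA]] := linear_form_separates (submodA_K submodule_inA)
                        (conductor_pred_notin hgamma (i := i)).
  by exists (l : QK -> K^o); [exists l|rewrite /Z /= lw => /eqP; rewrite oner_eq0].
exists l; split=> //.
have AP : inA `<=` [set q | forall a, l (emb a * q) = 0].
  by move=> q Aq a; apply: lA; apply: inAM => //; apply: inA_emb.
apply: (@subspace_sub_of_values _ _ _ N _ gmax).
- by move=> q r hq hr a; rewrite mulrDr linearD hq hr addr0.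
- by move=> c q hq a; rewrite mulrCA lformZ hq mulr0.
- by move=> q /vge_gmax_inA Aq; split=> //; apply: AP.
- move=> v q hq qv.
  suff /valuesP[a Aa av] : values inA v by exists a; split=> //; apply: AP.
  apply: symA; rewrite -subset0 => al [i _ [/valuesP[h [b _ bE] hal] ali alj]].
  have hE j : has_val (al j + v j) ((emb b * q) j).
    by rewrite bE; apply: has_valM.
  apply: (lw i); apply: (@lead_in_subspace _ i _ (ker_submodule l)) (hq b) _ _.
  + exact: lA.
  + by have := hE i; rewrite ali; congr (has_val _ _); lia.
  + move=> j ji; apply: vge_le (has_val_vge (hE j)).
    by have := alj j ji; lia.
Qed.

End Duality.

(** * Duality of values from a perfect form *)

Section PerfectForm.
Variables (R : realType) (p : nat) (D : curve_germ R p) (N : normalization D).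
Local Notation K := R[i].
Local Notation O := (Ct R).
Local Notation F := {fraction O}.
Local Notation Q := (Qprod R p).
Local Notation nu := (nu N).
Local Notation emb := (germ_emb N).
Local Notation inA := (germ_in_Q N).
Local Notation scalQ := (@scalQ R p).
Local Notation comp_at := (@comp_at R p).
Local Notation QA := (restrict_scalars emb).
Local Notation QK := (restrict_scalars scalQ).
Local Notation in_max := (in_max N).
Implicit Types (q r : Q) (a b : D) (c : K) (i j : 'I_p) (v w : 'I_p -> int).
Variable gamma : 'I_p -> nat.
Hypothesis hgamma : is_conductor N gamma.

Lemma emb_neq0 x : (forall i, nu i x != 0) -> forall i, emb x i != 0.
Proof. by move=> x0 i; rewrite /germ_emb tofrac_eq0. Qed.

(** The ideal x A contains a power of t, modulo which A is finite-dimensional. *)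
Lemma germ_span_mod x : (forall i, nu i x != 0) ->
  exists d (e : 'I_d -> D), forall a, exists (c : 'I_d -> K) b,
    a = \sum_k c k *: e k + x * b.
Proof.
move=> x0; have [z hz] := principal_big hgamma (emb_neq0 x0).
have [|d [e [Ae spane]]] := @subspace_finite_mod _ _ inA 0 (fun=> `|z|%N)
  (submodA_K (submodule_inA N)).
  by move=> q Aq i; apply: (inA_vge0 Aq).
have [e' e'E] : exists e' : 'I_d -> D, forall k, emb (e' k) = e k.
  have ex k : exists a, emb a = e k by have [a _ <-] := Ae k; exists a.
  by have [f fE] := choice ex; exists f.
exists d, e' => a; have [c hc] := spane _ (inA_emb N a).
have [|b bE] := hz (emb a - \sum_k scalQ (c k) * e k).
  by move=> i; apply: vge_le (hc i); lia.
exists c, b; apply: (@emb_inj _ _ _ N); rewrite rmorphD rmorphM rmorph_sum /=.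
under eq_bigr => k _ do rewrite embZ e'E.
by rewrite [emb x * _]mulrC -bE addrC subrK.
Qed.

(** The kernel of the Gram matrix of the pairing, taken on generators of A/xA,
    consists of the relations between these generators; so the row of values of h
    lies in the row space. *)
Lemma perfect_form_represents (l : {linear QK -> K^o}) x (h : {linear D -> K^o}) :
  perfect_form N l -> (forall i, nu i x != 0) -> (forall a, h (x * a) = 0) ->
  exists q, forall a, h a = l (emb a * q).
Proof.
move=> [lA perf] x0 hx; have [d [e spane]] := germ_span_mod x0.
pose y : Q := fun i => (emb x i)^-1.
have xy : emb x * y = 1.
  by apply: funext => i; rewrite -[LHS]/(emb x i * y i) /y mulfV // emb_neq0.
pose B := \matrix_(j < d, k < d) l (emb (e j * e k) * y).
pose H := \row_(k < d) h (e k).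
have /submxP[v Hv] : (H <= B)%MS.
  rewrite submxE; apply/eqP; move: (cokermx B) (mulmx_coker B) => w Bw.
  apply/matrixP => i0 k0; rewrite mxE [RHS]mxE.
  pose s := \sum_j w j k0 *: e j.
  have : inA (emb s * y).
    apply: perf => a; have [c [b ->]] := spane a.
    have -> : emb (\sum_k c k *: e k + x * b) * (emb s * y) =
        emb (\sum_k c k *: e k) * (emb s * y) + emb (b * s).
      rewrite rmorphD mulrDl; congr (_ + _).
      by rewrite !rmorphM [emb s * y]mulrC mulrACA xy mul1r.
    rewrite linearD [X in _ + X]lA ?addr0; last exact: inA_emb.
    rewrite rmorph_sum mulr_suml linear_sum big1 // => k _ /=.
    rewrite embZ -mulrA lformZ mulrA -rmorphM /s mulr_sumr rmorph_sum mulr_suml.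
    rewrite linear_sum /=.
    have -> : \sum_j l (emb (e k * (w j k0 *: e j)) * y) = (B *m w) k k0.
      rewrite mxE; apply: eq_bigr => j _; rewrite mxE -scalerAr embZ -mulrA lformZ.
      by rewrite mulrC.
    by rewrite Bw mxE mulr0.
  move=> [b _ bE].
  have sE : s = x * b.
    by apply: (@emb_inj _ _ _ N); rewrite rmorphM /= bE mulrCA xy mulr1.
  transitivity (h s); last by rewrite sE hx.
  rewrite /s linear_sum.
  by apply: eq_bigr => j _; rewrite linearZ mxE /= mulrC.
pose u := \sum_j v 0 j *: e j.
exists (y * emb u) => a; have [c [b ->]] := spane a.
have -> : emb (\sum_k c k *: e k + x * b) * (y * emb u) =
    emb (\sum_k c k *: e k) * (y * emb u) + emb (b * u).
  rewrite rmorphD mulrDl; congr (_ + _).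
  by rewrite !rmorphM mulrACA xy mul1r.
rewrite linearD hx addr0 linearD [X in _ = _ + X]lA ?addr0; last exact: inA_emb.
rewrite /u.
rewrite linear_sum rmorph_sum mulr_suml linear_sum; apply: eq_bigr => k _ /=.
rewrite linearZ embZ -mulrA lformZ; congr (_ * _).
have -> : h (e k) = H 0 k by rewrite mxE.
rewrite Hv mxE mulrCA -rmorphM mulr_sumr rmorph_sum mulr_sumr linear_sum.
apply: eq_bigr => j _; rewrite mxE -scalerAr /= embZ mulrCA lformZ.
by rewrite [e k * _]mulrC [y * _]mulrC.
Qed.

Lemma in_max_vgeX x n : in_max x -> vgeQ (fun=> n%:Z) (emb (x ^+ n)).
Proof.
move=> mx; elim: n => [|n IH] i.
  by rewrite expr0 rmorph1; exists 1; rewrite tofrac1 expr0z mulr1.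
rewrite exprS rmorphM; have := vgeM (in_max_vge mx i) (IH i).
by apply: vge_le; lia.
Qed.

Lemma nu_neq0X x n : (forall i, nu i x != 0) -> forall i, nu i (x ^+ n) != 0.
Proof. by move=> x0 i; rewrite rmorphXn /= expf_neq0. Qed.

(** After division by a large power y of a parameter, phi becomes a continuous form
    on A. *)
Lemma perfect_form_representsQ (l phi : {linear QK -> K^o}) (z z' : int) :
  perfect_form N l -> (forall q, vgeQ (fun=> z) q -> phi q = 0) ->
  exists g, forall r, vgeQ (fun=> z') r -> phi r = l (r * g).
Proof.
move=> pl phiz; have [X hX] := parameter_exists N.
have X0 i : nu i X != 0 by case: (hX i).
have mX : in_max X by move=> i; case: (hX i).
pose n := `|gmax gamma - z'|%N; set y := X ^+ n.
have y0 := emb_neq0 (nu_neq0X n X0).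
pose yi : Q := fun i => (emb y i)^-1.
have yyi : emb y * yi = 1.
  by apply: funext => i; rewrite -[LHS]/(emb y i * yi i) /yi mulfV.
have [z0 hz0] := vgeQ_lower yi.
pose hf a : K^o := phi (emb a * yi).
have addh : zmod_morphism hf.
  by move=> a b; rewrite /hf rmorphB mulrBl linearB.
have scah : scalable hf.
  by move=> c a; rewrite /hf embZ -mulrA lformZ.
pose h1 := GRing.isZmodMorphism.Build D K^o hf addh.
pose h2 := GRing.isScalable.Build K D K^o *:%R hf scah.
pose h : {linear D -> K^o} := HB.pack hf h1 h2.
have [|q hq] := @perfect_form_represents l (X ^+ `|z - z0|) h pl (nu_neq0X _ X0).
  move=> a; rewrite /h /= /hf; apply: phiz => i.
  rewrite rmorphM [emb (X ^+ _) * _]mulrC -mulrA.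
  have := vgeM (inA_vge0 (inA_emb N a) i) (vgeM (in_max_vgeX `|z - z0| mX i) (hz0 i)).
  by apply: vge_le; lia.
exists (emb y * q) => r hr.
have [a _ aE] : inA (emb y * r).
  apply: (vge_gmax_inA hgamma) => i; have := vgeM (in_max_vgeX n mX i) (hr i).
  by apply: vge_le; rewrite /n; lia.
have -> : r = emb a * yi by rewrite aE mulrAC yyi mul1r.
have := hq a; rewrite /h /= /hf => ->.
by rewrite -mulrA [yi * _]mulrA [yi * _]mulrC yyi mul1r.
Qed.

Lemma fractional_submodule (I : set Q) : fractional_ideal N I -> @submodule D QA I.
Proof.
move=> [[s ->] _]; split.
- by exists (fun=> 0); rewrite big1 // => k _; rewrite rmorph0 mul0r.
- move=> _ _ [c ->] [c' ->]; exists (fun k => c k + c' k).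
  by rewrite -big_split; apply: eq_bigr => k _; rewrite rmorphD mulrDl.
- move=> a _ [c ->]; exists (fun k => a * c k).
  rewrite -[LHS]/(emb a * _) mulr_sumr; apply: eq_bigr => k _.
  by rewrite rmorphM mulrA.
Qed.

Lemma fractional_big (I : set Q) : fractional_ideal N I ->
  exists z : int, forall q, vgeQ (fun=> z) q -> I q.
Proof.
move=> fI; have subI := fractional_submodule fI; case: fI => _ [g Ig /nzdP g0].
have [z hz] := principal_big hgamma g0; exists z => q /hz[b ->].
exact: (submodZ subI b Ig).
Qed.

Lemma fractional_bounded (I : set Q) : fractional_ideal N I ->
  exists z : int, forall q, I q -> vgeQ (fun=> z) q.
Proof.
move=> [[s ->] _]; have [z hz] := choice (fun k : 'I_(size s) => vgeQ_lower s`_k).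
have [m zm] : exists m : nat, forall k, (`|z k| <= m)%N.
  by exists (\max_k `|z k|)%N => k; apply: leq_bigmax.
exists (- m%:Z) => _ [c ->] i; rewrite fct_sumE.
elim/big_rec: _ => [|k x _ hx]; first exact: vge_0.
apply: vgeD => //; rewrite -[(_ * _) i]/(emb (c k) i * s`_k i); apply: vgeMO.
by apply: vge_le (hz k i); have := zm k; lia.
Qed.

Lemma germ_fractional : fractional_ideal N inA.
Proof.
split; last by exists 1; [exists 1; rewrite ?rmorph1|move=> y; rewrite mul1r].
exists [:: 1]; rewrite eqEsubset; split=> q.
  by move=> [a _ <-]; exists (fun=> a); rewrite big_ord1 mulr1.
by move=> [c ->]; rewrite big_ord1 mulr1; apply: inA_emb.
Qed.

Lemma dual_germ : dual N inA `<=` inA.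
Proof.
move=> q /(_ 1); rewrite mulr1; apply; exists 1 => //; exact: rmorph1.
Qed.

(** For g in the dual and h in I the product g h lies in A, so its value avoids the
    gap of A just below the conductor. *)
Lemma values_dual_Delta (I : set Q) v : values (dual N I) v ->
  Delta (fun i => (gamma i)%:Z - v i - 1) (values I) = set0.
Proof.
move=> /valuesP[g Ig gv]; rewrite -subset0 => al [i _ [/valuesP[h Ih hal] ali alj]].
have hE j : has_val (v j + al j) ((g * h) j) by apply: has_valM.
apply: (conductor_pred_notin hgamma (i := i)).
apply: (lead_in_subspace hgamma (submodA_K (submodule_inA N)) _ (Ig _ Ih)) => //.
  by have := hE i; rewrite ali; congr (has_val _ _); lia.
move=> j ji; apply: vge_le (has_val_vge (hE j)).
by have := alj j ji; lia.
Qed.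

(** For each branch i, emptiness says that t_i^(gamma_i - v_i - 1) lies outside
    I + t^(gamma - v) O~. A linear form separating them is represented by an element g
    of Q, and g lies in I^dual, in t^v O~, and has valuation v_i on the branch i. *)
Lemma Delta_values_dual (l : {linear QK -> K^o}) (I : set Q) v :
  perfect_form N l -> fractional_ideal N I ->
  Delta (fun i => (gamma i)%:Z - v i - 1) (values I) = set0 ->
  values (dual N I) v.
Proof.
move=> pl fI D0; have subI := fractional_submodule fI.
have [zb Ib] := fractional_big fI; have [zl Il] := fractional_bounded fI.
pose W : set Q := [set q | exists h r,
   [/\ I h, vgeQ (fun j => (gamma j)%:Z - v j) r & q = h + r]].
have subW : @submodule K QK W.
  split.
  - exists 0, 0; split; [exact: submod0 subI|exact: vgeQ_0|by rewrite addr0].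
  - move=> _ _ [h [r [Ih hr ->]]] [h' [r' [Ih' hr' ->]]]; exists (h + h'), (r + r').
    by split; [exact: (submodD subI)|exact: vgeQD|rewrite addrACA].
  - move=> c _ [h [r [Ih hr ->]]]; exists (scalQ c * h), (scalQ c * r).
    split; [exact: (submodZ (submodA_K subI) c)|exact: vgeQ_scalQ|].
    exact: mulrDr.
have nW i : ~ W (comp_at i (fT K ^ ((gamma i)%:Z - v i - 1))).
  move=> [h [r [Ih hr wE]]].
  have hi : has_val ((gamma i)%:Z - v i - 1) (h i).
    have hiE : h i = fT K ^ ((gamma i)%:Z - v i - 1) - r i.
      have := congr1 (fun q : Q => q i) wE; rewrite /comp_at eqxx => ->.
      by rewrite -[(h + r) i]/(h i + r i) addrK.
    have [hT nT] := (has_valP _ _).1 (has_val_fTz K ((gamma i)%:Z - v i - 1)).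
    have ri : vge ((gamma i)%:Z - v i - 1 + 1) (r i) by apply: vge_le (hr i); lia.
    apply/has_valP; rewrite hiE; split.
      by apply: vgeB => //; apply: vge_le ri; lia.
    by move=> hv; apply: nT; rewrite -(subrK (r i) (fT K ^ _)); apply: vgeD.
  have hj j : j != i -> vge ((gamma j)%:Z - v j) (h j).
    move=> ji; have := congr1 (fun q : Q => q j) wE; rewrite /comp_at (negbTE ji).
    rewrite -[(h + r) j]/(h j + r j) => /esym/eqP; rewrite addr_eq0 => /eqP ->.
    exact/vgeN/hr.
  pose Z j : int := `|zb|%N%:Z + `|(gamma j)%:Z - v j|%N%:Z.
  pose h' : Q := h + (fun j => if h j == 0 then fT K ^ Z j else 0).
  have Ih' : I h'.
    apply: (submodD subI Ih); apply: Ib => j /=; case: ifP => _; last exact: vge_0.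
    by apply: vge_le (vge_fTz K _); rewrite /Z; lia.
  have h'E j : h' j = h j + (if h j == 0 then fT K ^ Z j else 0) by [].
  have h'0 j : h' j != 0.
    rewrite h'E; have [->|hj0] := eqVneq (h j) 0; last by rewrite addr0.
    by rewrite add0r fTz_neq0.
  have [al hal] := choice (fun j => frac_factor (h'0 j)).
  rewrite -[False]/(@set0 ('I_p -> int) al) -D0; exists i => //; split.
  - by apply/valuesP; exists h'.
  - apply: (has_val_inj (hal i)); rewrite h'E.
    by rewrite (negbTE (has_val_neq0 hi)) addr0.
  - move=> j ji; have : (gamma j)%:Z - v j <= al j; last by lia.
    apply/(vge_has_val _ (hal j)); rewrite h'E; apply: vgeD; first exact: hj.
    case: ifP => _; last exact: vge_0.
    by apply: vge_le (vge_fTz K _); rewrite /Z; lia.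
have [z1 hz1] : exists z1 : int, forall j, z1 <= (gamma j)%:Z - v j - 1.
  pose f j : int := (gamma j)%:Z - v j - 1.
  exists (- (\max_j `|f j|)%N%:Z) => j; rewrite -/(f j).
  have : (`|f j| <= \max_j `|f j|)%N.
    exact: (leq_bigmax (F := fun j => `|f j|%N)).
  by move: (\max_j _)%N => m; lia.
pose zm : int := - `|z1|%N%:Z - `|zl|%N%:Z.
have ex i : exists2 g, (dual N I g /\ vgeQ v g) & ~ vge (v i + 1) (g i).
  have [phi [phiw phiW]] := linear_form_separates subW (nW i).
  have [|g hg] := @perfect_form_representsQ l phi zb zm pl.
    move=> q hq; apply: phiW; exists q, 0; split; [exact: Ib|exact: vgeQ_0|].
    by rewrite addr0.
  have [lA perf] := pl; exists g; first split.
  - move=> h Ih; rewrite mulrC; apply: perf => a.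
    have Iah : I (emb a * h) by apply: (submodZ subI a Ih).
    rewrite mulrA -hg; last by move=> i'; apply: vge_le (Il _ Iah i'); rewrite /zm; lia.
    by apply: phiW; exists (emb a * h), 0; split=> //; [exact: vgeQ_0|rewrite addr0].
  - pose T : Q := fun j => fT K ^ ((gamma j)%:Z - v j).
    have : vgeQ (fun j => (gamma j)%:Z) (T * g).
      apply: (conductor_dual hgamma) => r hr; apply: perf => a.
      have hTr : vgeQ (fun j => (gamma j)%:Z - v j) (emb a * (T * r)).
        move=> j; apply: vgeMO; have := vgeM (vge_fTz K ((gamma j)%:Z - v j)) (hr j).
        by rewrite addr0.
      have -> : emb a * (T * g * r) = emb a * (T * r) * g by rewrite -!mulrA [g * r]mulrC.
      rewrite -hg; last first.
        by move=> j; apply: vge_le (hTr j); rewrite /zm; have := hz1 j; lia.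
      apply: phiW; exists 0, (emb a * (T * r)); split=> //; [exact: submod0 subI|].
      by rewrite add0r.
    move=> hT j; have := vgeM (vge_fTz K (- ((gamma j)%:Z - v j))) (hT j).
    rewrite -[(T * g) j]/(fT K ^ ((gamma j)%:Z - v j) * g j) mulrA.
    rewrite -expfzDr ?fT_neq0 // addNr expr0z mul1r.
    by apply: vge_le; lia.
  - move=> gi; have : l (comp_at i (fT K ^ ((gamma i)%:Z - v i - 1)) * g) = 0.
      apply/lA/(conductor_sub hgamma); rewrite comp_atM; apply: vgeQ_comp.
      have := vgeM (vge_fTz K ((gamma i)%:Z - v i - 1)) gi.
      by apply: vge_le; lia.
    rewrite -hg ?phiw => [/eqP|]; first by rewrite oner_eq0.
    by apply: vgeQ_comp; apply: vge_le (vge_fTz K _); rewrite /zm; have := hz1 i; lia.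
pose P : set Q := [set g | dual N I g /\ vgeQ v g].
pose B i : set Q := [set g | vge (v i + 1) (g i)].
have [|i|//|g [Ig vg] ng] := @avoid_subspaces K QK P 'I_p B.
- split.
  + by split; [move=> h _; rewrite mul0r; exact: inA0|exact: vgeQ_0].
  + move=> x y [Ix vx] [Iy vy]; split; last exact: vgeQD.
    by move=> h Ih; rewrite mulrDl; apply: inAD; [apply: Ix|apply: Iy].
  + move=> c x [Ix vx]; split; last exact: vgeQ_scalQ.
    move=> h Ih; rewrite -[c *: x]/(scalQ c * x) -mulrA.
    by apply: inAM; [exact: inA_scalQ|exact: Ix].
- split; first exact: vge_0.
    by move=> x y hx hy; apply: vgeD.
  by move=> c x hx; apply: vgeMC.
apply/valuesP; exists g => // i; apply/has_valP; split; [exact: vg|exact: ng].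
Qed.

End PerfectForm.

(** * Locality, finite generation of ideals and injectivity of the fractions *)

Section LocalNoetherian.
Variables (R : realType) (p : nat) (D : curve_germ R p) (N : normalization D).
Local Notation K := R[i].
Local Notation O := (Ct R).
Local Notation F := {fraction O}.
Local Notation Q := (Qprod R p).
Local Notation nu := (nu N).
Local Notation emb := (germ_emb N).
Local Notation inA := (germ_in_Q N).
Local Notation scalQ := (@scalQ R p).
Local Notation comp_at := (@comp_at R p).
Local Notation QA := (restrict_scalars emb).
Local Notation QK := (restrict_scalars scalQ).
Local Notation in_max := (in_max N).
Implicit Types (q r : Q) (a b : D) (c : K) (i j : 'I_p) (v w : 'I_p -> int).

(** A proper ideal contains no unit, so its elements have residue 0. *)
Lemma germ_local : local_ring D.
Proof.
have [i0 _] := component_exists N.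
pose M : {pred D} := fun a => `[< in_max a >].
have MP a : a \in M <-> in_max a by split=> /asboolP.
have M1 : 1 \notin M.
  by apply/negP => /MP/(_ i0)/eqP; rewrite !rmorph1 oner_eq0.
have JM (J : {pred D}) : idealr_closed J -> {subset J <= M}.
  move=> [J0 /negP J1 JD] a Ja; apply/MP; apply: contrapT => /germ_unit[b ab].
  by apply: J1; rewrite -ab mulrC -[b * a]addr0; apply: JD.
have idM : idealr_closed M.
  split=> // [|a x y /MP mx /MP my]; first by apply/MP => i; rewrite !rmorph0.
  by apply/MP => i; rewrite rmorphD rmorphM /= rmorphD rmorphM /= mx my mulr0 addr0.
have MJ (J : {pred D}) : idealr_closed J -> {subset M <= J} -> J =i M.
  by move=> idJ MJ x; apply/idP/idP; [exact: JM|exact: MJ].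
exists M; first by split.
by move=> M' [idM' maxM'] x; rewrite -(maxM' M idM (JM _ idM')).
Qed.

Variable gamma : 'I_p -> nat.
Hypothesis hgamma : is_conductor N gamma.

(** T is the set of branches on which J does not vanish. If y in J does not vanish on
    the branch i, then A y contains all that is supported on i with large
    valuation. *)
Lemma ideal_structure (J : set D) : ideal J ->
  exists (T : 'I_p -> Prop) (z : nat),
    (forall a i, J a -> ~ T i -> nu i a = 0) /\
    (forall q, vgeQ (fun=> z%:Z) q -> (forall i, ~ T i -> q i = 0) ->
       exists2 a, J a & emb a = q).
Proof.
move=> idJ; pose T i := exists2 a, J a & nu i a != 0.
have ex i : exists n : nat, T i -> forall x, vge n%:Z x ->
    exists2 a, J a & emb a = comp_at i x.
  have [[y Jy y0]|nT] := pselect (T i); last by exists 0%N.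
  have ey0 : emb y i != 0 by rewrite /germ_emb tofrac_eq0.
  have [w hw] := frac_factor ey0; exists (gmax gamma + `|w|)%N => _ x hx.
  have [a _ aE] : inA (comp_at i (x / emb y i)).
    apply: (vge_gmax_inA hgamma); apply: vgeQ_comp.
    by have := vgeM hx (has_val_vge (has_valV hw)); apply: vge_le; lia.
  exists (a * y); first exact: (submodZ idJ).
  by rewrite rmorphM /= aE comp_atM divfK.
have [n hn] := choice ex; exists T, (\max_i n i)%N; split.
  move=> a i Ja nT; apply: contrapT => /eqP nu0; apply: nT.
  by exists a.
move=> q hq qT.
have ex' i : exists a, J a /\ emb a = comp_at i (q i).
  have [Ti|nTi] := pselect (T i); last first.
    exists 0; split; first exact: (submod0 idJ).
    by rewrite rmorph0 (qT _ nTi); apply: funext => j; rewrite /comp_at; case: eqP.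
  have [|a Ja aE] := hn i Ti (q i); last by exists a.
  by apply: vge_le (hq i); rewrite lez_nat leq_bigmax.
have [a ha] := choice ex'; exists (\sum_i a i).
  by apply: (submod_sum idJ) => i; case: (ha i).
rewrite rmorph_sum [RHS](comp_at_sum q).
by apply: eq_bigr => i _; case: (ha i).
Qed.

Lemma ideal_of_pred (J : {pred D}) : idealr_closed J -> @ideal D [set a | a \in J].
Proof.
move=> [J0 _ JD]; split=> //= [x y Jx Jy|r x Jx].
  by rewrite -[x]mul1r; apply: JD.
by rewrite -[r *: x]/(r * x) -[_ * _]addr0; apply: JD.
Qed.

(** The part of t^z O~ supported on the branches of J is generated in the same way as
    O~, and J is finite-dimensional modulo that part. *)
Lemma ideal_finitely_generated (J : set D) : ideal J ->
  exists d (g : 'I_d -> D), (forall k, J (g k)) /\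
    forall a, J a -> exists c : 'I_d -> D, a = \sum_k c k * g k.
Proof.
move=> idJ; have [T [z [JT TJ]]] := ideal_structure idJ.
suff [I [g [Jg gen]]] : exists (I : finType) (g : I -> D), (forall k, J (g k)) /\
    forall a, J a -> exists c : I -> D, a = \sum_k c k * g k.
  exists #|I|, (g \o enum_val); split=> [k|a /gen[c ->]]; first exact: Jg.
  by exists (c \o enum_val); rewrite (reindex _ (onW_bij _ (enum_val_bij I))).
have [k hk] := normalization_generators N; pose M := (\max_i k i)%N.
pose J' : set Q := [set emb a | a in J].
have subJ' : @submodule K QK J'.
  split; first by exists 0; [exact: (submod0 idJ)|rewrite rmorph0].
    move=> _ _ [a Ja <-] [b Jb <-]; exists (a + b); last exact: rmorphD.
    exact: (submodD idJ).
  move=> c _ [a Ja <-]; exists (c%:A * a); first exact: (submodZ idJ).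
  by rewrite rmorphM /= emb_alg.
have [|d [e [Je spane]]] := @subspace_finite_mod _ _ J' 0 (fun=> z) subJ'.
  by move=> _ [a _ <-] i; apply: vge_tofrac.
have [e' e'P] : exists e' : 'I_d -> D, forall l, J (e' l) /\ emb (e' l) = e l.
  have ex l : exists a, J a /\ emb a = e l by have [a Ja <-] := Je l; exists a.
  by have [f fE] := choice ex; exists f.
have [g gP] : exists g : 'I_p * 'I_M -> D, forall x, J (g x) /\
    (T x.1 -> emb (g x) = comp_at x.1 (fT K ^ (z + x.2)%N%:Z)).
  have ex (x : 'I_p * 'I_M) : exists a, J a /\
      (T x.1 -> emb a = comp_at x.1 (fT K ^ (z + x.2)%N%:Z)).
    have [Tx|nT] := pselect (T x.1); last first.
      by exists 0; split=> //; exact: (submod0 idJ).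
    have [||a Ja aE] := TJ (comp_at x.1 (fT K ^ (z + x.2)%N%:Z)).
    + by apply: vgeQ_comp; apply: vge_le (vge_fTz K _); rewrite lez_nat leq_addr.
    + by move=> i nTi; rewrite /comp_at; case: eqP => // ix; case: nTi; rewrite ix.
    by exists a.
  by have [f fE] := choice ex; exists f.
exists ('I_d + 'I_p * 'I_M)%type, (fun x => match x with inl l => e' l | inr x => g x end).
split; first by case=> [l|x]; [case: (e'P l)|case: (gP x)].
move=> a Ja; have [c hc] := spane _ (ex_intro2 _ _ a Ja erefl).
pose rem := a - \sum_l (c l)%:A * e' l.
have Jrem : J rem.
  apply: (submodB idJ Ja); apply: (submod_sum idJ) => l.
  by apply: (submodZ idJ); case: (e'P l).
have remE : emb rem = emb a - \sum_l scalQ (c l) * e l.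
  rewrite rmorphB rmorph_sum; congr (_ - _); apply: eq_bigr => l _.
  by rewrite rmorphM /= emb_alg; case: (e'P l) => _ ->.
have ex i : exists f, emb rem i = fT K ^ z%:Z * tofrac f.
  by have := hc i; rewrite -remE add0r.
have [f fE] := choice ex; have [h hE] := hk f.
exists (fun x : 'I_d + 'I_p * 'I_M => match x with inl l => (c l)%:A
   | inr x => if `[< T x.1 >] && (x.2 < k x.1)%N then h x.1 x.2 else 0 end).
rewrite big_sumType /=; apply/eqP; rewrite addrC -subr_eq -/rem; apply/eqP.
apply: (@emb_inj _ _ _ N).
pose G i (j : 'I_M) := (if `[< T i >] && (j < k i)%N then h i j else 0) * g (i, j).
transitivity (emb (\sum_i \sum_j G i j)); last first.
  by rewrite pair_bigA; congr emb; apply: eq_bigr => -[].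
rewrite rmorph_sum [LHS]comp_at_sum; apply: eq_bigr => i _ /=.
have [Ti|nTi] := pselect (T i); last first.
  rewrite big1 => [|j _]; last by rewrite /G (asboolF nTi) mul0r.
  rewrite rmorph0 {1}/germ_emb (JT _ _ Jrem nTi) rmorph0.
  by apply: funext => j; rewrite /comp_at; case: eqP.
have kM : (k i <= M)%N by apply: leq_bigmax.
rewrite fE hE.
rewrite (big_ord_widen M (fun j : nat => nu i (h i j) * cT K ^+ j)) //.
rewrite big_mkcond /= !rmorph_sum /= mulr_sumr.
apply: funext => l; rewrite fct_sumE /comp_at.
have [->|li] := eqVneq l i; last first.
  rewrite big1 // => j _; rewrite /G rmorphM /=.
  rewrite -[LHS]/(emb _ l * emb (g (i, j)) l); have [_ /(_ Ti) ->] := gP (i, j).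
  by rewrite /comp_at (negbTE li) mulr0.
apply: eq_bigr => j _; rewrite /G (asboolT Ti) rmorphM /=.
rewrite -[RHS]/(emb _ i * emb (g (i, j)) i); have [_ /(_ Ti) ->] := gP (i, j).
rewrite /comp_at eqxx /=; case: ifP => _; last by rewrite !rmorph0 mulr0 mul0r.
rewrite tofracM tofracXn -/(fT K) mulrCA PoszD expfzDr ?fT_neq0 //.
Qed.

Lemma germ_noetherian : noetherian D.
Proof.
move=> J idJ; have idJ' := ideal_of_pred idJ.
have [d [g [Jg gen]]] := ideal_finitely_generated idJ'.
pose s := [seq g k | k <- enum 'I_d].
have sd : size s = d by rewrite size_map size_enum_ord.
have sE (k : 'I_d) : s`_k = g k.
  by rewrite (nth_map k) ?size_enum_ord // nth_ord_enum.
have sumE (c : 'I_(size s) -> D) :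
    \sum_k c k * s`_k = \sum_k c (cast_ord (esym sd) k) * g k.
  rewrite (reindex (cast_ord (esym sd))) /=; last first.
    by exists (cast_ord sd) => k _; rewrite ?cast_ordK ?cast_ordKV.
  by apply: eq_bigr => k _; rewrite -sE.
exists s => x; split=> [/gen[c ->]|[c ->]].
  exists (c \o cast_ord sd); rewrite sumE; apply: eq_bigr => k _ /=.
  by rewrite cast_ordKV.
rewrite sumE; apply: (submod_sum idJ') => k; exact: (submodZ idJ').
Qed.

(** On a branch where some y in J does not vanish, f is the multiplication by f y / y.
    On another branch f vanishes, as an element supported there kills J. *)
Lemma baer_fractions : baer (QA : lmodType D).
Proof.
move=> J f idJ fD fZ.
have f0 a : J a -> f 0 = 0.
  by move=> Ja; have := fZ 0 a Ja; rewrite mul0r scale0r.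
suff ex i : exists x, forall a, J a -> f a i = emb a i * x.
  have [e he] := choice ex; exists e => a Ja; apply: funext => i.
  exact: he.
have [[y [Jy y0]]|nJ] := pselect (exists y, J y /\ nu i y != 0).
  have ey0 : emb y i != 0 by rewrite /germ_emb tofrac_eq0.
  exists (f y i / emb y i) => a Ja; apply: (mulfI ey0).
  have : emb y * f a = emb a * f y.
    by rewrite -[LHS](fZ y a Ja) -[RHS](fZ a y Jy) mulrC.
  move=> /(congr1 (fun q : Q => q i)).
  rewrite -[LHS]/(emb y i * f a i) -[RHS]/(emb a i * f y i) => ->.
  by rewrite mulrCA; congr (_ * _); rewrite mulrC divfK.
exists 0 => a Ja; rewrite mulr0.
have [z _ zE] : inA (comp_at i (fT K ^ (gmax gamma)%:Z)).
  by apply: (vge_gmax_inA hgamma); apply: vgeQ_comp; apply: vge_fTz.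
have za : z * a = 0.
  apply: (@emb_inj _ _ _ N); rewrite rmorph0 rmorphM /= zE comp_atM.
  have -> : emb a i = 0.
    rewrite /germ_emb; suff -> : nu i a = 0 by rewrite tofrac0.
    by apply: contrapT => /eqP nu0; apply: nJ; exists a.
  by apply: funext => j; rewrite mulr0 /comp_at; case: eqP.
have := fZ z a Ja; rewrite za (f0 a Ja) => /(congr1 (fun q : Q => q i)).
rewrite -[RHS]/(emb z i * f a i) zE /comp_at eqxx => /esym/eqP.
by rewrite mulf_eq0 (negbTE (fTz_neq0 _ _)) => /eqP.
Qed.

End LocalNoetherian.

(** * The resolution by fractions and continuous forms *)

Section ContinuousForms.
Variables (K : fieldType) (A : comAlgType K) (x : A).

(** The K-linear forms on A that are continuous for the x-adic topology. For a local
    algebra with parameter x this is an injective hull of the residue field; A acts by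
    multiplication on the argument. *)
Definition continuous_form (h : A -> K) : Prop :=
  [/\ forall a b, h (a + b) = h a + h b, forall c a, h (c *: a) = c * h a &
      exists n, forall a, h (x ^+ n * a) = 0].

Record cform := CForm { cf :> A -> K; cfP : continuous_form cf }.

Lemma cf_inj : injective cf.
Proof.
by move=> [f Pf] [g Pg] /= fg; move: Pf; rewrite fg => Pf; congr CForm; apply: Prop_irrelevance.
Qed.

Lemma cfD (h : cform) a b : h (a + b) = h a + h b.
Proof. by case: h => h []. Qed.
Lemma cfZ (h : cform) c a : h (c *: a) = c * h a.
Proof. by case: h => h []. Qed.
Lemma cf_cont (h : cform) : exists n, forall m a, (n <= m)%N -> h (x ^+ m * a) = 0.
Proof.
case: h => h [hD hZ [n hn]]; exists n => m a nm.
by rewrite -(subnKC nm) exprD -mulrA; apply: hn.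
Qed.

HB.instance Definition _ := gen_eqMixin cform.
HB.instance Definition _ := gen_choiceMixin cform.

Fact cform_zeroP : continuous_form (fun=> 0).
Proof.
by split=> [a b|c a|]; rewrite ?addr0 ?mulr0 //; exists 0%N.
Qed.
Fact cform_addP (h g : cform) : continuous_form (fun a => h a + g a).
Proof.
split=> [a b|c a|]; first by rewrite !cfD addrACA.
  by rewrite !cfZ mulrDr.
have [n hn] := cf_cont h; have [m gm] := cf_cont g; exists (n + m)%N => a.
by rewrite hn ?leq_addr // gm ?leq_addl // addr0.
Qed.
Fact cform_oppP (h : cform) : continuous_form (fun a => - h a).
Proof.
split=> [a b|c a|]; first by rewrite cfD opprD.
  by rewrite cfZ mulrN.
by have [n hn] := cf_cont h; exists n => a; rewrite hn ?oppr0.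
Qed.
Fact cform_scaleP (r : A) (h : cform) : continuous_form (fun a => h (r * a)).
Proof.
split=> [a b|c a|]; first by rewrite mulrDr cfD.
  by rewrite -scalerAr cfZ.
by have [n hn] := cf_cont h; exists n => a; rewrite mulrCA hn.
Qed.

Definition cform_zero := CForm cform_zeroP.
Definition cform_add h g := CForm (cform_addP h g).
Definition cform_opp h := CForm (cform_oppP h).
Definition cform_scale r h := CForm (cform_scaleP r h).

Fact cform_addA : associative cform_add.
Proof. by move=> f g h; apply/cf_inj/funext => a /=; rewrite addrA. Qed.
Fact cform_addC : commutative cform_add.
Proof. by move=> f g; apply/cf_inj/funext => a /=; rewrite addrC. Qed.
Fact cform_add0 : left_id cform_zero cform_add.
Proof. by move=> f; apply/cf_inj/funext => a /=; rewrite add0r. Qed.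
Fact cform_addN : left_inverse cform_zero cform_opp cform_add.
Proof. by move=> f; apply/cf_inj/funext => a /=; rewrite addNr. Qed.
HB.instance Definition _ := GRing.isZmodule.Build cform
  cform_addA cform_addC cform_add0 cform_addN.

Fact cform_scaleA r s h : cform_scale r (cform_scale s h) = cform_scale (r * s) h.
Proof. by apply/cf_inj/funext => a /=; rewrite mulrCA mulrA. Qed.
Fact cform_scale1 : left_id 1 cform_scale.
Proof. by move=> h; apply/cf_inj/funext => a /=; rewrite mul1r. Qed.
Fact cform_scaleDr : right_distributive cform_scale +%R.
Proof. by move=> r f g; apply/cf_inj/funext. Qed.
Fact cform_scaleDl h : {morph cform_scale^~ h : r s / r + s}.
Proof. by move=> r s; apply/cf_inj/funext => a /=; rewrite mulrDl cfD. Qed.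
HB.instance Definition _ := GRing.Zmodule_isLmodule.Build A cform
  cform_scaleA cform_scale1 cform_scaleDr cform_scaleDl.

Lemma cform_scaleE r (h : cform) a : (r *: h : cform) a = h (r * a).
Proof. by []. Qed.
Lemma cform_addE (h g : cform) a : (h + g : cform) a = h a + g a.
Proof. by []. Qed.

End ContinuousForms.

Section ResolutionOfForm.
Variables (R : realType) (p : nat) (D : curve_germ R p) (N : normalization D).
Local Notation K := R[i].
Local Notation O := (Ct R).
Local Notation F := {fraction O}.
Local Notation Q := (Qprod R p).
Local Notation nu := (nu N).
Local Notation emb := (germ_emb N).
Local Notation inA := (germ_in_Q N).
Local Notation scalQ := (@scalQ R p).
Local Notation QA := (restrict_scalars emb).
Local Notation QK := (restrict_scalars scalQ).
Local Notation in_max := (in_max N).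
Implicit Types (q r : Q) (a b : D) (c : K) (i j : 'I_p) (v w : 'I_p -> int).
Variable gamma : 'I_p -> nat.
Hypothesis hgamma : is_conductor N gamma.
Variables (x : D) (x0 : forall i, nu i x != 0) (mx : in_max x).

(** If x^m a lies in J then a vanishes wherever J does, so x^z a already lies in J for
    a z that depends only on J. *)
Lemma artin_rees (J : set D) n : ideal J ->
  exists m, forall a, J (x ^+ m * a) -> exists2 b, J b & x ^+ m * a = x ^+ n * b.
Proof.
move=> idJ; have [T [z [JT TJ]]] := ideal_structure hgamma idJ.
exists (n + z)%N => a Ja.
exists (x ^+ z * a); last by rewrite exprD mulrA.
have [||b Jb bE] := TJ (emb (x ^+ z * a)).
- rewrite rmorphM => i.
  have := vgeM (in_max_vgeX z mx i) (inA_vge0 (inA_emb N a) i).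
  by rewrite addr0.
- move=> i nTi; have := JT _ i Ja nTi; rewrite rmorphM rmorphXn /=.
  move=> /eqP; rewrite mulf_eq0 (negbTE (expf_neq0 _ (x0 i))) /= => /eqP na0.
  by rewrite /germ_emb rmorphM /= na0 mulr0 tofrac0.
by rewrite -(emb_inj bE).
Qed.

(** Evaluation at 1 turns f into a linear form on J that vanishes on x^n J. By the
    Artin-Rees property it is compatible with 0 on x^m A, and extends to A. *)
Lemma baer_cform : baer (cform x : lmodType D).
Proof.
move=> J f idJ fD fZ.
have f0 : f 0 = 0.
  by have := fZ 0 _ (submod0 idJ); rewrite mul0r scale0r.
have [d [g [Jg gen]]] := ideal_finitely_generated hgamma idJ.
have fsum (c : 'I_d -> D) : f (\sum_k c k * g k) = \sum_k c k *: f (g k).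
  suff [] : J (\sum_k c k * g k) /\ f (\sum_k c k * g k) = \sum_k c k *: f (g k) by [].
  apply: (big_rec2 (fun (a : D) (h : cform x) => J a /\ f a = h)) => [|k b h _ [Jb fb]].
    by split; first exact: (submod0 idJ).
  have Jk : J (c k * g k) by apply: (submodZ idJ).
  by split; [exact: (submodD idJ)|rewrite fD // fZ // fb].
have [n hn] : exists n, forall a b, J a -> f a (x ^+ n * b) = 0.
  have [n hn] := choice (fun k => cf_cont (f (g k))).
  exists (\max_k n k)%N => a b /gen[c ->]; rewrite fsum.
  apply: (big_rec (fun h : cform x => h (x ^+ (\max_k n k)%N * b) = 0)) => [//|k h _ h0].
  rewrite cform_addE h0 addr0 cform_scaleE mulrCA.
  by apply: hn; apply: leq_bigmax.
have fE a b : J a -> f a b = f (b * a) 1.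
  by move=> Ja; rewrite fZ // cform_scaleE mulr1.
have [m hm] := artin_rees n idJ.
pose S : set (D * K^o) :=
  [set z | exists a b, J a /\ z = (a + x ^+ m * b, f a 1)].
have JZ c a : J a -> J (c *: a).
  by move=> Ja; rewrite -[a]mul1r scalerAl; apply: (submodZ idJ).
have [||h hS] := @baer_extension K D K^o S (@baer_field K).
- split.
  + exists 0, 0; split; first exact: (submod0 idJ).
    by rewrite mulr0 addr0 f0.
  + move=> _ _ [a [b [Ja ->]]] [a' [b' [Ja' ->]]]; exists (a + a'), (b + b').
    split; first exact: (submodD idJ).
    by rewrite fD // cform_addE mulrDr addrACA.
  + move=> c _ [a [b [Ja ->]]]; exists (c *: a), (c *: b); split; first exact: JZ.
    congr (_, _); rewrite /= ?scalerDr ?scalerAr //.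
    have -> : c *: a = c%:A * a by rewrite -scalerAl mul1r.
    by rewrite fZ // cform_scaleE mulr1 cfZ.
- move=> e [a [b [Ja [ab ->]]]].
  have aE : a = x ^+ m * (- b) by rewrite mulrN; apply/eqP; rewrite -addr_eq0 -ab.
  have [b' Jb' ->] : exists2 b', J b' & a = x ^+ n * b'.
    by rewrite aE; apply: hm; rewrite -aE.
  by rewrite fZ // cform_scaleE hn.
have hJ a : J a -> h a = f a 1.
  by move=> Ja; apply: hS; exists a, 0; rewrite mulr0 addr0.
have hcont : continuous_form x h.
  split=> [a b|c a|]; [exact: linearD|exact: linearZ|].
  exists m => a; apply: hS; exists 0, a; split; first exact: (submod0 idJ).
  by rewrite add0r f0.
exists (CForm hcont) => a Ja; apply/cf_inj/funext => b.
rewrite cform_scaleE (fE a b Ja) /= [a * b]mulrC hJ //; exact: (submodZ idJ).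
Qed.

Variable l : {linear QK -> K^o}.
Hypothesis pl : perfect_form N l.

Lemma pairing_continuous q : continuous_form x (fun a => l (emb a * q)).
Proof.
split=> [a b|c a|]; first by rewrite rmorphD mulrDl linearD.
  by rewrite embZ -mulrA lformZ.
have [z hz] := vgeQ_lower q; exists `|(gmax gamma)%:Z - z|%N => a.
case: pl => lA _; apply/lA/(vge_gmax_inA hgamma) => i.
rewrite rmorphM -mulrA.
have := vgeM (in_max_vgeX `|(gmax gamma)%:Z - z|%N mx i) (vgeMO (nu i a) (hz i)).
by apply: vge_le; lia.
Qed.

Definition pairing (q : QA) : cform x := CForm (pairing_continuous q).

Fact pairing_zmod : zmod_morphism pairing.
Proof.
move=> q r; apply/cf_inj/funext => a /=; rewrite mulrBr linearB.
by rewrite -[RHS]/(l (emb a * q) - l (emb a * r)).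
Qed.
Fact pairing_scalable : scalable pairing.
Proof.
move=> b q; apply/cf_inj/funext => a /=; congr (l _).
by rewrite -[b *: q]/(emb b * q) rmorphM mulrCA mulrA.
Qed.
HB.instance Definition _ := GRing.isZmodMorphism.Build QA (cform x) pairing pairing_zmod.
HB.instance Definition _ :=
  GRing.isScalable.Build D QA (cform x) *:%R pairing pairing_scalable.

Lemma pairing_eq0 q : pairing q = 0 <-> inA q.
Proof.
case: pl => lA perf; split=> [q0|Aq].
  by apply: perf => a; have := congr1 (fun h : cform x => h a) q0.
by apply/cf_inj/funext => a /=; apply: lA; apply: inAM => //; apply: inA_emb.
Qed.

Lemma pairing_onto (h : cform x) : exists q, h = pairing q.
Proof.
have [n hn] := cf_cont h.
have addh : zmod_morphism (h : D -> K^o).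
  by move=> a b /=; rewrite cfD -scaleN1r cfZ mulN1r.
have scah : scalable (h : D -> K^o) by move=> c a; apply: cfZ.
pose h1 := GRing.isZmodMorphism.Build D K^o (h : D -> K^o) addh.
pose h2 := GRing.isScalable.Build K D K^o *:%R (h : D -> K^o) scah.
pose hl : {linear D -> K^o} := HB.pack (h : D -> K^o) h1 h2.
have [|q hq] := perfect_form_represents hgamma (h := hl) pl (nu_neq0X n x0).
  by move=> a; apply: hn.
by exists q; apply/cf_inj/funext => a; exact: hq.
Qed.

(** The injective resolution 0 -> A -> Q -> Q/A -> 0, in which Q/A is identified by the
    pairing with the continuous forms. *)
Lemma germ_finite_injective_dimension : finite_injective_dimension (D^o : lmodType D).
Proof.
pose E (n : nat) : lmodType D :=
  match n with 0 => QA | 1 => cform x | _ => 'rV[D]_0 end.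
have e_lin : scalable (emb : D^o -> QA) by move=> a b; apply: rmorphM.
have e_add : zmod_morphism (emb : D^o -> QA) by move=> a b; apply: rmorphB.
pose e1 := GRing.isZmodMorphism.Build D^o QA emb e_add.
pose e2 := GRing.isScalable.Build D D^o QA *:%R emb e_lin.
pose e : {linear D^o -> QA} := HB.pack (emb : D^o -> QA) e1 e2.
pose d (n : nat) : {linear E n -> E n.+1} :=
  match n with 0 => pairing | 1 => \0%R | _ => \0%R end.
have zero (y : 'rV[D]_0) : y = 0 by apply/rowP => -[].
exists E, e, d; split.
- case=> [|[|n]] /=.
  + exact: baer_injective (baer_fractions hgamma).
  + exact: baer_injective baer_cform.
  + by move=> M M' f g injf; exists \0%R => y; rewrite /= [g y]zero.
- exact: emb_inj.
- move=> q; rewrite -[d 0 q]/(pairing q) pairing_eq0.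
  by split=> [[a _ <-]|[a ->]]; [exists a|exists a].
- case=> [|n] y /=.
    by split=> // _; apply: pairing_onto.
  by split=> _; [exists 0; rewrite linear0; apply: zero|apply: zero].
- by exists 2%N => -[|[|n]] // _ y; apply: zero.
Qed.

End ResolutionOfForm.

(** * Finite injective dimension and the socle *)

Section SubmoduleType.
Variables (A : pzRingType) (V : lmodType A) (S : set V) (subS : submodule S).

Record subm (H : submodule S) := Subm { subm_val : V; subm_valP : S subm_val }.
Local Notation M := (subm subS).

Lemma subm_val_inj : injective (@subm_val subS).
Proof.
by move=> [x Sx] [y Sy] /= xy; move: Sx; rewrite xy => Sx; congr Subm; apply: Prop_irrelevance.
Qed.

HB.instance Definition _ := gen_eqMixin M.
HB.instance Definition _ := gen_choiceMixin M.

Definition subm_zero : M := Subm _ (submod0 subS).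
Definition subm_add (x y : M) : M :=
  Subm _ (submodD subS (subm_valP x) (subm_valP y)).
Definition subm_opp (x : M) : M := Subm _ (submodN subS (subm_valP x)).
Definition subm_scale (r : A) (x : M) : M := Subm _ (submodZ subS r (subm_valP x)).

Fact subm_addA : associative subm_add.
Proof. by move=> x y z; apply: subm_val_inj; rewrite /= addrA. Qed.
Fact subm_addC : commutative subm_add.
Proof. by move=> x y; apply: subm_val_inj; rewrite /= addrC. Qed.
Fact subm_add0 : left_id subm_zero subm_add.
Proof. by move=> x; apply: subm_val_inj; rewrite /= add0r. Qed.
Fact subm_addN : left_inverse subm_zero subm_opp subm_add.
Proof. by move=> x; apply: subm_val_inj; rewrite /= addNr. Qed.
HB.instance Definition _ := GRing.isZmodule.Build M
  subm_addA subm_addC subm_add0 subm_addN.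

Fact subm_scaleA r s x : subm_scale r (subm_scale s x) = subm_scale (r * s) x.
Proof. by apply: subm_val_inj; rewrite /= scalerA. Qed.
Fact subm_scale1 : left_id 1 subm_scale.
Proof. by move=> x; apply: subm_val_inj; rewrite /= scale1r. Qed.
Fact subm_scaleDr : right_distributive subm_scale +%R.
Proof. by move=> r x y; apply: subm_val_inj; rewrite /= scalerDr. Qed.
Fact subm_scaleDl x : {morph subm_scale^~ x : r s / r + s}.
Proof. by move=> r s; apply: subm_val_inj; rewrite /= scalerDl. Qed.
HB.instance Definition _ := GRing.Zmodule_isLmodule.Build A M
  subm_scaleA subm_scale1 subm_scaleDr subm_scaleDl.

Fact subm_val_zmod : zmod_morphism (@subm_val subS). Proof. by []. Qed.
Fact subm_val_scalable : scalable (@subm_val subS). Proof. by []. Qed.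
HB.instance Definition _ := GRing.isZmodMorphism.Build M V (@subm_val subS) subm_val_zmod.
HB.instance Definition _ :=
  GRing.isScalable.Build A M V *:%R (@subm_val subS) subm_val_scalable.

End SubmoduleType.

(** The map j + r y |-> r e on the ideal J + A y extends to A, and u is its value
    at 1. *)
Lemma injective_extends (A : comNzRingType) (E : lmodType A) (J : set A) (y : A) (e : E) :
  injective_module E -> ideal J -> (forall r, J (r * y) -> r *: e = 0) ->
  exists u, (forall j, J j -> j *: u = 0) /\ y *: u = e.
Proof.
move=> injE idJ wd.
pose J1 : set A^o := [set z | exists r, J (z - r * y)].
have subJ1 : submodule J1.
  split.
  - by exists 0; rewrite mul0r subr0; exact: (submod0 idJ).
  - move=> a b [r Jr] [r' Jr']; exists (r + r').
    by rewrite mulrDl opprD addrACA; exact: (submodD idJ).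
  - move=> t a [r Jr]; exists (t * r).
    by rewrite -[t *: a]/(t * a) -mulrA -mulrBr; exact: (submodZ idJ).
have [g0 hg0] := choice (fun z : subm subJ1 => subm_valP z).
have gE (z : subm subJ1) (r : A) : J (subm_val z - r * y) -> g0 z *: e = r *: e.
  move=> Jr; apply/eqP; rewrite -subr_eq0 -scalerBl; apply/eqP/wd.
  have E1 (t u v : A) : (v - u) * y = (t - u * y) - (t - v * y) by ring.
  rewrite (E1 (subm_val z)); exact: (submodB idJ Jr (hg0 z)).
pose g (z : subm subJ1) := g0 z *: e.
have addg : zmod_morphism g.
  move=> a b; rewrite /g -scalerBl; apply: gE.
  have E2 (t t' u v : A) : (t - t') - (u - v) * y = (t - u * y) - (t' - v * y) by ring.
  rewrite -[subm_val _]/(subm_val a - subm_val b : A) E2.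
  exact: (submodB idJ (hg0 a) (hg0 b)).
have scag : scalable g.
  move=> t a; rewrite /g scalerA; apply: gE.
  rewrite -[subm_val _]/(t * (subm_val a : A)) -mulrA -mulrBr.
  exact: (submodZ idJ t (hg0 a)).
pose g1 := GRing.isZmodMorphism.Build (subm subJ1) E g addg.
pose g2 := GRing.isScalable.Build A (subm subJ1) E *:%R g scag.
pose gl : {linear subm subJ1 -> E} := HB.pack g g1 g2.
have [h hh] := injE _ _ (@subm_val A A^o J1 subJ1 : {linear _ -> _}) gl (@subm_val_inj _ _ _ subJ1).
have hE z r (Jz : J (z - r * y)) : h z = r *: e.
  have J1z : J1 z by exists r.
  by have := hh (Subm subJ1 J1z); rewrite /= => ->; apply: gE.
have hZ z : z *: h 1 = h z by rewrite -linearZ /= -[z *: 1]/(z * 1) mulr1.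
exists (h 1); split=> [j Jj|].
  by rewrite hZ (hE j 0) ?scale0r // mul0r subr0.
by rewrite hZ (hE y 1) ?scale1r // mul1r subrr; exact: (submod0 idJ).
Qed.

Section FiniteInjectiveDimension.
Variables (K : fieldType) (A : comAlgType K) (m : set A) (x : A).
Hypotheses (idm : ideal m) (m1 : ~ m 1) (mx : m x).
Hypothesis x_reg : forall a, x * a = 0 -> a = 0.
Hypothesis m_unit : forall a, ~ m a -> exists b, a * b = 1.
Hypothesis socle : forall J, ideal J -> J x -> ~ J 1 ->
  exists y, ~ J y /\ forall a, m a -> J (a * y).
Hypothesis finite_colength : exists n (g : 'I_n -> A), forall a,
  exists (c : 'I_n -> K) b, a = \sum_k c k *: g k + x * b.

Variables (E : nat -> lmodType A) (e : {linear A^o -> E 0%N})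
  (d : forall i, {linear E i -> E i.+1}).
Hypotheses (injE : forall i, injective_module (E i)) (inj_e : injective e).
Hypotheses (exact0 : exact_at e (d 0%N)) (exactS : forall i, exact_at (d i) (d i.+1)).
Hypothesis bounded : exists n, forall i, (n <= i)%N -> forall y : E i, y = 0.

Definition kills (V : lmodType A) (J : set A) (w : V) : Prop :=
  forall j, J j -> j *: w = 0.

(** Vanishing of the first extension group of A/J by the cosyzygy ker (d i): cocycles
    of E i.+1 killed by J lift to elements killed by J. *)
Definition lifts (i : nat) (J : set A) : Prop :=
  forall w : E i.+1, d i.+1 w = 0 -> kills J w ->
  exists u : E i, d i u = w /\ kills J u.

Lemma d_comp i (u : E i) : d i.+1 (d i u) = 0.
Proof. by apply/exactS; exists u. Qed.

Lemma principal_ideal (y : A) : ideal [set y * b | b in [set: A]].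
Proof.
split; first by exists 0; rewrite ?mulr0.
  by move=> _ _ [b _ <-] [b' _ <-]; exists (b + b'); rewrite ?mulrDr.
by move=> r _ [b _ <-]; exists (r * b); rewrite // mulrCA.
Qed.

Lemma x_divisible i (w : E i) : exists u, x *: u = w.
Proof.
have id0 : @ideal A [set 0].
  by split=> [//|a b -> ->|r a ->]; rewrite ?addr0 ?scaler0.
have [r|u [_ xu]] := injective_extends (y := x) (e := w) (@injE i) id0; last by exists u.
by rewrite /= mulrC => /x_reg ->; rewrite scale0r.
Qed.

Definition ideal_add (J : set A) (y : A) : set A := [set a | exists r, J (a - r * y)].

Lemma ideal_addP (J : set A) (y : A) : ideal J ->
  [/\ ideal (ideal_add J y), J `<=` ideal_add J y & ideal_add J y y].
Proof.
move=> idJ; split; last 2 first.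
- by move=> a Ja; exists 0; rewrite mul0r subr0.
- by exists 1; rewrite mul1r subrr; exact: (submod0 idJ).
split.
- by exists 0; rewrite mul0r subr0; exact: (submod0 idJ).
- move=> a b [r Jr] [r' Jr']; exists (r + r').
  by rewrite mulrDl opprD addrACA; exact: (submodD idJ).
- move=> t a [r Jr]; exists (t * r).
  by rewrite -[t *: a]/(t * a) -mulrA -mulrBr; exact: (submodZ idJ).
Qed.

Lemma kills_add (V : lmodType A) (J : set A) (y : A) (w : V) :
  kills J w -> y *: w = 0 -> kills (ideal_add J y) w.
Proof.
move=> Jw yw a [r Jr]; rewrite -(subrK (r * y) a) scalerDl (Jw _ Jr) add0r.
by rewrite -scalerA yw scaler0.
Qed.

(** Let y be a socle element of A/J. The multiple y w is killed by m, hence lifts; as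
    E i is injective, the lift is y u for some u killed by J, and w minus the image of
    u is killed by the larger ideal J + A y. *)
Lemma lifts_devissage i J : lifts i m -> ideal J -> J x -> lifts i J.
Proof.
move=> lm; have [n [g span]] := finite_colength.
suff h k (f : 'I_k -> A) J' : ideal J' -> J' x ->
    (forall a, exists c : 'I_k -> K, J' (a - \sum_l c l *: f l)) -> lifts i J'.
  move=> idJ Jx; apply: (h n g) => // a; have [c [b ->]] := span a; exists c.
  by rewrite addrAC subrr add0r mulrC; apply: (submodZ idJ).
elim: k f J' => [|k IH] f J' idJ' J'x spanf w dw Jw.
  exists 0; rewrite linear0; split; last by move=> j _; rewrite scaler0.
  have [c] := spanf 1; rewrite big_ord0 subr0 => /Jw.
  by rewrite scale1r.
have [J'1|nJ'1] := pselect (J' 1).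
  exists 0; rewrite linear0; split; last by move=> j _; rewrite scaler0.
  by rewrite -[w]scale1r Jw.
have [y [nJ'y my]] := socle idJ' J'x nJ'1.
have JZ c a : J' a -> J' (c *: a).
  by move=> Ja; rewrite -[a]mul1r scalerAl; apply: (submodZ idJ').
have [c hc] := spanf y.
have [k0 ck0] : exists k0, c k0 != 0.
  apply: contrapT => nc; apply: nJ'y; move: hc; rewrite big1 ?subr0 // => l _.
  have [->|cl] := eqVneq (c l) 0; first by rewrite scale0r.
  by case: nc; exists l.
have [idJ1 JJ1 J1y] := ideal_addP y idJ'.
have lJ1 : lifts i (ideal_add J' y).
  apply: (IH (fun l => f (lift k0 l))) => //; first exact: JJ1.
  move=> a; have [b hb] := spanf a.
  exists (fun l => b (lift k0 l) - b k0 / c k0 * c (lift k0 l)).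
  exists ((b k0 / c k0)%:A); apply: (submodP idJ' hb).
  have := submodN idJ' (JZ (b k0 / c k0) _ hc); congr J'.
  rewrite [in LHS](bigD1_ord k0) // [in RHS](bigD1_ord k0) //=.
  rewrite !scalerBr scalerDr scalerA divfK // scaler_sumr.
  under [in RHS]eq_bigr => l _ do rewrite scalerBl.
  rewrite sumrB -scalerAl mul1r.
  under [in LHS]eq_bigr => l _ do rewrite scalerA.
  set u := b k0 *: f k0; set s1 := \sum_i _; set s2 := \sum_i _; set t := _ *: y.
  by rewrite /=; ring.
have [u1 [du1 mu1]] : exists u1 : E i, d i u1 = y *: w /\ kills m u1.
  apply: lm; first by rewrite linearZ /= dw scaler0.
  by move=> a ma; rewrite scalerA; apply: Jw; apply: my.
have [r Jr|u2 [Ju2 yu2]] := injective_extends (y := y) (e := u1) (@injE i) idJ'.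
  have [mr|/m_unit[b rb]] := pselect (m r); first exact: mu1.
  case: nJ'y; have -> : y = b * (r * y) by rewrite mulrA [b * r]mulrC rb mul1r.
  exact: (submodZ idJ').
have [||u3 [du3 Ju3]] := lJ1 (w - d i u2).
- by rewrite linearB /= dw d_comp subrr.
- apply: kills_add => [j Jj|]; last by rewrite scalerBr -linearZ /= yu2 du1 subrr.
  by rewrite scalerBr -linearZ /= Ju2 // linear0 Jw // subrr.
exists (u2 + u3); split; first by rewrite linearD /= du3 addrC subrK.
by move=> j Jj; rewrite scalerDr Ju2 // add0r; apply: Ju3; apply: JJ1.
Qed.

Lemma xA_proper : ~ [set x * b | b in [set: A]] 1.
Proof.
move=> [b _ xb]; apply: m1; rewrite -xb mulrC; exact: (submodZ idm).
Qed.

Lemma socle_mod_x_unit s r : ~ [set x * b | b in [set: A]] s ->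
  [set x * b | b in [set: A]] (r * s) -> m r.
Proof.
move=> ns [b _ xb]; apply: contrapT => /m_unit[t rt]; apply: ns.
by exists (t * b) => //; rewrite mulrCA xb mulrA [t * r]mulrC rt mul1r.
Qed.

(** Since A/xA contains a copy s of the residue field and x kills the obstruction, the
    vanishing descends from one cosyzygy to the previous one, as long as the latter is
    x-divisible. *)
Lemma lifts_descend i : (forall J, ideal J -> J x -> lifts i.+2 J) -> lifts i.+1 m.
Proof.
move=> lS w dw mw; pose xA : set A := [set x * b | b in [set: A]].
have idx : ideal xA by exact: principal_ideal.
have xAx : xA x by exists 1; rewrite ?mulr1.
have [s [ns ms]] := socle idx xAx xA_proper.
have [r rs|v [xv sv]] := injective_extends (y := s) (e := w) (@injE i.+2) idx.
  by apply: mw; apply: socle_mod_x_unit rs.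
have [idJ JJ Js] := ideal_addP s idx.
have [||u' [du' Ju']] := lS (ideal_add xA s) idJ (JJ _ xAx) (d i.+2 v).
- exact: d_comp.
- apply: kills_add => [j xj|]; first by rewrite -linearZ /= xv // linear0.
  by rewrite -linearZ /= sv.
have [u'' du''] : exists u'', v - u' = d i.+1 u''.
  by apply/exactS; rewrite linearB /= du' subrr.
have [y0 xu''] : exists y0, x *: u'' = d i y0.
  apply/exactS; rewrite linearZ /= -du'' scalerBr xv // (Ju' x) ?subrr //.
  exact: JJ.
have [y1 xy1] := x_divisible y0.
pose u := u'' - d i y1.
have xu : x *: u = 0 by rewrite scalerBr -linearZ /= xy1 xu'' subrr.
have du : d i.+1 u = v - u' by rewrite linearB /= d_comp subr0.
exists (s *: u); split.
  by rewrite linearZ /= du scalerBr sv (Ju' s) // subr0.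
move=> a ma; have [b _ ab] := ms a ma.
by rewrite scalerA -ab mulrC -scalerA xu scaler0.
Qed.

Lemma lifts_first J : ideal J -> J x -> lifts 1 J.
Proof.
have [n hn] := bounded.
suff h k : forall i, (n <= i + k)%N -> forall J, ideal J -> J x -> lifts i.+1 J.
  by apply: (h n 0%N).
elim: k => [|k IH] i nik J' idJ' J'x.
  move=> w _ _; exists 0; split; last by move=> j _; rewrite scaler0.
  by rewrite linear0 [w]hn //; lia.
apply: lifts_devissage => //; apply: lifts_descend.
by apply: IH; rewrite addSnnS.
Qed.

(** Write e 1 = x f in the injective module E 0. Sending a to a' d f and x to 0 defines
    a map to E 1, whose extension to A is corrected by the vanishing of the previous
    lemma to a coboundary d g; then x g = e b for some b in A, and b is the wanted
    multiplier. *)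
Lemma socle_mod_x_cyclic a a' :
  (forall r, m r -> [set x * b | b in [set: A]] (r * a)) ->
  (forall r, m r -> [set x * b | b in [set: A]] (r * a')) ->
  ~ [set x * b | b in [set: A]] a ->
  exists b c, a' = a * b - x * c.
Proof.
move=> ma ma' na; pose xA : set A := [set x * b | b in [set: A]].
have idx : ideal xA by exact: principal_ideal.
have xAx : xA x by exists 1; rewrite ?mulr1.
have [f xf] := x_divisible (e 1).
have eE b : e b = b *: e 1 by rewrite -linearZ /= -[b *: 1]/(b * 1) mulr1.
have de b : d 0%N (e b) = 0 by apply/exact0; exists b.
have xdf : x *: d 0%N f = 0 by rewrite -linearZ /= xf de.
have [r ra|v [xv av]] := injective_extends (y := a) (e := a' *: d 0%N f) (@injE 1%N) idx.
  have [b _ xb] := ma' r (socle_mod_x_unit na ra).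
  by rewrite scalerA -xb mulrC -scalerA xdf scaler0.
have [idJ JJ Ja] := ideal_addP a idx.
have [||u [du Ju]] := lifts_first idJ (JJ _ xAx) (w := d 1%N v).
- exact: d_comp.
- apply: kills_add => [j xj|]; first by rewrite -linearZ /= xv // linear0.
  by rewrite -linearZ /= av linearZ /= d_comp scaler0.
have [g dg] : exists g, v - u = d 0%N g.
  by apply/exactS; rewrite linearB /= du subrr.
have [b xg] : exists b, x *: g = e b.
  apply/exact0; rewrite linearZ /= -dg scalerBr xv // (Ju x) ?subrr //.
  exact: JJ.
have [c agf] : exists c, a *: g - a' *: f = e c.
  apply/exact0; rewrite linearB !linearZ /= -dg scalerBr.
  by rewrite (Ju a) // subr0 av scalerN subrr.
exists b, c; apply/eqP; rewrite eq_sym -subr_eq0; apply/eqP/inj_e.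
rewrite linear0 !linearB /=.
have -> : e (a * b) = x *: (a *: g).
  by rewrite scalerA [x * a]mulrC -scalerA xg -linearZ.
have -> : e (x * c) = x *: e c by rewrite -linearZ.
have -> : e a' = x *: (a' *: f) by rewrite scalerA [x * a']mulrC -scalerA xf -eE.
by rewrite -agf scalerBr subKr subrr.
Qed.

End FiniteInjectiveDimension.

Section SocleOfGorenstein.
Variables (R : realType) (p : nat) (D : curve_germ R p) (N : normalization D).
Local Notation K := R[i].
Local Notation nu := (nu N).
Local Notation emb := (germ_emb N).
Local Notation inA := (germ_in_Q N).
Local Notation in_max := (in_max N).
Local Notation QA := (restrict_scalars emb).
Variable gamma : 'I_p -> nat.
Hypothesis hgamma : is_conductor N gamma.

Lemma max_ideal : @ideal D [set a | in_max a].
Proof.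
split=> [i|a b ma mb i|r a ma i] /=; first by rewrite !rmorph0.
  by rewrite rmorphD rmorphD /= ma mb addr0.
by rewrite -[r *: a]/(r * a) rmorphM rmorphM /= ma mulr0.
Qed.

(** Multiplication by a parameter x maps the socle of Q/A onto that of A/xA. *)
Lemma socle_dual_of_gorenstein : finite_injective_dimension (D^o : lmodType D) ->
  forall s q, socle_dual N s -> ~ inA s -> socle_dual N q ->
  exists c, inA (q - @scalQ R p c * s).
Proof.
move=> [E [e [d [injE inj_e exact0 exactS bounded]]]] s q sds nAs sdq.
have [x hx] := parameter_exists N.
have x0 i : nu i x != 0 by case: (hx i).
have mx : in_max x by move=> i; case: (hx i).
have x_reg a : x * a = 0 -> a = 0.
  move=> xa; apply: (nu_joint_inj (N := N)) => i.
  have /eqP := congr1 (nu i) xa; rewrite rmorphM rmorph0 mulf_eq0.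
  by rewrite (negbTE (x0 i)) => /eqP.
have m1 : ~ [set a | in_max a] (1 : D).
  by have [i0 _] := component_exists N; move=> /(_ i0)/eqP; rewrite !rmorph1 oner_eq0.
have soc (J : set D) : ideal J -> J x -> ~ J 1 ->
    exists y, ~ J y /\ forall a, in_max a -> J (a * y).
  move=> idJ Jx nJ1.
  have subJ : @submodule D QA [set emb a | a in J].
    split; first by exists 0; [exact: (submod0 idJ)|exact: rmorph0].
      move=> _ _ [a Ja <-] [b Jb <-]; exists (a + b); last exact: rmorphD.
      exact: (submodD idJ).
    move=> r _ [a Ja <-]; exists (r * a); last exact: rmorphM.
    exact: (submodZ idJ).
  have J_emb a : [set emb a | a in J] (emb a) -> J a.
    by move=> [b Jb /emb_inj <-].
  have [z hz] := principal_big hgamma (emb_neq0 x0).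
  have [||y [ny my]] := socle_exists (S := [set emb a | a in J]) (z := z) (y := 1) subJ.
  - move=> r /hz[b ->]; exists (b * x); last exact: rmorphM.
    exact: (submodZ idJ).
  - by rewrite -(rmorph1 emb) => /J_emb.
  exists y; rewrite mulr1 in ny; split=> [Jy|a ma]; first by apply: ny; exists y.
  by apply: J_emb; rewrite rmorphM /= -[emb y]mulr1; apply: my.
have [a _ aE] : inA (emb x * s) by apply: sds.
have [a' _ a'E] : inA (emb x * q) by apply: sdq.
have soc_mod r b : inA (emb r * b) -> forall y, emb y = emb x * b ->
    [set x * t | t in [set: D]] (r * y).
  move=> [t _ tE] y yE; exists t => //; apply: (emb_inj (N := N)).
  by rewrite !rmorphM /= tE yE mulrCA.
have [|||b [c bc]] := socle_mod_x_cyclic max_ideal m1 mx x_reg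
    (@germ_unit _ _ _ N) soc (germ_span_mod hgamma x0) injE inj_e exact0 exactS
    bounded (a := a) (a' := a').
- by move=> r mr; apply: (soc_mod r s) => //; apply: sds.
- by move=> r mr; apply: (soc_mod r q) => //; apply: sdq.
- move=> [t _ ta]; apply: nAs; exists t => //.
  apply: funext => i; apply: (mulfI (emb_neq0 x0 i)).
  rewrite -[RHS]/((emb x * s) i) -aE -ta.
  by rewrite -[LHS]/((emb x * emb t) i) -rmorphM.
have [c0 mc0] := germ_residue N b; exists c0.
have -> : q - scalQ c0 * s = emb (b - c0%:A) * s - emb c.
  have : emb x * q = emb x * (emb b * s - emb c).
    by rewrite -a'E bc rmorphB !rmorphM /= aE mulrBr -mulrA [s * _]mulrC.
  move=> /(congr1 (fun q => (fun i => (emb x i)^-1) * q)) xq.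
  have xK (r : Qprod R p) : (fun i => (emb x i)^-1) * (emb x * r) = r.
    apply: funext => i.
    by rewrite -[LHS]/((emb x i)^-1 * (emb x i * r i)) mulKf // emb_neq0.
  rewrite !xK in xq; rewrite xq rmorphB /= mulrBl (emb_alg N).
  by rewrite addrAC.
by apply: inAD; [exact: sds|apply: inAN; apply: inA_emb].
Qed.

End SocleOfGorenstein.

(** * Duality of values and the Gorenstein property *)

Theorem theorem1p2 (R : realType) (p : nat) (D : curve_germ R p)
    (N : normalization D) (gamma : 'I_p -> nat)
    (hgamma : is_conductor N gamma) :
  gorenstein_local_ring D <->
  (forall I : set (Qprod R p), fractional_ideal N I ->
   forall v : 'I_p -> int,
     values (dual N I) v <->
     Delta (fun i => (gamma i)%:Z - v i - 1) (values I) = set0).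
Proof.
split=> [[_ _ finj] I fI v|duality].
  have [l pl] := perfect_form_of_socle hgamma (socle_dual_of_gorenstein hgamma finj).
  split; [exact: values_dual_Delta|exact: Delta_values_dual pl fI].
have [l pl] : exists l, perfect_form N l.
  apply: (perfect_form_of_values hgamma) => v /(duality _ (germ_fractional N)).
  by move=> /valuesP[q /dual_germ Aq qv]; apply/valuesP; exists q.
have [x hx] := parameter_exists N.
have x0 i : nu N i x != 0 by case: (hx i).
have mx : in_max N x by move=> i; case: (hx i).
split; [exact: germ_noetherian hgamma|exact: germ_local N|].
exact: (germ_finite_injective_dimension hgamma x0 mx pl).
Qed.
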